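(* For any $1\leq p_1<p<p_2\leq\infty$, the space $H^p(\mathbb{T}^\infty)$ is not an interpolation space for the pair $(H^{p_1}(\mathbb{T}^\infty),H^{p_2}(\mathbb{T}^\infty))$.
   Context: $\mathbb{T}^\infty=\mathbb{T}\times\mathbb{T}\times\cdots$ is the countably infinite product of the unit circle $\mathbb{T}\subset\mathbb{C}$, equipped with its normalized Haar measure $m_\infty$ (the countable product of the normalized arclength measure $m$ on each circle). For a positive rational number $q\in\mathbb{Q}^+$ and $\chi=(\chi_1,\chi_2,\dots)\in\mathbb{T}^\infty$, put $\chi(q)=\prod_j\chi_j^{k_j}$, where $k_j\in\mathbb{Z}$ is the exponent of the $j$-th prime number in the prime factorization of $q$. The Fourier coefficients of $f\in L^1(\mathbb{T}^\infty)$ are $\widehat f(q)=\int_{\mathbb{T}^\infty}f(\chi)\overline{\chi(q)}\,\mathrm{d}m_\infty(\chi)$, $q\in\mathbb{Q}^+$. For $1\leq p\leq\infty$, $H^p(\mathbb{T}^\infty)=\{f\in L^p(\mathbb{T}^\infty):\widehat f(q)=0\text{ for all }q\in\mathbb{Q}^+\setminus\mathbb{Z}^+\}$, with the $L^p$ norm, where $\mathbb{Z}^+$ denotes the positive integers. Interpolation space has its usual meaning: for a compatible couple of Banach spaces $(X_1,X_2)$, a Banach space $X$ with continuous inclusions $X_1\cap X_2\subseteq X\subseteq X_1+X_2$ is an interpolation space for $(X_1,X_2)$ if every linear operator $T:X_1+X_2\to X_1+X_2$ that restricts to a bounded operator $X_1\to X_1$ and to a bounded operator $X_2\to X_2$ also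 restricts to a bounded operator $X\to X$. Here $X_j=H^{p_j}(\mathbb{T}^\infty)$, and since $p_1<p_2$ we have $X_2\subseteq X\subseteq X_1$ for $X=H^p(\mathbb{T}^\infty)$. *)

(* Defs.v *)
From HB Require Import structures.
From mathcomp Require Import all_boot all_order all_algebra.
From mathcomp Require Import all_classical all_reals all_analysis.
From mathcomp Require Import measurable_realfun ess_sup_inf.
From mathcomp Require Import complex.

Set Implicit Arguments.
Unset Strict Implicit.
Unset Printing Implicit Defensive.

Import Order.TTheory GRing.Theory Num.Theory.
Import numFieldNormedType.Exports.
Import Normc.

Local Open Scope classical_set_scope.
Local Open Scope ring_scope.
Local Open Scope complex_scope.
Local Open Scope quotient_scope.

(* R[i] carries its Borel sigma-algebra, generated by Re and Im. *)
Definition complex_display : measure_display.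
Proof. exact. Qed.

Section complex_measurable.
Variable R : realType.

Local Notation S :=
  (@g_sigma_preimageU _ _ R R R[i] (@complex.Re R) (@complex.Im R)).

HB.instance Definition _ := isPointed.Build R[i] 0.

Let S0 : S set0. Proof. exact: sigma_algebra0. Qed.
Let SC A : S A -> S (~` A). Proof. exact: sigma_algebraC. Qed.
Let SU (F : _^nat) : (forall i, S (F i)) -> S (\bigcup_i F i).
Proof. exact: sigma_algebra_bigcup. Qed.

HB.instance Definition _ :=
  @isMeasurable.Build complex_display R[i] S S0 SC SU.

End complex_measurable.

Lemma measurable_complexP d (T : measurableType d) (R : realType)
    (f : T -> R[i]) :
  measurable_fun setT f <->
  measurable_fun setT (@complex.Re R \o f) /\
  measurable_fun setT (@complex.Im R \o f).
Proof.
have mRe : measurable_fun setT (@complex.Re R).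
  by move=> _ B mB; apply: sub_sigma_algebra; left; exists B.
have mIm : measurable_fun setT (@complex.Im R).
  by move=> _ B mB; apply: sub_sigma_algebra; right; exists B.
split=> [mf|[mr mi]].
  by split; exact: measurableT_comp.
apply: (@measurability _ _ _ _ _ _
  (preimage_set_system setT (@complex.Re R) measurable `|`
   preimage_set_system setT (@complex.Im R) measurable)) => //.
move=> _ [_ [[B mB <-]|[B mB <-]] <-].
  by rewrite !setTI -comp_preimage -[X in measurable X]setTI; exact: mr.
by rewrite !setTI -comp_preimage -[X in measurable X]setTI; exact: mi.
Qed.

Section measurable_complex_ops.
Context d (T : measurableType d) (R : realType).
Implicit Types f g : T -> R[i].

Lemma measurable_complexD f g : measurable_fun setT f ->
  measurable_fun setT g -> measurable_fun setT (f \+ g).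
Proof.
move=> /measurable_complexP[fr fi] /measurable_complexP[gr gi].
apply/measurable_complexP; split.
  rewrite (_ : _ \o _ = (@complex.Re R \o f) \+ (@complex.Re R \o g)).
    exact: measurable_funD.
  by apply/funext => t /=; case: (f t); case: (g t).
rewrite (_ : _ \o _ = (@complex.Im R \o f) \+ (@complex.Im R \o g)).
  exact: measurable_funD.
by apply/funext => t /=; case: (f t); case: (g t).
Qed.

Lemma measurable_complexM f g : measurable_fun setT f ->
  measurable_fun setT g -> measurable_fun setT (f \* g).
Proof.
move=> /measurable_complexP[fr fi] /measurable_complexP[gr gi].
apply/measurable_complexP; split.
  rewrite (_ : _ \o _ = ((@complex.Re R \o f) \* (@complex.Re R \o g)) \-
                        ((@complex.Im R \o f) \* (@complex.Im R \o g))).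
    by apply: measurable_funB; exact: measurable_funM.
  by apply/funext => t /=; case: (f t); case: (g t).
rewrite (_ : _ \o _ = ((@complex.Re R \o f) \* (@complex.Im R \o g)) \+
                      ((@complex.Im R \o f) \* (@complex.Re R \o g))).
  by apply: measurable_funD; exact: measurable_funM.
by apply/funext => t /=; case: (f t); case: (g t).
Qed.

Lemma measurable_complexN f : measurable_fun setT f ->
  measurable_fun setT (\- f).
Proof.
move=> mf; rewrite (_ : \- f = cst (-1) \* f); first exact: measurable_complexM.
by apply/funext => t /=; rewrite mulN1r.
Qed.

Lemma measurable_normc f : measurable_fun setT f ->
  measurable_fun setT (fun t => normc (f t)).
Proof.
move=> /measurable_complexP[fr fi].
rewrite (_ : (fun _ => _) = (fun t => Num.sqrt t) \o
   (fun t => complex.Re (f t) ^+ 2 + complex.Im (f t) ^+ 2)); last first.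
  by apply/funext => t /=; case: (f t).
apply: measurableT_comp; first exact: continuous_measurable_fun (@sqrt_continuous R).
by apply: measurable_funD; exact: measurable_funX.
Qed.

End measurable_complex_ops.

(* L^0(mu): complex measurable functions modulo mu-almost everywhere equality,
   as a complex vector space. *)
Section L0.
Context d (T : measurableType d) (R : realType).
Variable mu : {measure set T -> \bar R}.

Let ae_app (P Q : T -> Prop) : (\forall t \ae mu, P t -> Q t) ->
  (\forall t \ae mu, P t) -> \forall t \ae mu, Q t.
Proof. exact: filter_app. Qed.

Definition L0 : Type := {mfun_ mu, T >-> R[i]}.
HB.instance Definition _ := Choice.on L0.
HB.instance Definition _ := EqQuotient.on L0.
Definition fun_of_L0 (f : L0) : T -> R[i] := repr f.
Coercion fun_of_L0 : L0 >-> Funclass.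

Lemma measurable_L0 (f : L0) : measurable_fun setT f.
Proof. exact: measurable_funPT. Qed.

Definition L0_class (f : T -> R[i]) (mf : measurable_fun setT f) : L0 :=
  \pi_L0 (mfun_Sub (mem_set mf)).

Lemma L0_classE f (mf : measurable_fun setT f) :
  (L0_class mf : T -> R[i]) = f %[ae mu].
Proof.
rewrite /L0_class /fun_of_L0; case: piP => g /eqmodP/= /asboolP.
exact: ae_eq_sym.
Qed.

Lemma L0P (f g : L0) : (f : T -> R[i]) = g %[ae mu] -> f = g.
Proof.
by move=> fg; rewrite -[f]reprK -[g]reprK; apply/eqmodP/asboolP.
Qed.

Definition L0_zero : L0 := L0_class (measurable_cst (0 : R[i])).
Definition L0_opp (f : L0) : L0 :=
  L0_class (measurable_complexN (measurable_L0 f)).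
Definition L0_add (f g : L0) : L0 :=
  L0_class (measurable_complexD (measurable_L0 f) (measurable_L0 g)).
Definition L0_scale (a : R[i]) (f : L0) : L0 :=
  L0_class (measurable_complexM (measurable_cst a) (measurable_L0 f)).

Let L0_addA : associative L0_add.
Proof.
move=> f g h; apply: L0P.
have fg := L0_classE (measurable_complexD (measurable_L0 f) (measurable_L0 g)).
have gh := L0_classE (measurable_complexD (measurable_L0 g) (measurable_L0 h)).
have f_gh := L0_classE
  (measurable_complexD (measurable_L0 f) (measurable_L0 (L0_add g h))).
have fg_h := L0_classE
  (measurable_complexD (measurable_L0 (L0_add f g)) (measurable_L0 h)).
apply: (ae_app _ fg); apply: (ae_app _ gh).
apply: (ae_app _ f_gh); apply: (ae_app _ fg_h); apply: nearW => t /=.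
move=> /(_ I) e1 /(_ I) e2 /(_ I) e3 /(_ I) e4 _.
by rewrite e1 e2 e3 e4 addrA.
Qed.

Let L0_addC : commutative L0_add.
Proof.
move=> f g; apply: L0P.
have := L0_classE (measurable_complexD (measurable_L0 f) (measurable_L0 g)).
have := L0_classE (measurable_complexD (measurable_L0 g) (measurable_L0 f)).
by apply: filterS2 => t /= /(_ I) e1 /(_ I) e2 _; rewrite e1 e2 addrC.
Qed.

Let L0_add0 : left_id L0_zero L0_add.
Proof.
move=> f; apply: L0P.
have := L0_classE (measurable_complexD (measurable_L0 L0_zero) (measurable_L0 f)).
have := L0_classE (measurable_cst (0 : R[i])).
by apply: filterS2 => t /= /(_ I) e1 /(_ I) e2 _; rewrite e2 e1 add0r.
Qed.

Let L0_addN : left_inverse L0_zero L0_opp L0_add.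
Proof.
move=> f; apply: L0P.
have := L0_classE
  (measurable_complexD (measurable_L0 (L0_opp f)) (measurable_L0 f)).
have := L0_classE (measurable_complexN (measurable_L0 f)).
have := L0_classE (measurable_cst (0 : R[i])).
apply: filterS3 => t /= /(_ I) e1 /(_ I) e2 /(_ I) e3 _.
by rewrite e3 e2 e1 addNr.
Qed.

HB.instance Definition _ :=
  GRing.isZmodule.Build L0 L0_addA L0_addC L0_add0 L0_addN.

Lemma L0_0E : ((0 : L0) : T -> R[i]) = cst 0 %[ae mu].
Proof. exact: L0_classE. Qed.

Lemma L0_oppE (f : L0) : ((- f : L0) : T -> R[i]) = \- f %[ae mu].
Proof. exact: L0_classE. Qed.

Lemma L0_addE (f g : L0) : ((f + g : L0) : T -> R[i]) = f \+ g %[ae mu].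
Proof. exact: L0_classE. Qed.

Let L0_scaleE' a (f : L0) : (L0_scale a f : T -> R[i]) = cst a \* f %[ae mu].
Proof. exact: L0_classE. Qed.

Let L0_scaleA a b (f : L0) : L0_scale a (L0_scale b f) = L0_scale (a * b) f.
Proof.
apply: L0P; have := L0_scaleE' a (L0_scale b f).
have := L0_scaleE' b f; have := L0_scaleE' (a * b) f.
apply: filterS3 => t /= /(_ I) e1 /(_ I) e2 /(_ I) e3 _.
by rewrite e3 e2 e1 mulrA.
Qed.

Let L0_scale1 : left_id 1 L0_scale.
Proof.
move=> f; apply: L0P; have := L0_scaleE' 1 f.
by apply: filterS => t /= /(_ I) -> _; rewrite mul1r.
Qed.

Let L0_scaleDr : right_distributive L0_scale +%R.
Proof.
move=> a f g; apply: L0P.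
have af_ag := L0_addE (L0_scale a f) (L0_scale a g).
apply: (ae_app _ (L0_scaleE' a (f + g))); apply: (ae_app _ (L0_addE f g)).
apply: (ae_app _ (L0_scaleE' a f)); apply: (ae_app _ (L0_scaleE' a g)).
apply: (ae_app _ af_ag); apply: nearW => t /=.
move=> /(_ I) e1 /(_ I) e2 /(_ I) e3 /(_ I) e4 /(_ I) e5 _.
by rewrite e1 e2 e3 e5 e4 mulrDr.
Qed.

Let L0_scaleDl f : {morph L0_scale^~ f : a b / a + b}.
Proof.
move=> a b; apply: L0P.
have af_bf := L0_addE (L0_scale a f) (L0_scale b f).
apply: (ae_app _ (L0_scaleE' (a + b) f)).
apply: (ae_app _ (L0_scaleE' a f)); apply: (ae_app _ (L0_scaleE' b f)).
apply: (ae_app _ af_bf); apply: nearW => t /=.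
move=> /(_ I) e1 /(_ I) e2 /(_ I) e3 /(_ I) e4 _.
by rewrite e1 e2 e3 e4 mulrDl.
Qed.

HB.instance Definition _ := GRing.Zmodule_isLmodule.Build R[i] L0
  L0_scaleA L0_scale1 L0_scaleDr L0_scaleDl.

Lemma L0_scaleE a (f : L0) : ((a *: f : L0) : T -> R[i]) = cst a \* f %[ae mu].
Proof. exact: L0_scaleE'. Qed.

End L0.

Lemma Lnorm_nondecreasing d (T : measurableType d) (R : realType)
    (P : probability T R) (p q : \bar R) (g : T -> R) :
  measurable_fun setT g -> (1 <= p)%E -> (p <= q)%E ->
  ('N[P]_p[EFin \o g] <= 'N[P]_q[EFin \o g])%E.
Proof.
move=> mg.
have P1 : (P : {measure set T -> \bar R}) setT = 1%E := probability_setT P.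
have mgp r : measurable_fun setT (fun x => `|g x| `^ r).
  apply: (@measurableT_comp _ _ _ _ _ _ (@powR R ^~ r)) => //.
  exact: measurableT_comp.
case: p q => [p| |] [q| |]// p1.
- rewrite le_eqVlt => /predU1P[[->]//|]; rewrite lte_fin => pq.
  have p0 : 0 < p by rewrite (lt_le_trans ltr01).
  have q0 : 0 < q by rewrite (lt_trans p0).
  have := @hoelder _ _ _ P (fun x => `|g x| `^ p) (cst 1)
    (q / p) (1 - (q / p)^-1)^-1 (mgp p) (measurable_cst _).
  rewrite (_ : (_ \* cst 1) = (fun x => `|g x| `^ p)); last first.
    by apply/funext => x /=; rewrite mulr1.
  rewrite Lnorm_cst1 P1 poweR1r mule1 divr_gt0// invr_gt0 subr_gt0.
  rewrite invf_lt1 ?divr_gt0// ltr_pdivlMr// mul1r pq invrK subrKC.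
  move=> /(_ erefl erefl erefl).
  rewrite unlock /Lnorm invr1 poweRe1; last first.
    by apply: integral_ge0 => x _; exact: poweR_ge0.
  move=> h.
  have e1 : (\int[P]_x (`|(EFin \o (fun y => (`|g y| `^ p)%R)) x| `^ 1) =
     \int[P]_x `|(EFin \o g) x| `^ p)%E.
    apply: eq_integral => x _ /=.
    by rewrite powRr1// ger0_norm ?powR_ge0.
  have e2 : (\int[P]_x (`|(EFin \o (fun y => (`|g y| `^ p)%R)) x| `^ (q / p)%R) =
     \int[P]_x `|(EFin \o g) x| `^ q)%E.
    apply: eq_integral => x _ /=.
    by rewrite ger0_norm ?powR_ge0// -powRrM mulrCA divff ?gt_eqF// mulr1.
  move: h; rewrite e1 e2 => h.
  have -> : (q^-1 = (q / p)^-1 * p^-1)%R.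
    by rewrite invf_div mulrAC divff ?gt_eqF// mul1r.
  rewrite poweRrM; apply: gt0_ler_poweR => //.
  + by rewrite invr_ge0 ltW.
  + by rewrite in_itv/= leey integral_ge0.
  + by rewrite in_itv/= leey poweR_ge0.
- move=> _; have p0 : 0 < p by rewrite (lt_le_trans ltr01).
  rewrite unlock /Lnorm P1 lte01.
  have := @ess_sup_ge _ _ _ P (abse \o (EFin \o g)).
  have s0 : (0 <= ess_sup P (abse \o (EFin \o g)))%E.
    apply: ess_sup_gee; first by rewrite P1 lte01.
    by apply: nearW => x /=; rewrite lee_fin.
  case: (ess_sup _ _) s0 => [M| |]// M0 gM; last by rewrite leey.
  rewrite lee_fin in M0.
  apply: (@le_trans _ _ ((\int[P]_x (M `^ p)%R%:E) `^ p^-1)%E).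
    apply: gt0_ler_poweR.
    + by rewrite invr_ge0 ltW.
    + by rewrite in_itv/= leey integral_ge0.
    + by rewrite in_itv/= leey integral_ge0// => x _; rewrite lee_fin powR_ge0.
    apply: ae_ge0_le_integral => //.
    + by move=> x _; rewrite lee_fin powR_ge0.
    + exact/measurable_EFinP.
    + by move=> x _; rewrite lee_fin powR_ge0.
    + apply: filterS gM => x /= gM _.
      by rewrite lee_fin ge0_ler_powR// ?nnegrE// ltW.
  rewrite integral_cst// P1 mule1 poweR_EFin -powRrM.
  by rewrite divff ?gt_eqF// powRr1.
Qed.

(* A linear subspace of V with a norm of its own; the values of ns_norm outside
   the subspace are irrelevant. The vector space and norm axioms and
   completeness are not recorded: the notion of interpolation space below makes
   sense without them, and is used for spaces known to be Banach spaces. *)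
Record normed_subspace (R : realType) (V : lmodType R[i]) := NormedSubspace {
  ns_carrier :> V -> Prop;
  ns_norm : V -> R }.

Section interpolation.
Context (R : realType) (V : lmodType R[i]).
Implicit Types X Y : normed_subspace V.

Definition ns_cap X Y : normed_subspace V :=
  NormedSubspace (fun v => X v /\ Y v) (fun v => Num.max (ns_norm X v) (ns_norm Y v)).

(* X + Y, with the norm inf { |x| + |y| : v = x + y }. *)
Definition ns_sum X Y : normed_subspace V :=
  NormedSubspace
    (fun v => exists x y, [/\ X x, Y y & v = x + y])
    (fun v => inf [set r | exists x y,
       [/\ X x, Y y, v = x + y & r = ns_norm X x + ns_norm Y y]]).

Definition bounded_from_to X Y (A : V -> V) :=
  exists M : R, forall x, X x -> Y (A x) /\ ns_norm Y (A x) <= M * ns_norm X x.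

Definition linear_operator_on X (A : V -> V) :=
  (forall x, X x -> X (A x)) /\
  (forall (a : R[i]) x y, X x -> X y -> A (a *: x + y) = a *: A x + A y).

Definition continuous_inclusion X Y := bounded_from_to X Y id.

Definition interpolation_space X1 X2 X :=
  [/\ continuous_inclusion (ns_cap X1 X2) X,
      continuous_inclusion X (ns_sum X1 X2) &
      forall A : V -> V, linear_operator_on (ns_sum X1 X2) A ->
        bounded_from_to X1 X1 A -> bounded_from_to X2 X2 A ->
        bounded_from_to X X A].

End interpolation.

Record circle (R : realType) :=
  Circle { circle_val :> R[i]; circleP : normc circle_val == 1 }.

HB.instance Definition _ R := [isSub for @circle_val R].
HB.instance Definition _ R := [Choice of circle R by <:].

Section circle.
Variable R : realType.

Lemma normc_expi (t : R) : normc (cos t +i* sin t) == 1.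
Proof. by rewrite /= cos2Dsin2 sqrtr1. Qed.

Definition expi (t : measurableTypeR R) : circle R := Circle (normc_expi t).

HB.instance Definition _ := isPointed.Build (circle R) (expi 0).

Local Notation circle_preim := (g_sigma_algebra_preimageType (@circle_val R)).
Local Notation S := (g_sigma_algebra_preimage (@circle_val R)).

Let S0 : S set0. Proof. exact: (@measurable0 _ circle_preim). Qed.
Let SC A : S A -> S (~` A). Proof. exact: (@measurableC _ circle_preim). Qed.
Let SU (F : _^nat) : (forall i, S (F i)) -> S (\bigcup_i F i).
Proof. exact: (@bigcupT_measurable _ circle_preim). Qed.

HB.instance Definition _ := @isMeasurable.Build
  (preimage_display (@circle_val R)) (circle R) S S0 SC SU.

Lemma measurable_expi : measurable_fun setT expi.
Proof.
move=> _ _ [B mB <-]; rewrite !setTI -comp_preimage -[X in measurable X]setTI.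
have : measurable_fun setT (@circle_val R \o expi).
  by apply/measurable_complexP; split; apply: continuous_measurable_fun;
    [exact: continuous_cos|exact: continuous_sin].
by apply.
Qed.

HB.instance Definition _ :=
  @isMeasurableFun.Build _ _ (measurableTypeR R) (circle R) expi measurable_expi.

Lemma twopi_gt0 : 0 < 2 * pi :> R.
Proof. by rewrite mulr_gt0// pi_gt0. Qed.

(* normalized arclength: the image under t |-> e^(it) of the uniform
   probability on [0, 2 pi] *)
Definition arclength : probability (circle R) R :=
  distribution (uniform_prob twopi_gt0)
    (expi : {mfun measurableTypeR R >-> circle R}).

End circle.

(* The infinite torus, with the product (= Borel) sigma-algebra. *)
Definition Tinf (R : realType) : Type := nat -> circle R.

Definition Tinf_display : measure_display.
Proof. exact. Qed.

Section Tinf.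
Variable R : realType.

HB.instance Definition _ := Pointed.copy (Tinf R) (nat -> circle R).

Local Notation S := (<<s \bigcup_(j in [set: nat])
  preimage_set_system setT (fun chi : Tinf R => chi j) measurable >>).

Let S0 : S set0. Proof. exact: sigma_algebra0. Qed.
Let SC A : S A -> S (~` A). Proof. exact: sigma_algebraC. Qed.
Let SU (F : _^nat) : (forall i, S (F i)) -> S (\bigcup_i F i).
Proof. exact: sigma_algebra_bigcup. Qed.

HB.instance Definition _ :=
  @isMeasurable.Build Tinf_display (Tinf R) S S0 SC SU.

End Tinf.

(* m is the countable product of the normalized arclength measures, that is, the
   normalized Haar measure. There is exactly one such m, since the rectangles
   form a pi-system generating the sigma-algebra. *)
Definition is_haar_Tinf (R : realType) (m : probability (Tinf R) R) :=
  forall (n : nat) (A : nat -> set (circle R)),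
    (forall j, measurable (A j)) ->
    m [set chi | forall j, (j < n)%N -> A j (chi j)] =
    (\prod_(j < n) arclength R (A j))%E.

(* The number of primes smaller than p: coordinates of Tinf are numbered from
   0, so the prime p is attached to the coordinate chi (prime_index p). *)
Definition prime_index (p : nat) : nat := count prime (iota 0 p).

(* The exponent of p in the prime factorization of q > 0. *)
Definition prime_exponent (p : nat) (q : rat) : int :=
  (logn p `|numq q|)%:Z - (logn p `|denq q|)%:Z.

Definition torus_character (R : realType) (chi : Tinf R) (q : rat) : R[i] :=
  \prod_(p <- primes (`|numq q| * `|denq q|))
    (circle_val (chi (prime_index p))) ^ prime_exponent p q.

Definition complex_integral d (T : measurableType d) (R : realType)
    (mu : {measure set T -> \bar R}) (f : T -> R[i]) : R[i] :=
  (\int[mu]_x complex.Re (f x)) +i* (\int[mu]_x complex.Im (f x)).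

Section Hardy.
Context (R : realType) (m : probability (Tinf R) R).

Definition fourier_coefficient (f : Tinf R -> R[i]) (q : rat) : R[i] :=
  complex_integral m (fun chi => f chi * conjc (torus_character chi q)).

Definition Lp_norm (p : \bar R) (f : Tinf R -> R[i]) : \bar R :=
  ('N[m]_p[(fun chi => (normc (f chi))%:E)])%E.

(* H^p, as a subspace of L^0 with the L^p norm. *)
Definition Hardy (p : \bar R) : normed_subspace (L0 m) :=
  NormedSubspace
    (fun f : L0 m => (Lp_norm p f < +oo)%E /\
       forall q : rat, 0 < q -> q \isn't a Num.int ->
         fourier_coefficient f q = 0)
    (fun f : L0 m => fine (Lp_norm p f)).

End Hardy.

Lemma circle_invE (R : realType) (z : circle R) :
  (circle_val z)^-1 = conjc (circle_val z).
Proof.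
case: z => -[a b] /= /eqP ab.
have {}ab : a ^+ 2 + b ^+ 2 = 1.
  by rewrite -[LHS]sqr_sqrtr ?addr_ge0 ?sqr_ge0// ab expr1n.
rewrite -[LHS]/((a / (a ^+ 2 + b ^+ 2)) -i* (b / (a ^+ 2 + b ^+ 2))).
by rewrite ab !divr1.
Qed.

Section measurable_torus_character.
Variable R : realType.

Lemma measurable_complexX d (T : measurableType d) (f : T -> R[i]) n :
  measurable_fun setT f -> measurable_fun setT (fun t => f t ^+ n).
Proof.
move=> mf; elim: n => [|n ih]; first exact: measurable_cst.
rewrite (_ : (fun _ => _) = f \* (fun t => f t ^+ n)).
  exact: measurable_complexM.
by apply/funext => t /=; rewrite exprS.
Qed.

Lemma measurable_conjc d (T : measurableType d) (f : T -> R[i]) :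
  measurable_fun setT f -> measurable_fun setT (fun t => conjc (f t)).
Proof.
move=> /measurable_complexP[fr fi]; apply/measurable_complexP; split.
  rewrite (_ : _ \o _ = @complex.Re R \o f)//.
  by apply/funext => t /=; case: (f t).
rewrite (_ : _ \o _ = \- (@complex.Im R \o f)); first exact: measurableT_comp.
by apply/funext => t /=; case: (f t).
Qed.

Lemma measurable_coordinate j :
  measurable_fun setT (fun chi : Tinf R => circle_val (chi j)).
Proof.
move=> _ B mB; rewrite setTI; apply: sub_sigma_algebra.
by exists j => //; exists (@circle_val R @^-1` B);
  [exists B|]; rewrite // setTI.
Qed.

Lemma measurable_torus_character (q : rat) :
  measurable_fun setT (fun chi : Tinf R => torus_character chi q).
Proof.
rewrite /torus_character; elim: (primes _) => [|p s ih].
  by under eq_fun do rewrite big_nil; exact: measurable_cst.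
under eq_fun do rewrite big_cons.
apply: measurable_complexM => //.
case: (prime_exponent p q) => n.
  by apply: measurable_complexX; exact: measurable_coordinate.
rewrite (_ : (fun _ => _) =
   (fun chi : Tinf R => (conjc (circle_val (chi (prime_index p)))) ^+ n.+1)).
  apply: measurable_complexX; apply: measurable_conjc.
  exact: measurable_coordinate.
by apply/funext => chi; rewrite NegzE -exprnN -exprVn circle_invE.
Qed.

End measurable_torus_character.

Section Hardy_intermediate.
Context (R : realType) (m : probability (Tinf R) R).

Lemma ae_eq_Lp_norm p (f g : Tinf R -> R[i]) : (1 <= p)%E ->
  measurable_fun setT f -> measurable_fun setT g ->
  f = g %[ae m] -> Lp_norm m p f = Lp_norm m p g.
Proof.
move=> p1 mf mg fg; rewrite /Lp_norm unlock /Lnorm; case: p p1 => [p| |]// p1.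
  congr (_ `^ _)%E; apply: ae_eq_integral => //.
  - by apply: (measurableT_comp (measurable_poweR _));
      apply: measurableT_comp => //; apply/measurable_EFinP; exact: measurable_normc.
  - by apply: (measurableT_comp (measurable_poweR _));
      apply: measurableT_comp => //; apply/measurable_EFinP; exact: measurable_normc.
  - by apply: filterS fg => t /= /(_ I) ->.
case: ifPn => // _; apply: eq_ess_sup.
by apply: filterS fg => t /= /(_ I) ->.
Qed.

Lemma ae_eq_fourier_coefficient (f g : Tinf R -> R[i]) q :
  measurable_fun setT f -> measurable_fun setT g ->
  f = g %[ae m] -> fourier_coefficient m f q = fourier_coefficient m g q.
Proof.
move=> mf mg fg; rewrite /fourier_coefficient /complex_integral.
have mM (h : Tinf R -> R[i]) : measurable_fun setT h -> measurable_fun setT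
    (fun chi => h chi * conjc (torus_character chi q)).
  move=> mh; apply: measurable_complexM => //.
  by apply: measurable_conjc; exact: measurable_torus_character.
have /measurable_complexP[fr fi] := mM _ mf.
have /measurable_complexP[gr gi] := mM _ mg.
congr (_ +i* _); rewrite /Rintegral; congr fine; apply: ae_eq_integral => //.
- exact/measurable_EFinP.
- exact/measurable_EFinP.
- by apply: filterS fg => t /= /(_ I) ->.
- exact/measurable_EFinP.
- exact/measurable_EFinP.
- by apply: filterS fg => t /= /(_ I) ->.
Qed.

Lemma Lp_norm_ge0 p f : (0 <= Lp_norm m p f)%E.
Proof. exact: Lnorm_ge0. Qed.

Lemma Lp_norm_nondecreasing p q (f : Tinf R -> R[i]) :
  measurable_fun setT f -> (1 <= p)%E -> (p <= q)%E ->
  (Lp_norm m p f <= Lp_norm m q f)%E.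
Proof. by move=> /measurable_normc mf; exact: Lnorm_nondecreasing. Qed.

Lemma Lp_norm0 p : (1 <= p)%E -> Lp_norm m p (0 : L0 m) = 0%E.
Proof.
move=> p1; rewrite (ae_eq_Lp_norm p1 _ _ (L0_0E m)); last 2 first.
- exact: measurable_L0.
- exact: measurable_cst.
rewrite /Lp_norm (_ : (fun _ => _) = cst 0%E).
  by rewrite Lnorm0// gt_eqF// (lt_le_trans _ p1).
by apply/funext => t /=; rewrite expr0n/= addr0 sqrtr0.
Qed.

Lemma Hardy0 p : (1 <= p)%E -> Hardy m p 0.
Proof.
move=> p1; split; first by rewrite Lp_norm0.
move=> q _ _; rewrite (ae_eq_fourier_coefficient _ _ _ (L0_0E m)); last 2 first.
- exact: measurable_L0.
- exact: measurable_cst.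
rewrite /fourier_coefficient /complex_integral.
by under eq_Rintegral do rewrite mul0r/=;
  under [X in _ +i* X]eq_Rintegral do rewrite mul0r/=; rewrite Rintegral_cst// mul0r.
Qed.

Lemma Hardy_cap_inclusion p1 p p2 : (1 <= p)%E -> (p <= p2)%E ->
  continuous_inclusion (ns_cap (Hardy m p1) (Hardy m p2)) (Hardy m p).
Proof.
move=> p_ge1 pp2; exists 1 => f [[_ _] [fp2 f0]].
have le2 := Lp_norm_nondecreasing (measurable_L0 f) p_ge1 pp2.
split; first by split=> //; exact: le_lt_trans fp2.
rewrite mul1r /= le_max; apply/orP; right; apply: fine_le => //.
- by rewrite ge0_fin_numE ?Lp_norm_ge0//; exact: le_lt_trans fp2.
- by rewrite ge0_fin_numE ?Lp_norm_ge0.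
Qed.

Lemma Hardy_sum_inclusion p1 p p2 : (1 <= p1)%E -> (p1 <= p)%E ->
  (p <= p2)%E ->
  continuous_inclusion (Hardy m p) (ns_sum (Hardy m p1) (Hardy m p2)).
Proof.
move=> p1_ge1 p1p pp2; exists 1 => f [fp f0].
have p2_ge1 : (1 <= p2)%E by rewrite (le_trans p1_ge1)// (le_trans p1p).
have le1 := Lp_norm_nondecreasing (measurable_L0 f) p1_ge1 p1p.
have Hf : Hardy m p1 f by split=> //; exact: le_lt_trans fp.
have H0 : Hardy m p2 0 by exact: Hardy0.
split; first by exists f, 0; split; rewrite ?addr0.
have sum_le : ns_norm (ns_sum (Hardy m p1) (Hardy m p2)) f <=
    fine (Lp_norm m p1 (f : L0 m)).
  apply: ge_inf.
    exists 0 => _ [x [y [_ _ _ ->]]].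
    by rewrite addr_ge0// fine_ge0// Lp_norm_ge0.
  by exists f, 0; split; rewrite ?addr0//= Lp_norm0//= addr0.
rewrite mul1r; apply: (le_trans sum_le) => /=.
apply: fine_le => //.
- by rewrite ge0_fin_numE ?Lp_norm_ge0//; exact: le_lt_trans fp.
- by rewrite ge0_fin_numE ?Lp_norm_ge0.
Qed.

End Hardy_intermediate.

(* Main.v *)
Require Import Defs.
From HB Require Import structures.
From mathcomp Require Import all_boot all_order all_algebra.
From mathcomp Require Import all_classical all_reals all_analysis.
From mathcomp Require Import measurable_realfun ess_sup_inf.
From mathcomp Require Import complex.
From mathcomp Require Import ring lra.
Set Implicit Arguments.
Unset Strict Implicit.
Unset Printing Implicit Defensive.
Import Order.TTheory GRing.Theory Num.Theory.
Import numFieldNormedType.Exports.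
Import Normc.
Local Open Scope classical_set_scope.
Local Open Scope ring_scope.
Local Open Scope complex_scope.

(** Let z_j be the coordinates of the torus and F_n the product over j < n of
the sums z_(2j) + z_(2j+1); it is a polynomial in the coordinates, so it lies in
every H^q. Let L_n f be the integral of f times the conjugate of F_n. Since F_n
is a product of independent copies of z_0 + z_1, its L^q norm is X_q ^ n, where
X_q is the L^q norm of z_0 + z_1, and L_n F_n = ||F_n||_2 ^ 2 = 2 ^ n.

The point is that on H^q, as opposed to L^q, the functional L_n has norm exactly
(2 / X_q) ^ n for every q, so that F_n is extremal for all q at once. Indeed the
conjugate of F_n may be changed by any function that the analytic functions do
not see. With u = |z + w|^2, the function (z + w) P(u) is, for each polynomial
P, a multiple of z + w plus characters in which z or w has a negative exponent.
Hence L_n f is, up to the n-th power of a constant, the integral of f against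
the product of the conjugates of (z_(2j) + z_(2j+1)) P(u_j). Letting P(u)
approach u^((q-2)/2), which makes this product the Hoelder dual of F_n, gives
the bound ([functional_bound]).

So a rank-one operator f |-> L_n(f) g has norm (2 / X_q) ^ n ||g||_q. As
|z_0 + z_1| takes more than one nonzero value, Lyapunov's inequality
X_p < X_p1 ^ (1 - t) X_p2 ^ t is strict for 1/p = (1-t)/p1 + t/p2, and the norm
of L_n on H^p exceeds the interpolated one by an exponentially large factor
([dual_norm_gap]). For g one takes a multiple of the square of a Dirichlet kernel
D_N, whose L^q norm is comparable to N ^ (2 - 1/q): this is log-linear in 1/q,
and N is free to balance the two endpoints. The rank-one operators obtained are
contractions on H^p1 and on H^p2, and their norms on H^p, attained up to a
constant at the F_n, tend to infinity as fast as one likes ([building_blocks]).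

Finally a series of such operators with weights 2 ^ -(k+1) converges almost
everywhere and defines one operator that is bounded on H^p1 and on H^p2. Since
L_n F_n' = 0 for n <> n', the function F_(n_k) is only seen by the k-th term,
which multiplies its norm by at least 2 ^ (k+1)
([nuclear_operator_unbounded]). *)

(** * Modulus of a complex number *)

Section normc.
Variable R : rcfType.
Implicit Types z : R[i].

Lemma normc_ge0 z : 0 <= normc z. Proof. by case: z => a b; exact: sqrtr_ge0. Qed.

Lemma normc_sqr z : normc z ^+ 2 = complex.Re z ^+ 2 + complex.Im z ^+ 2.
Proof. by case: z => a b /=; rewrite sqr_sqrtr// addr_ge0 ?sqr_ge0. Qed.

Lemma normc_Re z : `|complex.Re z| <= normc z.
Proof.
rewrite -[leRHS](ger0_norm (normc_ge0 z)) -ler_sqr ?nnegrE ?normr_ge0//.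
by rewrite !real_normK ?num_real// normc_sqr lerDl sqr_ge0.
Qed.

Lemma normc_Im z : `|complex.Im z| <= normc z.
Proof.
rewrite -[leRHS](ger0_norm (normc_ge0 z)) -ler_sqr ?nnegrE ?normr_ge0//.
by rewrite !real_normK ?num_real// normc_sqr lerDr sqr_ge0.
Qed.

Lemma normc_real (a : R) : normc a%:C = `|a|.
Proof. by rewrite /= expr0n addr0 sqrtr_sqr. Qed.

Lemma normc_conj z : normc (conjc z) = normc z.
Proof. by case: z => a b /=; rewrite sqrrN. Qed.

Lemma mul_conjc z : z * conjc z = (normc z ^+ 2)%:C.
Proof.
rewrite normc_sqr; case: z => a b /=.
by rewrite /GRing.mul/=; congr (_ +i* _); ring.
Qed.

Lemma conjcD z z' : conjc (z + z') = conjc z + conjc z'.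
Proof. exact: rmorphD. Qed.

Lemma conjcM z z' : conjc (z * z') = conjc z * conjc z'.
Proof. exact: rmorphM. Qed.

Lemma normcX z n : normc (z ^+ n) = normc z ^+ n.
Proof. by elim: n => [|n ih]; rewrite ?normc1// !exprS normcM ih. Qed.

Lemma normc_prod (I : Type) (r : seq I) (F : I -> R[i]) :
  normc (\prod_(i <- r) F i) = \prod_(i <- r) normc (F i).
Proof. by elim/big_rec2: _ => [|i y x _ <-]; rewrite ?normc1 ?normcM. Qed.

Lemma normc_sum_le (I : Type) (r : seq I) (F : I -> R[i]) :
  normc (\sum_(i <- r) F i) <= \sum_(i <- r) normc (F i).
Proof.
elim/big_rec2: _ => [|i y z _ h]; first by rewrite normc0.
by apply: le_trans (le_normcD _ _) _; rewrite lerD2l.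
Qed.

End normc.

(** * Integrals over a probability space *)

Section complex_integral.
Context d (T : measurableType d) (R : realType) (P : probability T R).
Implicit Types f g : T -> R[i].

Definition cintegrable f := measurable_fun setT f /\
  P.-integrable setT (fun x => (normc (f x))%:E).

Lemma cintegrable_Re f : cintegrable f ->
  P.-integrable setT (EFin \o (fun x => complex.Re (f x))).
Proof.
move=> [/measurable_complexP[mr mi] fi]; apply: le_integrable fi => //.
  exact/measurable_EFinP.
by move=> x _ /=; rewrite lee_fin (ger0_norm (normc_ge0 _)) normc_Re.
Qed.

Lemma cintegrable_Im f : cintegrable f ->
  P.-integrable setT (EFin \o (fun x => complex.Im (f x))).
Proof.
move=> [/measurable_complexP[mr mi] fi]; apply: le_integrable fi => //.
  exact/measurable_EFinP.
by move=> x _ /=; rewrite lee_fin (ger0_norm (normc_ge0 _)) normc_Im.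
Qed.

Lemma bounded_integrable (h : T -> R) (M : R) : measurable_fun setT h ->
  (forall x, `|h x| <= M) -> P.-integrable setT (EFin \o h).
Proof.
move=> mh hM; apply: measurable_bounded_integrable => //.
  by rewrite -ge0_fin_numE// fin_num_measure.
exists M; split; first exact: num_real.
by move=> y My x _ /=; rewrite (le_trans (hM x))// ltW.
Qed.

Lemma integrable_scale (c : R) (h : T -> R) : P.-integrable setT (EFin \o h) ->
  P.-integrable setT (EFin \o (fun x => c * h x)).
Proof. by move=> hi; exact: (integrableZl measurableT c hi). Qed.

Lemma cintegrable_bounded f (M : R) : measurable_fun setT f ->
  (forall x, normc (f x) <= M) -> cintegrable f.
Proof.
move=> mf fM; split=> //; apply: (@bounded_integrable _ M).
  exact: measurable_normc.
by move=> x; rewrite ger0_norm ?normc_ge0.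
Qed.

Lemma cintegrable_le f (h : T -> R) : measurable_fun setT f ->
  P.-integrable setT (EFin \o h) ->
  (forall x, normc (f x) <= h x) -> cintegrable f.
Proof.
move=> mf hi fh; split => //; apply: le_integrable hi => //.
  exact/measurable_EFinP/measurable_normc.
move=> x _ /=; rewrite lee_fin (ger0_norm (normc_ge0 _)).
exact: le_trans (fh x) (ler_norm _).
Qed.

Lemma cintegrableD f g : cintegrable f -> cintegrable g ->
  cintegrable (fun x => f x + g x).
Proof.
move=> [mf fi] [mg gi].
apply: (@cintegrable_le _ (fun x => normc (f x) + normc (g x))).
- exact: measurable_complexD.
- rewrite (_ : _ \o _ = (fun x => (normc (f x))%:E) \+ (fun x => (normc (g x))%:E))%E//.
  exact: integrableD.
- by move=> x; exact: le_normcD.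
Qed.

Lemma cintegrableM f g (M : R) : cintegrable f -> measurable_fun setT g ->
  (forall x, normc (g x) <= M) -> cintegrable (fun x => f x * g x).
Proof.
move=> [mf fi] mg gM; apply: (@cintegrable_le _ (fun x => M * normc (f x))).
- exact: measurable_complexM.
- exact: (integrable_scale M fi).
- by move=> x; rewrite normcM mulrC ler_wpM2r ?normc_ge0.
Qed.

Lemma cintegrableZ (c : R[i]) f : cintegrable f -> cintegrable (fun x => c * f x).
Proof.
move=> /(@cintegrableM f (cst c) (normc c)) h.
rewrite (_ : (fun _ => _) = fun x => f x * cst c x); first exact: h.
by apply/funext => x; rewrite mulrC.
Qed.

Lemma complex_integralD f g : cintegrable f -> cintegrable g ->
  complex_integral P (fun x => f x + g x) =
  complex_integral P f + complex_integral P g.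
Proof.
move=> fi gi; rewrite /complex_integral.
under eq_Rintegral do rewrite raddfD/=.
rewrite RintegralD//; [|exact: cintegrable_Re|exact: cintegrable_Re].
under [X in _ +i* X = _]eq_Rintegral do rewrite raddfD/=.
by rewrite RintegralD//; exact: cintegrable_Im.
Qed.

Lemma complex_integralZ (c : R[i]) f : cintegrable f ->
  complex_integral P (fun x => c * f x) = c * complex_integral P f.
Proof.
move=> fi; have fr := cintegrable_Re fi; have fim := cintegrable_Im fi.
rewrite /complex_integral; case: c => a b.
have eR x : complex.Re ((a +i* b) * f x) =
    a * complex.Re (f x) - b * complex.Im (f x) by case: (f x).
have eI x : complex.Im ((a +i* b) * f x) =
    a * complex.Im (f x) + b * complex.Re (f x) by case: (f x).
under eq_Rintegral do rewrite eR.
under [X in _ +i* X = _]eq_Rintegral do rewrite eI.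
rewrite RintegralB//; [|exact: (integrableZl measurableT a fr)
                       |exact: (integrableZl measurableT b fim)].
rewrite RintegralD//; [|exact: (integrableZl measurableT a fim)
                       |exact: (integrableZl measurableT b fr)].
by rewrite !RintegralZl.
Qed.

Lemma complex_integral_real (h : T -> R) :
  complex_integral P (fun x => (h x)%:C) = (\int[P]_x h x)%:C.
Proof. by rewrite /complex_integral/= Rintegral_cst// mul0r. Qed.

Lemma complex_integral_cst c : complex_integral P (fun=> c) = c.
Proof.
case: c => a b; rewrite /complex_integral/= !Rintegral_cst//.
have -> : (P : {measure set T -> \bar R}) setT = 1%E := probability_setT P.
by rewrite !mulr1.
Qed.

Lemma complex_integral_conj f : cintegrable f ->
  complex_integral P (fun x => conjc (f x)) = conjc (complex_integral P f).
Proof.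
move=> fi; rewrite /complex_integral/=; congr (_ +i* _).
  by apply: eq_Rintegral => x _; case: (f x).
rewrite -[RHS]mulN1r -RintegralZl//; last exact: cintegrable_Im.
by apply: eq_Rintegral => x _; rewrite mulN1r; case: (f x).
Qed.

(** Multiplication by the conjugate of the integral makes the integral real and
nonnegative; then real parts are compared. *)
Lemma normc_complex_integral f : cintegrable f ->
  normc (complex_integral P f) <= \int[P]_x normc (f x).
Proof.
move=> fi; set c := complex_integral P f.
have [->|c0] := eqVneq c 0.
  by rewrite normc0; apply: Rintegral_ge0 => x _; exact: normc_ge0.
have nc0 : 0 < normc c.
  rewrite lt_def normc_ge0 andbT; apply: contra c0 => /eqP.
  by move/eq0_normc => ->.
have ci := cintegrableZ (conjc c) fi.
have : normc c ^+ 2 = \int[P]_x complex.Re (conjc c * f x).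
  have /(congr1 (@complex.Re R)) := complex_integralZ (conjc c) fi.
  by rewrite -/c (mulrC (conjc c)) mul_conjc => /esym.
rewrite expr2 => e; rewrite -(ler_pM2l nc0) e -RintegralZl//; last by case: fi.
apply: le_Rintegral => //; first exact: cintegrable_Re.
  by apply: (@integrable_scale (normc c)); case: fi.
move=> x _; rewrite (le_trans (ler_norm _))// (le_trans (normc_Re _))//.
by rewrite normcM normc_conj.
Qed.

Lemma complex_integral_sum (I : Type) (r : seq I) (F : I -> T -> R[i]) :
  (forall i, cintegrable (F i)) ->
  cintegrable (fun x => \sum_(i <- r) F i x) /\
  complex_integral P (fun x => \sum_(i <- r) F i x) =
  \sum_(i <- r) complex_integral P (F i).
Proof.
move=> Fi; elim: r => [|i r [ihi ihe]].
  under eq_fun do rewrite big_nil.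
  split; last by rewrite complex_integral_cst big_nil.
  by apply: (@cintegrable_bounded _ 0) => // x; rewrite normc0.
under eq_fun do rewrite big_cons.
split; first exact: cintegrableD.
by rewrite complex_integralD// ihe big_cons.
Qed.

End complex_integral.

Section bounded_functions.
Context d (T : measurableType d) (R : realType) (P : probability T R).
Implicit Types h : T -> R.

Lemma Rintegral_le h h' (M M' : R) : measurable_fun setT h -> measurable_fun setT h' ->
  (forall x, `|h x| <= M) -> (forall x, `|h' x| <= M') ->
  (forall x, h x <= h' x) -> \int[P]_x h x <= \int[P]_x h' x.
Proof.
move=> mh mh' hM hM' hh'; apply: le_Rintegral => //.
- exact: bounded_integrable hM.
- exact: bounded_integrable hM'.
Qed.

Lemma Rintegral_prob_cst (r : R) : \int[P]_x r = r.
Proof.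
rewrite Rintegral_cst//.
by have -> : (P : {measure set T -> \bar R}) setT = 1%E := probability_setT P; rewrite mulr1.
Qed.

Lemma EFin_Rintegral h (M : R) : measurable_fun setT h -> (forall x, `|h x| <= M) ->
  (\int[P]_x (h x)%:E = (\int[P]_x h x)%:E)%E.
Proof.
move=> mh hM; rewrite /Rintegral fineK//.
have : P.-integrable setT (EFin \o h) by exact: bounded_integrable hM.
by move/integrable_fin_num; apply.
Qed.

(** For bounded functions the extended-real norm is a real number; all moments
below are computed in this form. *)
Lemma Lnorm_bounded h (M q : R) : measurable_fun setT h ->
  (forall x, 0 <= h x <= M) -> 0 < q ->
  ('N[P]_(q%:E)[EFin \o h] = ((\int[P]_x (h x `^ q)) `^ q^-1)%:E)%E.
Proof.
move=> mh hM q0; rewrite unlock /Lnorm -poweR_EFin; congr (_ `^ _)%E.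
rewrite -(@EFin_Rintegral _ (M `^ q)).
- apply: eq_integral => x _ /=.
  by have /andP[h0 _] := hM x; rewrite ger0_norm.
- exact: (measurableT_comp (measurable_powR _)).
- move=> x; have /andP[h0 hx] := hM x.
  rewrite ger0_norm ?powR_ge0// ge0_ler_powR ?nnegrE ?(ltW q0)//.
  exact: le_trans hx.
Qed.

End bounded_functions.

Section complex_limits.
Variable R : realType.

(** The limit is taken through real and imaginary parts, which gives a total
function without a topology on the complex numbers being involved. *)
Definition complex_lim (u : nat -> R[i]) : R[i] :=
  limn (fun M => complex.Re (u M)) +i* limn (fun M => complex.Im (u M)).

Definition complex_cvg (u : nat -> R[i]) (l : R[i]) :=
  (complex.Re (u M) @[M --> \oo] --> complex.Re l) /\
  (complex.Im (u M) @[M --> \oo] --> complex.Im l).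

Lemma complex_cvg_lim u l : complex_cvg u l -> complex_lim u = l.
Proof.
by case: l => a b [/= ua ub]; rewrite /complex_lim (cvg_lim _ ua)// (cvg_lim _ ub).
Qed.

Lemma complex_cvgD u v l l' : complex_cvg u l -> complex_cvg v l' ->
  complex_cvg (fun M => u M + v M) (l + l').
Proof.
move=> [ur ui] [vr vi]; split; rewrite raddfD/=.
  by under eq_cvg do rewrite raddfD/=; exact: cvgD.
by under eq_cvg do rewrite raddfD/=; exact: cvgD.
Qed.

Lemma complex_cvgZ (c : R[i]) u l : complex_cvg u l -> complex_cvg (fun M => c * u M) (c * l).
Proof.
case: c => a b [ur ui].
have eR z : complex.Re ((a +i* b) * z) = a * complex.Re z - b * complex.Im z.
  by case: z.
have eI z : complex.Im ((a +i* b) * z) = a * complex.Im z + b * complex.Re z.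
  by case: z.
split.
  rewrite eR; under eq_cvg do rewrite eR.
  by apply: cvgB; apply: cvgM => //; exact: cvg_cst.
rewrite eI; under eq_cvg do rewrite eI.
by apply: cvgD; apply: cvgM => //; exact: cvg_cst.
Qed.

Lemma complex_cvg_normc u l : complex_cvg u l -> normc (u M) @[M --> \oo] --> normc l.
Proof.
move=> [ur ui].
have sqrt z : normc z = Num.sqrt (complex.Re z ^+ 2 + complex.Im z ^+ 2 : R) by case: z.
rewrite sqrt; under eq_cvg do rewrite sqrt.
have s : (complex.Re (u M) ^+ 2 + complex.Im (u M) ^+ 2) @[M --> \oo] -->
    (complex.Re l ^+ 2 + complex.Im l ^+ 2).
  by apply: cvgD; rewrite expr2; under eq_cvg do rewrite expr2; exact: cvgM.
exact: (@cvg_comp _ _ _ (fun M => complex.Re (u M) ^+ 2 + complex.Im (u M) ^+ 2)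
  (@Num.sqrt R) \oo _ _ s (@sqrt_continuous R _)).
Qed.

Lemma complex_cvg_series (u : nat -> R[i]) (B : R) :
  (forall M, \sum_(0 <= k < M) normc (u k) <= B) ->
  complex_cvg (fun M => \sum_(0 <= k < M) u k) (complex_lim (fun M => \sum_(0 <= k < M) u k)).
Proof.
move=> uB.
have real (r : nat -> R) : (forall k, `|r k| <= normc (u k)) -> cvgn (series r).
  move=> ru; apply: normed_cvg; apply: nondecreasing_is_cvgn.
    by apply: nondecreasing_series => k _ _; exact: normr_ge0.
  exists B => _ [M _ <-]; apply: le_trans (uB M).
  by rewrite /series/= ler_sum.
split; rewrite /=.
  have e : (fun M => complex.Re (\sum_(0 <= k < M) u k)) = series (fun k => complex.Re (u k)).
    by apply/funext => M; rewrite raddf_sum.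
  by rewrite e; apply: real => k; exact: normc_Re.
have e : (fun M => complex.Im (\sum_(0 <= k < M) u k)) = series (fun k => complex.Im (u k)).
  by apply/funext => M; rewrite raddf_sum.
by rewrite e; apply: real => k; exact: normc_Im.
Qed.

End complex_limits.

Section integral_limits.
Context d (T : measurableType d) (R : realType) (P : probability T R).

Lemma Rintegral_dominated_cvg (h_ : nat -> T -> R) (h b : T -> R) :
  (forall n, measurable_fun setT (h_ n)) -> measurable_fun setT h ->
  P.-integrable setT (EFin \o b) -> (forall n x, `|h_ n x| <= b x) ->
  (forall x, h_ n x @[n --> \oo] --> h x) ->
  \int[P]_x h_ n x @[n --> \oo] --> \int[P]_x h x.
Proof.
move=> mh_ mh ib hb hh; rewrite /Rintegral; apply: fine_cvg.
have hb' x : `|h x| <= b x.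
  by apply: (cvgr_to_le (cvg_norm (hh x))); apply: nearW => n; exact: hb.
rewrite fineK; last first.
  have : P.-integrable setT (EFin \o h).
    apply: le_integrable ib => //; first exact/measurable_EFinP.
    by move=> x _; rewrite /= lee_fin (le_trans (hb' x))// ler_norm.
  by move/integrable_fin_num; apply.
apply: (@dominated_cvg _ _ _ P setT measurableT _ _ (EFin \o b)) => //.
- by move=> n; exact/measurable_EFinP.
- by move=> x _; apply: cvg_EFin => //; [exact: nearW|exact: hh].
- by move=> n x _; rewrite /= lee_fin.
Qed.

Lemma complex_integral_dominated_cvg (f_ : nat -> T -> R[i]) f (b : T -> R) :
  (forall n, measurable_fun setT (f_ n)) -> measurable_fun setT f ->
  P.-integrable setT (EFin \o b) -> (forall n x, normc (f_ n x) <= b x) ->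
  (forall x, complex_cvg (fun n => f_ n x) (f x)) ->
  complex_cvg (fun n => complex_integral P (f_ n)) (complex_integral P f).
Proof.
move=> mf_ /measurable_complexP[mr mi] ib fb ff; split; rewrite /complex_integral /=.
  apply: (@Rintegral_dominated_cvg _ _ b) => //.
  - by move=> n; have /measurable_complexP[] := mf_ n.
  - by move=> n x; exact: le_trans (normc_Re _) (fb n x).
  - by move=> x; exact: (ff x).1.
apply: (@Rintegral_dominated_cvg _ _ b) => //.
- by move=> n; have /measurable_complexP[] := mf_ n.
- by move=> n x; exact: le_trans (normc_Im _) (fb n x).
- by move=> x; exact: (ff x).2.
Qed.

Lemma ae_eq_complex_integral (f g : T -> R[i]) : measurable_fun setT f ->
  measurable_fun setT g -> f = g %[ae P] ->
  complex_integral P f = complex_integral P g.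
Proof.
move=> /measurable_complexP[fr fi] /measurable_complexP[gr gi] fg.
rewrite /complex_integral; congr (_ +i* _); rewrite /Rintegral; congr fine;
  apply: ae_eq_integral => //.
- exact/measurable_EFinP.
- exact/measurable_EFinP.
- by apply: filterS fg => t /= /(_ I) ->.
- exact/measurable_EFinP.
- exact/measurable_EFinP.
- by apply: filterS fg => t /= /(_ I) ->.
Qed.

End integral_limits.

(** * Prime exponents and characters *)

Section primes.

Lemma prime_index_lt p q : prime p -> (p < q)%N ->
  (prime_index p < prime_index q)%N.
Proof.
move=> pp pq; rewrite /prime_index -[in iota 0 q](subnKC (ltnW pq)).
rewrite iotaD count_cat add0n -[X in (X < _)%N]addn0 ltn_add2l -has_count.
by apply/hasP; exists p => //; rewrite mem_iota leqnn subnKC// ltnW.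
Qed.

Lemma prime_index_inj p q : prime p -> prime q ->
  prime_index p = prime_index q -> p = q.
Proof.
move=> pp pq e; case: (ltngtP p q) => // /prime_index_lt.
  by move=> /(_ pp); rewrite e ltnn.
by move=> /(_ pq); rewrite e ltnn.
Qed.

Lemma prime_index_surj i : exists p, prime p /\ prime_index p = i.
Proof.
elim: i => [|i [p [pp pi]]]; first by exists 2.
have ex : exists q, (p < q)%N && prime q.
  by have [q pq qp] := prime_above p; exists q; rewrite pq.
pose q := ex_minn ex; exists q.
rewrite /q; case: ex_minnP => {q} q /andP[pq qp] qmin; split => //.
rewrite /prime_index -(subnKC pq) iotaD count_cat add0n.
rewrite -addn1 iotaD count_cat/= add0n addn0 pp -pi addn1 -[RHS]addn0.
congr (_ + _)%N; first by rewrite addn1.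
apply/eqP; rewrite -leqn0 leqNgt -has_count.
apply/hasP => -[r]; rewrite mem_iota subnKC// => /andP[pr rq] rp.
by have := qmin r; rewrite pr rp => /(_ isT); rewrite leqNgt rq.
Qed.

Definition nth_prime i : nat := sval (cid (prime_index_surj i)).

Lemma prime_nth_prime i : prime (nth_prime i).
Proof. exact: (svalP (cid (prime_index_surj i))).1. Qed.

Lemma nth_primeK : cancel nth_prime prime_index.
Proof. by move=> i; exact: (svalP (cid (prime_index_surj i))).2. Qed.

Lemma prime_indexK p : prime p -> nth_prime (prime_index p) = p.
Proof. by move=> pp; apply: prime_index_inj; rewrite ?nth_primeK// prime_nth_prime. Qed.

Lemma nth_prime_inj : injective nth_prime.
Proof. exact: can_inj nth_primeK. Qed.

Lemma nth_prime_gt0 i : (0 < nth_prime i)%N.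
Proof. exact: prime_gt0 (prime_nth_prime i). Qed.

Lemma nth_prime_ge i : (i <= nth_prime i)%N.
Proof.
rewrite -[X in (X <= _)%N]nth_primeK /prime_index.
by rewrite (leq_trans (count_size _ _))// size_iota.
Qed.

Lemma posq_frac (q : rat) : 0 < q ->
  exists a b : nat, [/\ (0 < a)%N, (0 < b)%N, q = a%:R / b%:R,
    a = `|numq q|%N & b = `|denq q|%N].
Proof.
move=> q0; exists `|numq q|%N, `|denq q|%N; split => //.
- by rewrite absz_gt0 numq_eq0 gt_eqF.
- by rewrite absz_gt0 denq_neq0.
rewrite -[LHS]divq_num_den; congr (_ / _).
  by rewrite -[in LHS](@gez0_abs (numq q)) ?numq_ge0 ?ltW.
by rewrite -[in LHS](@gez0_abs (denq q)) ?denq_ge0.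
Qed.

Lemma prime_exponent_frac p (a b : nat) : (0 < a)%N -> (0 < b)%N ->
  prime_exponent p (a%:R / b%:R) = (logn p a)%:Z - (logn p b)%:Z.
Proof.
move=> a0 b0; rewrite /prime_exponent; set q : rat := _ / _.
have q0 : 0 < q by rewrite divr_gt0 ?ltr0n.
have [n [d [n0 d0 qE <- <-]]] := posq_frac q0.
have : (n * b = a * d)%N.
  apply/eqP; rewrite -(eqr_nat rat) !natrM.
  have b0' : b%:R != 0 :> rat by rewrite pnatr_eq0 -lt0n.
  have d0' : d%:R != 0 :> rat by rewrite pnatr_eq0 -lt0n.
  by rewrite -eqr_div// -qE eqxx.
move=> /(congr1 (logn p)); rewrite !lognM// => /(congr1 Posz).
rewrite !PoszD => e; apply/eqP; rewrite subr_eq; apply/eqP.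
by rewrite addrAC -e addrK.
Qed.

Lemma prime_exponentM p (q r : rat) : 0 < q -> 0 < r ->
  prime_exponent p (q * r) = prime_exponent p q + prime_exponent p r.
Proof.
move=> /posq_frac[a [b [a0 b0 -> _ _]]] /posq_frac[c [d [c0 d0 -> _ _]]].
rewrite mulf_div -!natrM !prime_exponent_frac ?muln_gt0 ?a0 ?b0//.
by rewrite !lognM// !PoszD; ring.
Qed.

Lemma prime_exponentV p (q : rat) : 0 < q ->
  prime_exponent p q^-1 = - prime_exponent p q.
Proof.
move=> /posq_frac[a [b [a0 b0 -> _ _]]].
by rewrite invf_div !prime_exponent_frac// opprB.
Qed.

Lemma prime_exponent_nat p n : (0 < n)%N -> prime_exponent p n%:R = logn p n.
Proof.
move=> n0; rewrite -[n%:R]divr1 -[1]/(1%:R) prime_exponent_frac//.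
by rewrite logn1 subr0.
Qed.

Lemma prime_exponent_nth i j :
  prime_exponent (nth_prime i) (nth_prime j)%:R = (i == j)%:R.
Proof.
rewrite prime_exponent_nat ?nth_prime_gt0// logn_prime ?prime_nth_prime//.
by rewrite (inj_eq nth_prime_inj) natz eq_sym.
Qed.

Lemma prime_exponent_lt0_not_int p (q : rat) :
  prime_exponent p q < 0 -> q \isn't a Num.int.
Proof.
apply: contraL; rewrite Qint_def /prime_exponent => /eqP ->.
by rewrite logn1 subr0 -leNgt.
Qed.

Lemma prime_exponent_finite (q : rat) : 0 < q ->
  exists M, forall i, (M <= i)%N -> prime_exponent (nth_prime i) q = 0.
Proof.
move=> /posq_frac[a [b [a0 b0 -> _ _]]]; exists (a + b).+1 => i abi.
have ab : (a + b < nth_prime i)%N by rewrite (leq_trans abi)// nth_prime_ge.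
have big n : (0 < n)%N -> (n < nth_prime i)%N -> logn (nth_prime i) n = 0%N.
  move=> n0 ni; apply/eqP; rewrite -leqn0 leqNgt logn_gt0 mem_primes n0.
  by rewrite prime_nth_prime/=; apply: contraL ni => /(dvdn_leq n0); rewrite -leqNgt.
rewrite prime_exponent_frac// !big// ?subrr// (leq_ltn_trans _ ab)//.
  exact: leq_addl.
exact: leq_addr.
Qed.

End primes.

Section characters.
Variable R : realType.
Implicit Types (chi : Tinf R) (q r : rat).

Lemma circle_val_unit (z : circle R) : circle_val z \is a GRing.unit.
Proof.
rewrite unitfE; case: z => z /= /eqP z1; apply: contra_eq_neq z1 => ->.
by rewrite normc0 eq_sym oner_eq0.
Qed.

Lemma normc_circle (z : circle R) : normc (circle_val z) = 1.
Proof. by case: z => z /= /eqP. Qed.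

Lemma conjc_circleX (z : circle R) (k : int) :
  conjc (circle_val z ^ k) = circle_val z ^ (- k).
Proof.
rewrite -exprz_inv circle_invE.
by case: k => n; rewrite ?NegzE -?exprnN -?exprnP ?rmorphXn// fmorphV rmorphXn.
Qed.

(** A character is defined by a product over the primes dividing numerator or
denominator; rewriting it over an initial segment of coordinates, common to
several characters, is what makes multiplicativity visible. *)
Lemma torus_characterE chi q M : 0 < q ->
  (forall i, (M <= i)%N -> prime_exponent (nth_prime i) q = 0) ->
  torus_character chi q =
  \prod_(i < M) circle_val (chi i) ^ prime_exponent (nth_prime i) q.
Proof.
move=> q0 qM.
pose F p := circle_val (chi (prime_index p)) ^ prime_exponent p q.
pose s := [seq nth_prime i | i <- iota 0 M].
transitivity (\prod_(p <- s) F p); last first.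
  rewrite big_map -(big_mkord xpredT (fun i => circle_val (chi i) ^
    prime_exponent (nth_prime i) q)) /index_iota subn0.
  by apply: eq_bigr => i _; rewrite /F nth_primeK.
set N := (`|numq q| * `|denq q|)%N.
rewrite /torus_character -/N (bigID (mem s))/= [X in _ * X]big1_seq ?mulr1; last first.
  move=> p /andP[ps]; rewrite mem_primes => /andP[pp _].
  rewrite -(prime_indexK pp) qM ?expr0z// leqNgt; apply: contra ps => pM.
  by apply/mapP; exists (prime_index p); rewrite ?mem_iota ?prime_indexK.
rewrite [RHS](bigID (mem (primes N)))/= [X in _ = _ * X]big1 ?mulr1; last first.
  move=> p; rewrite mem_primes => pN.
  rewrite /F (_ : prime_exponent p q = 0) ?expr0z//.
  have [pp|pp] := boolP (prime p); last first.
    by rewrite /prime_exponent /logn (negbTE pp) subrr.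
  have [a [b [a0 b0 _ aE bE]]] := posq_frac q0.
  move: pN; rewrite pp /N -aE -bE muln_gt0 a0 b0/= Euclid_dvdM// negb_or.
  rewrite /prime_exponent -aE -bE => /andP[pa pb].
  have l0 n : (0 < n)%N -> ~~ (p %| n)%N -> logn p n = 0%N.
    move=> n0 pn; apply/eqP; rewrite -leqn0 leqNgt logn_gt0 mem_primes.
    by rewrite pp n0 (negbTE pn).
  by rewrite !l0// subrr.
rewrite -big_filter -[RHS]big_filter; apply: perm_big.
apply: uniq_perm.
- by rewrite filter_uniq// primes_uniq.
- by rewrite filter_uniq// map_inj_uniq ?iota_uniq//; exact: nth_prime_inj.
- by move=> p; rewrite !mem_filter andbC.
Qed.

Lemma torus_characterM chi q r : 0 < q -> 0 < r ->
  torus_character chi (q * r) = torus_character chi q * torus_character chi r.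
Proof.
move=> q0 r0.
have [M qM] := prime_exponent_finite q0; have [N rN] := prime_exponent_finite r0.
rewrite !(@torus_characterE _ _ (maxn M N)) ?mulr_gt0// => [|i|i|i]; last 3 first.
- by rewrite geq_max => /andP[_ /rN].
- by rewrite geq_max => /andP[/qM].
- by rewrite prime_exponentM// geq_max => /andP[/qM -> /rN ->].
rewrite -big_split/=; apply: eq_bigr => i _.
by rewrite prime_exponentM// exprzDr ?circle_val_unit.
Qed.

Lemma torus_characterV chi q : 0 < q ->
  torus_character chi q^-1 = conjc (torus_character chi q).
Proof.
move=> q0; have [M qM] := prime_exponent_finite q0.
rewrite !(@torus_characterE _ _ M) ?invr_gt0//; last first.
  by move=> i /qM; rewrite prime_exponentV// => ->; rewrite oppr0.
rewrite rmorph_prod/=; apply: eq_bigr => i _.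
by rewrite conjc_circleX prime_exponentV.
Qed.

Lemma torus_character_nth chi i :
  torus_character chi (nth_prime i)%:R = circle_val (chi i).
Proof.
rewrite (@torus_characterE _ _ i.+1) ?ltr0n ?nth_prime_gt0//; last first.
  by move=> j ij; rewrite prime_exponent_nth gtn_eqF.
rewrite big_ord_recr/= prime_exponent_nth eqxx expr1z big1 ?mul1r// => j _.
by rewrite prime_exponent_nth ltn_eqF.
Qed.

Lemma torus_character1 chi : torus_character chi 1 = 1.
Proof. by rewrite /torus_character big_nil. Qed.

Lemma normc_torus_character chi q : normc (torus_character chi q) = 1.
Proof.
rewrite /torus_character normc_prod big1// => p _.
case: (prime_exponent p q) => n; rewrite ?NegzE -?exprnN -?exprnP ?normcV normcX;
  by rewrite normc_circle expr1n ?invr1.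
Qed.

End characters.

(** * Product structure of the Haar measure *)

Section haar_product.
Variable R : realType.
Local Notation Tinf := (Tinf R).

Definition cylinder (n : nat) (A : nat -> set (circle R)) : set Tinf :=
  [set chi | forall j, (j < n)%N -> A j (chi j)].

Definition cylinders : set (set Tinf) :=
  [set C | exists n A, (forall j, measurable (A j)) /\ C = cylinder n A].

Lemma measurable_coord j : measurable_fun setT (fun chi : Tinf => chi j).
Proof.
move=> _ B mB; apply: sub_sigma_algebra; exists j => //.
by exists B.
Qed.

Lemma measurable_cylinder n A : (forall j, measurable (A j)) ->
  measurable (cylinder n A).
Proof.
move=> mA; rewrite (_ : cylinder n A =
    \bigcap_(j in [set j | (j < n)%N]) ((fun chi : Tinf => chi j) @^-1` A j)).
  apply: bigcap_measurableType => j _; rewrite -[X in measurable X]setTI.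
  exact: measurable_coord.
by apply/seteqP; split => chi h j /= /h.
Qed.

Lemma cylinders_setI : setI_closed cylinders.
Proof.
move=> _ _ [n [A [mA ->]]] [n' [A' [mA' ->]]].
exists (maxn n n'), (fun j => (if (j < n)%N then A j else setT) `&`
                             (if (j < n')%N then A' j else setT)); split.
  by move=> j; apply: measurableI; case: ifP.
apply/seteqP; split => chi.
  by move=> [h h'] j _; split; case: ifP => // jn; [exact: h|exact: h'].
move=> h; split => j jn.
  by have := h j; rewrite leq_max jn => /(_ isT)[].
by have := h j; rewrite leq_max jn orbT => /(_ isT)[].
Qed.

Lemma measurable_cylinders : measurable = <<s cylinders >>.
Proof.
apply/seteqP; split.
  apply: smallest_sub; first exact: smallest_sigma_algebra.
  move=> _ [j _ [B mB <-]]; apply: sub_sigma_algebra.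
  exists j.+1, (fun i => if i == j then B else setT); split.
    by move=> i; case: ifP.
  rewrite setTI; apply/seteqP; split => chi /=.
    by move=> Bj i _; case: eqP => // ->.
  by move=> /(_ j); rewrite eqxx; apply.
apply: smallest_sub; first exact: sigma_algebra_measurable.
by move=> _ [n [A [mA ->]]]; exact: measurable_cylinder.
Qed.

(** Cylinders are closed under intersection, so a finite measure on the torus is
determined by its values on them. *)
Lemma cylinder_measure_unique (m1 m2 : {measure set Tinf -> \bar R}) :
  (m1 setT < +oo)%E ->
  (forall n A, (forall j, measurable (A j)) ->
     m1 (cylinder n A) = m2 (cylinder n A)) ->
  forall B, measurable B -> m1 B = m2 B.
Proof.
move=> m1oo m12 B mB.
apply: (measure_unique cylinders (fun=> setT)) => //.
- exact: measurable_cylinders.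
- exact: cylinders_setI.
- move=> _; exists 0, (fun=> setT); split => //.
  by apply/seteqP; split.
- by apply/seteqP; split => // x _; exists 0.
- by move=> _ [n [A [mA ->]]]; exact: m12.
Qed.

Lemma measurable_into_Tinf d (T : measurableType d) (f : T -> Tinf) :
  (forall j, measurable_fun setT (fun x => f x j)) -> measurable_fun setT f.
Proof.
move=> mf; apply: (@measurability _ _ _ _ _ _
  (\bigcup_(j in [set: nat])
  preimage_set_system setT (fun chi : Tinf => chi j) measurable)) => //.
move=> _ [_ [j _ [B mB <-]] <-].
by rewrite !setTI -comp_preimage -[X in measurable X]setTI; exact: mf.
Qed.

(** The forgotten coordinates are set to 1, so that the first k coordinates and
the others are described by self-maps of the same space and independence can be
expressed with the single measure m. *)
Definition head_coords (k : nat) (chi : Tinf) : Tinf :=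
  fun j => if (j < k)%N then chi j else expi 0.
Definition tail_coords (k : nat) (chi : Tinf) : Tinf := fun j => chi (k + j)%N.

Lemma measurable_head k : measurable_fun setT (head_coords k).
Proof.
apply: measurable_into_Tinf => j; rewrite /head_coords.
by case: (j < k)%N; [exact: measurable_coord|exact: measurable_cst].
Qed.

Lemma measurable_tail k : measurable_fun setT (tail_coords k).
Proof. by apply: measurable_into_Tinf => j; exact: measurable_coord. Qed.

HB.instance Definition _ k :=
  @isMeasurableFun.Build _ _ Tinf Tinf (head_coords k) (@measurable_head k).
HB.instance Definition _ k :=
  @isMeasurableFun.Build _ _ Tinf Tinf (tail_coords k) (@measurable_tail k).

Definition head_tail k (chi : Tinf) : Tinf * Tinf := (head_coords k chi, tail_coords k chi).
Lemma measurable_head_tail k : measurable_fun setT (head_tail k).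
Proof.
by apply: measurable_fun_pair; [exact: measurable_head|exact: measurable_tail].
Qed.
HB.instance Definition _ k :=
  @isMeasurableFun.Build _ _ Tinf (Tinf * Tinf)%type (head_tail k) (@measurable_head_tail k).

Variable m : probability Tinf R.
Hypothesis hm : is_haar_Tinf m.

Lemma haar_cylinder n A : (forall j, measurable (A j)) ->
  m (cylinder n A) = (\prod_(j < n) arclength R (A j))%E.
Proof. exact: hm. Qed.

Lemma haar_tail k B : measurable B -> m (tail_coords k @^-1` B) = m B.
Proof.
move=> mB.
apply: (cylinder_measure_unique (m1 := pushforward m (tail_coords k)) (m2 := m)) => //.
  by rewrite /= /pushforward preimage_setT probability_setT ltry.
move=> n A mA.
apply: etrans (esym (haar_cylinder n mA)); rewrite /= /pushforward.
pose A' j := if (j < k)%N then setT else A (j - k)%N.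
have -> : tail_coords k @^-1` cylinder n A = cylinder (k + n) A'.
  apply/seteqP; split => chi /= h j jn; rewrite /A'.
    case: ltnP => // kj.
    have := h (j - k)%N; rewrite /tail_coords subnKC//; apply.
    by rewrite ltn_subLR.
  by have := h (k + j)%N; rewrite /A' ltn_add2l jn ltnNge leq_addr/= addKn; apply.
rewrite (@haar_cylinder (k + n) A'); last by move=> j; rewrite /A'; case: ifP.
rewrite big_split_ord/= [X in (X * _)%E](_ : _ = 1%E) ?mul1e.
  by apply: eq_bigr => i _; rewrite /A' ltnNge leq_addr/= addKn.
rewrite big1// => i _; rewrite /A' ltn_ord; exact: probability_setT.
Qed.

(** If one of the sets A j with j >= k misses the padding value 1, the preimage
under [head_coords k] is empty; otherwise these A j impose no condition. *)
Lemma haar_independent_cylinder k n A n' B :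
  (forall j, measurable (A j)) -> (forall j, measurable (B j)) ->
  m (head_coords k @^-1` cylinder n A `&` tail_coords k @^-1` cylinder n' B) =
  (m (head_coords k @^-1` cylinder n A) * m (cylinder n' B))%E.
Proof.
move=> mA mB.
have [padded|] := pselect (forall j, (k <= j < n)%N -> A j (expi 0)); last first.
  move=> npadded; suff -> : head_coords k @^-1` cylinder n A = set0.
    by rewrite set0I !measure0 mul0e.
  apply/seteqP; split => // chi /= h; apply: npadded => j /andP[kj jn].
  by have := h j jn; rewrite /head_coords ltnNge kj.
pose A' j := if (j < n)%N then A j else setT.
have mA' j : measurable (A' j) by rewrite /A'; case: ifP.
have -> : head_coords k @^-1` cylinder n A = cylinder k A'.
  apply/seteqP; split => chi /= h j.
    move=> jk; rewrite /A'; case: ifP => // jn.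
    by have := h j jn; rewrite /head_coords jk.
  move=> jn; rewrite /head_coords; case: ltnP => jk; last by apply: padded; rewrite jk.
  by have := h j jk; rewrite /A' jn.
pose AB j := if (j < k)%N then A' j else B (j - k)%N.
have -> : cylinder k A' `&` tail_coords k @^-1` cylinder n' B = cylinder (k + n') AB.
  apply/seteqP; split => chi /=.
    move=> [h h'] j jn; rewrite /AB; case: ltnP => kj; first exact: h.
    have := h' (j - k)%N; rewrite /tail_coords subnKC//; apply.
    by rewrite ltn_subLR.
  move=> h; split=> j jn.
    by have := h j; rewrite /AB jn (leq_trans jn (leq_addr _ _)); apply.
  by have := h (k + j)%N; rewrite /AB ltn_add2l jn ltnNge leq_addr/= addKn; apply.
rewrite (@haar_cylinder (k + n') AB); last by move=> j; rewrite /AB; case: ifP.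
rewrite (haar_cylinder k mA') (haar_cylinder n' mB) big_split_ord/=; congr (_ * _)%E.
  by apply: eq_bigr => i _; rewrite /AB ltn_ord.
by apply: eq_bigr => i _; rewrite /AB ltnNge leq_addr/= addKn.
Qed.

(** The pi-lambda argument is applied to one side at a time, first to the
tail with a cylinder as head, then to the head. *)
Lemma haar_independent k A B : measurable A -> measurable B ->
  m (head_coords k @^-1` A `&` tail_coords k @^-1` B) = (m (head_coords k @^-1` A) * m B)%E.
Proof.
move=> mA mB.
have mhead C : measurable C -> measurable (head_coords k @^-1` C).
  by move=> mC; rewrite -[X in measurable X]setTI; exact: measurable_head.
have mtail C : measurable C -> measurable (tail_coords k @^-1` C).
  by move=> mC; rewrite -[X in measurable X]setTI; exact: measurable_tail.
have mE C : measurable C -> exists2 r : {nonneg R}, m C = r%:num%:E &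
    (forall D, mscale r m D = r%:num%:E * m D)%E.
  move=> mC; have mC0 : 0 <= fine (m C) by rewrite fine_ge0.
  exists (NngNum mC0) => //=; rewrite fineK// ge0_fin_numE//.
  by rewrite (le_lt_trans (probability_le1 m mC))// ltry.
have finite (D : set Tinf) (C : set Tinf) :
    (m (C `&` D) <= m setT)%E -> (m (C `&` D) < +oo)%E.
  by rewrite probability_setT => /le_lt_trans; apply; rewrite ltry.
have step1 n (C : nat -> set (circle R)) : (forall j, measurable (C j)) ->
    m (head_coords k @^-1` cylinder n C `&` tail_coords k @^-1` B) =
    (m (head_coords k @^-1` cylinder n C) * m B)%E.
  move=> mC.
  have mhC := mhead _ (measurable_cylinder n mC).
  have [r rE sE] := mE _ mhC.
  rewrite rE -sE setIC.
  apply: (cylinder_measure_unique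
    (m1 := pushforward (mrestr m mhC) (tail_coords k)) (m2 := mscale r m)) => //.
    rewrite /= /pushforward /mrestr preimage_setT setTI rE ltry//.
  move=> n' D mD; apply: etrans (esym (sE _)); rewrite -rE.
  by rewrite -haar_independent_cylinder// setIC.
have [r rE sE] := mE _ mB.
rewrite rE muleC.
transitivity (pushforward (mscale r m) (head_coords k) A); last exact: sE.
apply: (cylinder_measure_unique
    (m1 := pushforward (mrestr m (mtail _ mB)) (head_coords k))
    (m2 := pushforward (mscale r m) (head_coords k))) => //.
  rewrite /= /pushforward /mrestr preimage_setT setTI haar_tail// rE ltry//.
move=> n D mD; apply: etrans (esym (sE _)); rewrite -rE muleC.
exact: step1.
Qed.

End haar_product.

Section haar_complex.
Variables (R : realType) (m : probability (Tinf R) R).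
Hypothesis hm : is_haar_Tinf m.
Local Notation Tinf := (Tinf R).

(** By independence the image of m under (head, tail) is a product measure, so
this is Fubini's theorem. *)
Lemma haar_prod_real k (h g : Tinf -> R) (M N : R) :
  measurable_fun setT h -> measurable_fun setT g ->
  (forall x, `|h x| <= M) -> (forall x, `|g x| <= N) ->
  (forall x, h (head_coords k x) = h x) ->
  \int[m]_x (h x * g (tail_coords k x)) = (\int[m]_x h x) * (\int[m]_x g x).
Proof.
move=> mh mg hM gN hE.
pose mk : probability Tinf R := distribution m (head_coords k : {mfun _ >-> _}).
pose f (z : Tinf * Tinf) := h z.1 * g z.2.
have mf : measurable_fun setT f by apply: measurable_funM; exact: measurableT_comp.
have fMN z : `|f z| <= M * N by rewrite normrM ler_pM.
have fi (Q : {measure set (Tinf * Tinf) -> \bar R}) : (Q setT < +oo)%E ->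
    Q.-integrable setT (EFin \o f).
  move=> Qoo; apply: measurable_bounded_integrable => //.
  exists (M * N); split; first exact: num_real.
  by move=> y My x _ /=; rewrite (le_trans (fMN x))// ltW.
have ih : m.-integrable setT (EFin \o h) by exact: bounded_integrable hM.
have ig : m.-integrable setT (EFin \o g) by exact: bounded_integrable gN.
have prodE A : measurable A -> (mk \x m)%E A = pushforward m (head_tail k) A.
  move=> mA; apply: (@product_measure_unique _ _ _ _ _ mk m) => //.
  by move=> B C mB mC; rewrite /= -(haar_independent hm k mB mC).
rewrite /Rintegral -[RHS]/(fine _ * fine _)%R -fineM; last 2 first.
- exact: (integrable_fin_num measurableT ih).
- exact: (integrable_fin_num measurableT ig).
congr fine.
transitivity (\int[pushforward m (head_tail k)]_z (f z)%:E)%E.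
  rewrite integral_pushforward//=.
  - by rewrite preimage_setT; apply: eq_integral => x _ /=; rewrite /f/= hE.
  - exact/measurable_EFinP.
  - rewrite preimage_setT; apply: (@bounded_integrable _ _ _ _ _ (M * N)) => //.
    by apply: (measurableT_comp mf); exact: measurable_head_tail.
transitivity (\int[mk \x m]_z (f z)%:E)%E.
  by apply: eq_measure_integral => A mA _; exact: esym (prodE _ mA).
rewrite -(@integral12_prod_meas1 _ _ _ _ _ mk m (EFin \o f)); last first.
  have mkT : ((mk \x m)%E setT < +oo)%E.
    rewrite prodE// /pushforward preimage_setT.
    have -> : (m : {measure set Tinf -> \bar R}) setT = 1%E := probability_setT m.
    by rewrite ltry.
  exact: fi mkT.
set c := (\int[m]_x (g x)%:E)%E.
have cE : c = (fine c)%:E by rewrite fineK// (integrable_fin_num measurableT ig).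
have inner x : (\int[m]_y (f (x, y))%:E = c * (h x)%:E)%E.
  by rewrite muleC; exact: (@integralZl _ _ _ m setT measurableT _ ig (h x)).
rewrite (eq_integral (fun x => c * (h x)%:E)%E); last by move=> x _; exact: inner.
have e : (\int[mk]_x (h x)%:E = \int[m]_x (h x)%:E)%E.
  rewrite integral_pushforward//=.
  - by rewrite preimage_setT; apply: eq_integral => x _ /=; rewrite hE.
  - exact/measurable_EFinP.
  - by rewrite preimage_setT; apply: eq_integrable ih => // x _; rewrite /= hE.
rewrite cE integralZl//; first by rewrite e muleC.
exact: (@bounded_integrable _ _ _ mk _ M).
Qed.

Lemma haar_prod_complex k (f g : Tinf -> R[i]) (M N : R) :
  measurable_fun setT f -> measurable_fun setT g ->
  (forall x, normc (f x) <= M) -> (forall x, normc (g x) <= N) ->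
  (forall x, f (head_coords k x) = f x) ->
  complex_integral m (fun x => f x * g (tail_coords k x)) =
  complex_integral m f * complex_integral m g.
Proof.
move=> mf mg fM gN fE.
have /measurable_complexP[mfr mfi] := mf; have /measurable_complexP[mgr mgi] := mg.
have fr x : `|complex.Re (f x)| <= M := le_trans (normc_Re _) (fM x).
have fi x : `|complex.Im (f x)| <= M := le_trans (normc_Im _) (fM x).
have gr x : `|complex.Re (g x)| <= N := le_trans (normc_Re _) (gN x).
have gi x : `|complex.Im (g x)| <= N := le_trans (normc_Im _) (gN x).
have prodE (h g' : Tinf -> R) : measurable_fun setT h -> measurable_fun setT g' ->
    (forall x, `|h x| <= M) -> (forall x, `|g' x| <= N) ->
    (forall x, h (head_coords k x) = h x) ->
    m.-integrable setT (EFin \o (fun x => h x * g' (tail_coords k x))) /\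
    \int[m]_x (h x * g' (tail_coords k x)) = (\int[m]_x h x) * (\int[m]_x g' x).
  move=> mh mg' hM gN' hE; split; last exact: haar_prod_real hE.
  apply: (@bounded_integrable _ _ _ _ _ (M * N)).
    apply: measurable_funM => //.
    by apply: (measurableT_comp mg'); exact: measurable_tail.
  by move=> x; rewrite normrM ler_pM.
have [irr err] := prodE _ _ mfr mgr fr gr (fun x => congr1 _ (fE x)).
have [iii eii] := prodE _ _ mfi mgi fi gi (fun x => congr1 _ (fE x)).
have [iri eri] := prodE _ _ mfr mgi fr gi (fun x => congr1 _ (fE x)).
have [iir eir] := prodE _ _ mfi mgr fi gr (fun x => congr1 _ (fE x)).
rewrite /complex_integral.
have eR x : complex.Re (f x * g (tail_coords k x)) =
  complex.Re (f x) * complex.Re (g (tail_coords k x)) -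
  complex.Im (f x) * complex.Im (g (tail_coords k x)) by case: (f x); case: (g _).
have eI x : complex.Im (f x * g (tail_coords k x)) =
  complex.Re (f x) * complex.Im (g (tail_coords k x)) +
  complex.Im (f x) * complex.Re (g (tail_coords k x)) by case: (f x); case: (g _).
under eq_Rintegral do rewrite eR.
under [X in _ +i* X = _]eq_Rintegral do rewrite eI.
by rewrite RintegralB// RintegralD// [in LHS]err [in LHS]eii [in LHS]eri [in LHS]eir.
Qed.

End haar_complex.

(** * Orthogonality of the characters *)

Section circle_moments.
Variables (R : realType).

Lemma cos_sin_exp (t : R) n :
  (cos t +i* sin t) ^+ n = cos (n%:R * t) +i* sin (n%:R * t).
Proof.
elim: n => [|n ih]; first by rewrite expr0 mul0r cos0 sin0.
rewrite exprS ih -natr1 mulrDl mul1r addrC cosD sinD.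
by apply/eqP; rewrite eq_complex/=; apply/andP; split; apply/eqP; ring.
Qed.

(** Fundamental theorem of calculus, applied to the nonnegative function f + M. *)
Lemma integral_uniform_twopi (f F : R -> R) (M : R) :
  (forall x : R, is_derive x (1 : R) F (f x)) -> continuous f ->
  (forall x, `|f x| <= M) -> F (2 * pi) = F 0 ->
  \int[uniform_prob (twopi_gt0 R)]_x f x = 0.
Proof.
move=> dF cf fM FF.
have mf : measurable_fun setT f by exact: continuous_measurable_fun.
have pi0 := twopi_gt0 R.
pose P : probability (measurableTypeR R) R := uniform_prob (twopi_gt0 R).
have fi : P.-integrable setT (EFin \o f).
  exact: (@bounded_integrable _ (measurableTypeR R) R P f M mf fM).
have ci : P.-integrable setT (EFin \o (fun=> M)).
  by apply: (@bounded_integrable _ _ _ _ _ `|M|) => //; exact: measurable_cst.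
have e : (\int[uniform_prob (twopi_gt0 R)]_x (f x + M)%:E = M%:E)%E.
  rewrite integral_uniform.
  - have := @continuous_FTC2 R (fun x => f x + M) (fun x => F x + M * x) _ _ pi0.
    rewrite FF mulr0 addr0 => ->.
    + rewrite subr0 -EFinB -EFinM; congr EFin.
      by move: (pi_gt0 R); move: (pi : R) => c c0; field; rewrite gt_eqF.
    + apply: continuous_subspaceT => x.
      by apply: cvgD; [exact: cf|exact: cvg_cst].
    + have cF x : {for x, continuous (fun x => F x + M * x)}.
        by apply: differentiable_continuous; apply/derivable1_diffP.
      split.
      * by move=> x _.
      * apply: cvg_at_right_filter; exact: cF.
      * apply: cvg_at_left_filter; exact: cF.
    + move=> x _; rewrite derive1E derive_val.
      by rewrite /GRing.scale/= mulr1.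
  - apply/measurable_EFinP; exact: measurable_funD.
  - by move=> x; rewrite lee_fin; have := fM x; rewrite ler_norml; lra.
have : \int[uniform_prob (twopi_gt0 R)]_x (f x + M) = M by rewrite /Rintegral e.
rewrite RintegralD// Rintegral_cst//.
have -> : (uniform_prob (twopi_gt0 R) : {measure set _ -> \bar R}) setT = 1%E.
  exact: probability_setT.
by rewrite mulr1 => /(canRL (addrK _)); rewrite subrr.
Qed.

Lemma measurable_circle_val : measurable_fun setT (@circle_val R).
Proof. by move=> _ B mB; rewrite setTI; exists B => //; rewrite setTI. Qed.

Variable m : probability (Tinf R) R.
Hypothesis hm : is_haar_Tinf m.

Lemma haar_coord0 (A : set (circle R)) : measurable A ->
  m ((fun chi : Tinf R => chi 0) @^-1` A) = arclength R A.
Proof.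
move=> mA.
have := haar_cylinder hm 1 (A := fun=> A) (fun=> mA).
rewrite big_ord1 => <-; congr (m _); apply/seteqP; split => chi /=.
  by move=> A0 j; rewrite ltnS leqn0 => /eqP ->.
by apply.
Qed.

Lemma integral_coord0 (h : circle R -> R) (M : R) : measurable_fun setT h ->
  (forall z, `|h z| <= M) ->
  \int[m]_x h (x 0) = \int[uniform_prob (twopi_gt0 R)]_t h (expi t).
Proof.
move=> mh hM.
have mc0 : measurable_fun setT (fun chi : Tinf R => chi 0) by exact: measurable_coord.
pose P : probability (measurableTypeR R) R := uniform_prob (twopi_gt0 R).
rewrite /Rintegral; congr fine.
transitivity (\int[pushforward m (mfun_Sub (mem_set mc0))]_z (h z)%:E)%E.
  rewrite integral_pushforward//= ?preimage_setT//; first exact/measurable_EFinP.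
  by apply: (@bounded_integrable _ _ _ m _ M) => //; exact: measurableT_comp.
transitivity (\int[arclength R]_z (h z)%:E)%E.
  by apply: eq_measure_integral => A mA _; exact: haar_coord0.
rewrite integral_pushforward//= ?preimage_setT//; first exact/measurable_EFinP.
apply: (@bounded_integrable _ _ _ P _ M) => //.
by apply: measurableT_comp => //; exact: measurable_expi.
Qed.

Lemma circleX_bounded (z : circle R) n : normc (circle_val z ^+ n) <= 1.
Proof. by rewrite normcX normc_circle expr1n. Qed.

Lemma integral_circleX n : complex_integral m (fun x => circle_val (x 0) ^+ n.+1) = 0.
Proof.
have mX : measurable_fun setT (fun z : circle R => circle_val z ^+ n.+1).
  by apply: measurable_complexX; exact: measurable_circle_val.
have /measurable_complexP[mr mi] := mX.
have nE : n.+1%:R != 0 :> R by rewrite pnatr_eq0.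
have kE (k : nat) : k%:R * (2 * pi) = 0 + (pi *+ 2) *+ k :> R.
  by rewrite add0r -[in RHS]mulr_natl -(mulr_natl pi 2).
have sper (k : nat) : sin (k%:R * (2 * pi)) = 0 :> R.
  by rewrite kE periodicn ?sin0//; exact: sinD2pi.
have cper (k : nat) : cos (k%:R * (2 * pi)) = 1 :> R.
  by rewrite kE periodicn ?cos0//; exact: cosD2pi.
have dlin (x : R) : is_derive x 1 (fun t => n.+1%:R * t) n.+1%:R.
  by apply: is_derive_eq; rewrite /GRing.scale/= mulr1 ?mul0r ?addr0.
have clin : continuous (fun t : R => n.+1%:R * t).
  by move=> x; apply: cvgM; [exact: cvg_cst|exact: cvg_id].
rewrite /complex_integral; apply/eqP; rewrite eq_complex/=; apply/andP; split; apply/eqP.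
  rewrite (@integral_coord0 (fun z => complex.Re (circle_val z ^+ n.+1)) 1)//; last first.
    by move=> z; exact: le_trans (normc_Re _) (circleX_bounded _ _).
  under eq_Rintegral do rewrite /= cos_sin_exp/=.
  apply: (@integral_uniform_twopi _ (fun t => sin (n.+1%:R * t) / n.+1%:R) 1).
  - move=> x; have dsin := is_derive1_comp (is_derive_sin (n.+1%:R * x)) (dlin x).
    apply: is_derive_eq.
    by rewrite /GRing.scale/=; field.
  - by move=> x; apply: continuous_comp; [exact: clin|exact: continuous_cos].
  - by move=> x; rewrite ler_norml cos_geN1 cos_le1.
  - by rewrite sper mulr0 sin0.
rewrite (@integral_coord0 (fun z => complex.Im (circle_val z ^+ n.+1)) 1)//; last first.
  by move=> z; exact: le_trans (normc_Im _) (circleX_bounded _ _).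
under eq_Rintegral do rewrite /= cos_sin_exp/=.
apply: (@integral_uniform_twopi _ (fun t => - cos (n.+1%:R * t) / n.+1%:R) 1).
- move=> x; have dcos := is_derive1_comp (is_derive_cos (n.+1%:R * x)) (dlin x).
  apply: is_derive_eq.
  by rewrite /GRing.scale/=; field.
- by move=> x; apply: continuous_comp; [exact: clin|exact: continuous_sin].
- by move=> x; rewrite ler_norml sin_geN1 sin_le1.
- by rewrite cper mulr0 cos0.
Qed.

End circle_moments.

Section orthogonality.
Variables (R : realType) (m : probability (Tinf R) R).
Hypothesis hm : is_haar_Tinf m.
Local Notation Tinf := (Tinf R).
Local Notation cI := (complex_integral m).

Lemma measurable_coordX j (k : int) :
  measurable_fun setT (fun chi : Tinf => circle_val (chi j) ^ k).
Proof.
case: k => n; first exact: (@measurable_complexX _ _ _ _ n (@measurable_coordinate R j)).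
rewrite (_ : (fun _ => _) = fun chi => conjc (circle_val (chi j) ^+ n.+1)).
  by apply: measurable_conjc; apply: measurable_complexX; exact: measurable_coordinate.
by apply/funext => chi; rewrite -[_ ^+ _]/(_ ^ n.+1%:Z) conjc_circleX NegzE.
Qed.

Lemma normc_circleX (z : circle R) (k : int) : normc (circle_val z ^ k) = 1.
Proof.
by case: k => n; rewrite ?NegzE -?exprnN -?exprnP ?normcV normcX normc_circle
  expr1n ?invr1.
Qed.

Lemma integral_circle_expz (k : int) : k != 0 ->
  cI (fun chi => circle_val (chi 0%N) ^ k) = 0.
Proof.
case: k => [[//|n]|n] _; first exact: integral_circleX.
rewrite (_ : (fun _ => _) = fun chi => conjc (circle_val (chi 0%N) ^+ n.+1)).
  rewrite complex_integral_conj; last first.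
    apply: (@cintegrable_bounded _ _ _ _ _ 1).
      by apply: measurable_complexX; exact: measurable_coordinate.
    by move=> x; exact: circleX_bounded.
  by rewrite integral_circleX// conjc0.
by apply/funext => chi; rewrite -[_ ^+ _]/(_ ^ n.+1%:Z) conjc_circleX NegzE.
Qed.

(** Either the first exponent is nonzero and the first factor has integral zero,
or the other coordinates contain a nonzero exponent: induction, the first
coordinate being independent of the shifted ones. *)
Lemma integral_monomial M (e : nat -> int) :
  (exists2 i, (i < M)%N & e i != 0) ->
  cI (fun chi => \prod_(i < M) circle_val (chi i) ^ e i) = 0.
Proof.
elim: M e => [|M ih] e [i iM ei]; first by rewrite ltn0 in iM.
have mmon (e' : nat -> int) N : measurable_fun setT
    (fun chi : Tinf => \prod_(i < N) circle_val (chi i) ^ e' i).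
  elim: N => [|N ihN]; first by under eq_fun do rewrite big_ord0; exact: measurable_cst.
  under eq_fun do rewrite big_ord_recr.
  by apply: measurable_complexM => //; exact: measurable_coordX.
have nmon (e' : nat -> int) N (chi : Tinf) :
    normc (\prod_(i < N) circle_val (chi i) ^ e' i) <= 1.
  by rewrite normc_prod big1// => j _; exact: normc_circleX.
pose f (chi : Tinf) := circle_val (chi 0%N) ^ e 0%N.
pose g (chi : Tinf) := \prod_(i < M) circle_val (chi i) ^ e i.+1.
transitivity (cI (fun chi => f chi * g (tail_coords 1 chi))).
  by congr complex_integral; apply/funext => chi; rewrite big_ord_recl.
rewrite (@haar_prod_complex _ _ hm 1 f g 1 1)//.
- have [e0|e0] := eqVneq (e 0%N) 0; last by rewrite integral_circle_expz ?mul0r.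
  rewrite (ih (fun i => e i.+1)) ?mulr0//.
  case: i iM ei => [|i]; first by rewrite e0 eqxx.
  by rewrite ltnS => iM ei; exists i.
- exact: measurable_coordX.
- exact: (mmon (fun i => e i.+1)).
- by move=> x; rewrite normc_circleX.
- exact: (nmon (fun i => e i.+1)).
Qed.

Lemma integral_torus_character q : 0 < q -> q != 1 ->
  cI (fun chi => torus_character chi q) = 0.
Proof.
move=> q0 q1; have [M qM] := prime_exponent_finite q0.
under eq_fun do rewrite (torus_characterE _ q0 qM).
apply: (integral_monomial (e := fun i => prime_exponent (nth_prime i) q)).
apply: contrapT => h; move/eqP: q1; apply.
have {}h i : prime_exponent (nth_prime i) q = 0.
  have [iM|/qM//] := ltnP i M; apply/eqP; apply: contrapT => /negP ei.
  by apply: h; exists i.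
have [a [b [a0 b0 qE _ _]]] := posq_frac q0.
suff ab : a = b by rewrite qE ab divff// pnatr_eq0 -lt0n.
apply: (eqn_from_log a0 b0) => p.
have [pp|pp] := boolP (prime p); last by rewrite /logn (negbTE pp).
have := h (prime_index p); rewrite prime_indexK// qE prime_exponent_frac//.
by move=> /eqP; rewrite subr_eq0 => /eqP[].
Qed.

(** The trigonometric polynomials with frequencies in S, generated by adding one
term at a time. Products and conjugates only act on the set S of frequencies, so
all orthogonality relations below reduce to arithmetic of exponents. *)
Inductive cspan (S : rat -> Prop) : (Tinf -> R[i]) -> Prop :=
| cspan0 : cspan S (fun=> 0)
| cspanDZ c q f : 0 < q -> S q -> cspan S f ->
    cspan S (fun chi => c * torus_character chi q + f chi).

Lemma cspan_char S c q : 0 < q -> S q ->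
  cspan S (fun chi => c * torus_character chi q).
Proof.
move=> q0 Sq; under eq_fun do rewrite -[_ * _]addr0.
by apply: cspanDZ => //; exact: cspan0.
Qed.

Lemma cspanD S f g : cspan S f -> cspan S g -> cspan S (fun chi => f chi + g chi).
Proof.
elim=> [|c q {}f q0 Sq _ ih] Sg; first by under eq_fun do rewrite add0r.
by under eq_fun do rewrite -addrA; apply: cspanDZ => //; exact: ih.
Qed.

Lemma cspanZ S c f : cspan S f -> cspan S (fun chi => c * f chi).
Proof.
elim=> [|c' q {}f q0 Sq _ ih]; first by under eq_fun do rewrite mulr0; exact: cspan0.
by under eq_fun do rewrite mulrDr mulrA; exact: cspanDZ.
Qed.

Lemma cspan_sum S (I : Type) (r : seq I) (F : I -> Tinf -> R[i]) :
  (forall i, cspan S (F i)) -> cspan S (fun chi => \sum_(i <- r) F i chi).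
Proof.
move=> SF; elim: r => [|i r ih].
  by under eq_fun do rewrite big_nil; exact: cspan0.
by under eq_fun do rewrite big_cons; exact: cspanD.
Qed.

Lemma cspanS (S S' : rat -> Prop) f : (forall q, S q -> S' q) ->
  cspan S f -> cspan S' f.
Proof.
move=> SS'; elim=> [|c q {}f q0 Sq _ ih]; first exact: cspan0.
by apply: cspanDZ => //; exact: SS'.
Qed.

Lemma cspanM (S S' S'' : rat -> Prop) f g :
  (forall q r, 0 < q -> 0 < r -> S q -> S' r -> S'' (q * r)) ->
  cspan S f -> cspan S' g -> cspan S'' (fun chi => f chi * g chi).
Proof.
move=> SS' Sf Sg; elim: Sf => [|c q {}f q0 Sq _ ih].
  by under eq_fun do rewrite mul0r; exact: cspan0.
under eq_fun do rewrite mulrDl; apply: cspanD => //.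
elim: Sg {ih} => [|c' r {}g r0 Sr _ ihg].
  by under eq_fun do rewrite mulr0; exact: cspan0.
under eq_fun do rewrite mulrDr mulrACA -torus_characterM//.
by apply: cspanDZ; [exact: mulr_gt0|exact: SS'|].
Qed.

Lemma cspan_conj (S S' : rat -> Prop) f : (forall q, 0 < q -> S q -> S' q^-1) ->
  cspan S f -> cspan S' (fun chi => conjc (f chi)).
Proof.
move=> SS'; elim=> [|c q {}f q0 Sq _ ih].
  by under eq_fun do rewrite conjc0; exact: cspan0.
under eq_fun do rewrite rmorphD/= rmorphM/= -torus_characterV//.
by apply: cspanDZ => //; [rewrite invr_gt0|exact: SS'].
Qed.

Lemma cspan_measurable S f : cspan S f -> measurable_fun setT f.
Proof.
elim=> [|c q {}f q0 Sq _ ih]; first exact: measurable_cst.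
apply: measurable_complexD => //; apply: measurable_complexM.
  exact: measurable_cst.
exact: measurable_torus_character.
Qed.

Lemma cspan_bounded S f : cspan S f -> exists M, forall chi, normc (f chi) <= M.
Proof.
elim=> [|c q {}f q0 Sq _ [M ih]]; first by exists 0 => chi; rewrite normc0.
exists (normc c + M) => chi; rewrite (le_trans (le_normcD _ _))//.
by rewrite lerD// normcM normc_torus_character mulr1.
Qed.

Lemma cspan_integrable S f : cspan S f -> cintegrable m f.
Proof.
move=> Sf; have [M fM] := cspan_bounded Sf.
exact: cintegrable_bounded (cspan_measurable Sf) fM.
Qed.

Lemma integral_cspan (S : rat -> Prop) f : (forall q, S q -> q != 1) ->
  cspan S f -> cI f = 0.
Proof.
move=> S1; elim=> [|c q {}f q0 Sq Sf ih]; first by rewrite complex_integral_cst.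
have Sc : cspan S (fun chi => 1 * torus_character chi q) by exact: cspan_char.
rewrite complex_integralD; last 2 first.
- by apply: (@cspan_integrable S); exact: cspan_char.
- exact: cspan_integrable Sf.
rewrite ih addr0 complex_integralZ; last first.
  by have := cspan_integrable Sc; under eq_fun do rewrite mul1r.
by rewrite integral_torus_character ?mulr0// S1.
Qed.

(** The condition on Fourier coefficients that cuts H^q out of L^q. *)
Definition analytic (f : Tinf -> R[i]) :=
  forall q : rat, 0 < q -> q \isn't a Num.int -> fourier_coefficient m f q = 0.

Lemma cspan_analytic S f : (forall q, S q -> q \is a Num.int) ->
  cspan S f -> analytic f.
Proof.
move=> Sint Sf r r0 rint; rewrite /fourier_coefficient.
have Sr : cspan (fun q => q = r^-1) (fun chi => conjc (torus_character chi r)).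
  apply: (cspan_conj (S := eq r)); first by move=> q _ ->.
  rewrite (_ : (fun _ => _) = fun chi => 1 * torus_character chi r).
    exact: cspan_char.
  by apply/funext => chi; rewrite mul1r.
apply: (integral_cspan (S := fun q => q != 1)) => //.
apply: cspanM Sf Sr => q s q0 s0 Sq ->.
apply: contra rint => /eqP qr; suff -> : r = q by exact: Sint.
by rewrite -[q](divfK (lt0r_neq0 r0)) qr mul1r.
Qed.

(** An analytic function is orthogonal to every character it has no coefficient
for: these are the perturbations which [functional_bound] exploits. *)
Lemma integral_analytic_cspan (S : rat -> Prop) f g : cintegrable m f ->
  analytic f -> (forall q, S q -> q \isn't a Num.int) -> cspan S g ->
  cI (fun chi => f chi * conjc (g chi)) = 0.
Proof.
move=> fi fa Sint Sg.
suff [] : cintegrable m (fun chi => f chi * conjc (g chi)) /\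
  cI (fun chi => f chi * conjc (g chi)) = 0 by [].
elim: Sg => [|c q {}g q0 Sq Sg [ihi ihe]].
  rewrite (_ : (fun _ => _) = fun=> 0); last first.
    by apply/funext => chi; rewrite conjc0 mulr0.
  by split; [apply: (@cintegrable_bounded _ _ _ _ _ 0) => // x; rewrite normc0|
            rewrite complex_integral_cst].
have qi : cintegrable m (fun chi => f chi * conjc (torus_character chi q)).
  apply: (@cintegrableM _ _ _ _ _ _ 1) => //.
    by apply: measurable_conjc; exact: measurable_torus_character.
  by move=> x; rewrite normc_conj normc_torus_character.
rewrite (_ : (fun _ => _) = fun chi =>
  conjc c * (f chi * conjc (torus_character chi q)) + f chi * conjc (g chi)); last first.
  by apply/funext => chi; rewrite rmorphD rmorphM/= mulrDr mulrCA.
split; first by apply: cintegrableD => //; exact: cintegrableZ.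
rewrite complex_integralD//; last exact: cintegrableZ.
by rewrite ihe addr0 complex_integralZ// [X in _ * X]fa ?mulr0// Sint.
Qed.

End orthogonality.

(** * Polynomial approximation of powers *)

Section bernstein.
Variable R : realType.
Implicit Types (h : nat -> R) (y : R).

(** The recursion on the first of N coin tosses with success probability y: the
value at y is the mean of h over the binomial law. Positivity and moments follow
by induction, without binomial coefficients. *)
Fixpoint bernstein (N : nat) h : {poly R} :=
  if N is N'.+1 then 'X * bernstein N' (fun j => h j.+1) +
                     (1 - 'X) * bernstein N' h
  else (h 0)%:P.

Lemma bernstein_div N h : h 0 = 0 -> exists Q, bernstein N h = 'X * Q.
Proof.
elim: N h => [|N ih] h h0 /=; first by exists 0; rewrite h0 mulr0.
have [Q ->] := ih _ h0.
by exists (bernstein N (fun j => h j.+1) + (1 - 'X) * Q); ring.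
Qed.

Lemma bernstein_le N h h' y : 0 <= y <= 1 -> (forall j, h j <= h' j) ->
  (bernstein N h).[y] <= (bernstein N h').[y].
Proof.
move=> /andP[y0 y1]; elim: N h h' => [|N ih] h h' hh' /=; rewrite !hornerE//.
by apply: lerD; apply: ler_wpM2l; rewrite ?subr_ge0//; exact: ih.
Qed.

(** The first two moments of the binomial law. *)
Lemma bernstein_quadratic N (a b c y : R) :
  (bernstein N (fun j => a + b * j%:R + c * j%:R ^+ 2)).[y] =
  a + b * (N%:R * y) + c * (N%:R * y * (1 - y) + (N%:R * y) ^+ 2).
Proof.
elim: N a b c => [|N ih] a b c /=; first by rewrite hornerC expr0n/= ?mulr0n; ring.
have -> : (fun j => a + b * j.+1%:R + c * j.+1%:R ^+ 2) =
    (fun j => (a + b + c) + (b + 2 * c) * j%:R + c * j%:R ^+ 2).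
  by apply/funext => j; rewrite -natr1; ring.
by rewrite !hornerE/= !ih -natr1; ring.
Qed.

(** Concavity of v ^ g; with the parabola below it gives a two-sided bound of
second order at v = 1, whose mean under the binomial law is explicit. *)
Lemma powR_le_tangent (g v : R) : 0 < g <= 1 -> 0 <= v ->
  v `^ g <= 1 + g * (v - 1).
Proof.
move=> /andP[g0]; rewrite le_eqVlt => /predU1P[->|g1] v0.
  by rewrite powRr1//; lra.
have := @conjugate_powR R (v `^ g) 1 g^-1 (1 - g)^-1 (powR_ge0 _ _) ler01.
rewrite !invr_gt0 subr_gt0 !invrK => /(_ g0 g1 _)/=.
rewrite -powRrM divff ?gt_eqF// powRr1// powR1 mulr1 => h.
apply: (le_trans (h _)); first by ring.
by rewrite le_eqVlt; apply/orP; left; apply/eqP; ring.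
Qed.

(** The constant 4 makes the parabola negative on [0, 1/2], where the estimate
through the logarithm is too weak. *)
Lemma powR_ge_parabola (g v : R) : 0 < g <= 1 -> 0 <= v ->
  1 + g * (v - 1) - 4 * (v - 1) ^+ 2 <= v `^ g.
Proof.
move=> /andP[g0 g1] v0.
have [vs|vl] := leP v (1/2).
  apply: (@le_trans _ _ 0); last exact: powR_ge0.
  have : 0 <= g * (1 - v) by apply: mulr_ge0; lra.
  have : 0 <= (1/2 - v) * (3/2 - v) by apply: mulr_ge0; lra.
  by nra.
have v_gt0 : 0 < v by lra.
have h1 : 1 + g * ln v <= v `^ g.
  by rewrite /powR gt_eqF//; exact: expR_ge1Dx.
have h2 : 1 - v^-1 <= ln v.
  have := @le_ln1Dx R (v^-1 - 1); rewrite ltrBrDl subrr invr_gt0.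
  by move=> /(_ v_gt0); rewrite (_ : 1 + _ = v^-1) ?lnV//; [lra|ring].
apply: le_trans h1; rewrite -addrA lerD2l.
apply: (@le_trans _ _ (g * (1 - v^-1))); last by rewrite ler_wpM2l// ltW.
have -> : 1 - v^-1 = (v - 1) / v by field; rewrite gt_eqF.
have : (v - 1) - 2 * (v - 1) ^+ 2 <= (v - 1) / v.
  rewrite ler_pdivlMr// -subr_ge0.
  rewrite (_ : _ - _ = (v - 1) ^+ 2 * (2 * v - 1)); last by ring.
  by rewrite mulr_ge0 ?sqr_ge0//; lra.
move=> /(ler_wpM2l (ltW g0)); apply: le_trans.
rewrite [leRHS]mulrBr lerD2l lerN2 mulrA ler_wpM2r ?sqr_ge0//; lra.
Qed.

(** Jensen's inequality gives the upper bound, and the variance of the binomial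
law, through the parabola rescaled at its mean, the lower bound. *)
Lemma bernstein_powR (g : R) (y : R) N : 0 < g <= 1 -> 0 < y <= 1 ->
  y `^ g - 4 * y `^ g / y / N.+1%:R <=
  (bernstein N.+1 (fun j => (j%:R / N.+1%:R) `^ g)).[y] <= y `^ g.
Proof.
move=> g01 /andP[y0 y1]; set n : R := N.+1%:R.
have n0 : 0 < n by rewrite ltr0n.
have NnE : N.+1%:R = n by []; clearbody n.
have y01 : 0 <= y <= 1 by rewrite ltW.
have yg0 := powR_gt0 g y0.
have nE : n != 0 by rewrite gt_eqF.
have yE : y != 0 by rewrite gt_eqF.
have pos j : 0 <= j%:R / (n * y) by rewrite divr_ge0// mulr_ge0// ltW.
have scale j : (j%:R / n) `^ g = y `^ g * (j%:R / (n * y)) `^ g.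
  rewrite -powRM ?pos ?(ltW y0)//; congr (_ `^ _).
  by field; rewrite nE yE.
apply/andP; split.
  apply: (@le_trans _ _ (bernstein N.+1 (fun j => y `^ g * (1 - g - 4) +
      (y `^ g * (g + 8) / (n * y)) * j%:R +
      (- 4 * y `^ g / (n * y) ^+ 2) * j%:R ^+ 2)).[y]); last first.
    apply: bernstein_le => // j; rewrite scale.
    apply: le_trans (ler_wpM2l (ltW yg0) (powR_ge_parabola g01 (pos j))).
    by rewrite le_eqVlt; apply/orP; left; apply/eqP; field; rewrite nE yE.
  rewrite bernstein_quadratic NnE.
  rewrite [leRHS](_ : _ = y `^ g - 4 * y `^ g * (1 - y) / y / n); last first.
    by field; rewrite nE yE.
  rewrite lerD2l lerN2; do 2 (apply: ler_wpM2r; first by rewrite invr_ge0 ltW).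
  by rewrite ger_pMr ?mulr_gt0//; lra.
apply: (@le_trans _ _ (bernstein N.+1 (fun j => y `^ g * (1 - g) +
    (y `^ g * g / (n * y)) * j%:R + 0 * j%:R ^+ 2)).[y]).
  apply: bernstein_le => // j; rewrite scale.
  apply: le_trans (ler_wpM2l (ltW yg0) (powR_le_tangent g01 (pos j))) _.
  by rewrite le_eqVlt; apply/orP; left; apply/eqP; field; rewrite nE yE.
rewrite bernstein_quadratic NnE le_eqVlt; apply/orP; left; apply/eqP.
by field; rewrite nE yE.
Qed.

(** Approximation from below matters: it makes the estimate of the functionals
free of error terms. A Bernstein polynomial of y ^ g vanishes at 0, so it can be
divided by y; this reaches negative exponents a > -1, written as k + g - 1, and
a = (q - 2) / 2 is negative for q < 2. *)
Lemma powR_poly_approx (a : R) : -1 < a -> exists P : nat -> {poly R},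
  forall x, 0 < x <= 4 ->
    (forall N, 0 <= (P N).[x] <= x `^ a) /\ (P N).[x] @[N --> \oo] --> x `^ a.
Proof.
move=> a1.
have [k [g [g01 aE]]] : exists (k : nat) (g : R), 0 < g <= 1 /\ a = k%:R + g - 1.
  have a0 : 0 <= a + 1 by lra.
  have := truncn_itv a0; case: (Num.truncn (a + 1)) => [|k] /andP[tl tr].
    by exists 0, (a + 1); split; [lra|ring].
  have [e|ne] := eqVneq (a + 1) (k.+1%:R).
    by exists k, 1; split; [lra| rewrite -natr1 in e; lra].
  exists k.+1, (a + 1 - k.+1%:R); split; last by ring.
  move: tl; rewrite le_eqVlt eq_sym (negbTE ne)/= => tl.
  by move: tr; rewrite -(natr1 k.+1); lra.
have h0 N : ((0%N)%:R / N.+1%:R : R) `^ g = 0.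
  by rewrite mul0r powR0// gt_eqF//; case/andP: g01.
have Qex N := cid (@bernstein_div N.+1 (fun j => (j%:R / N.+1%:R) `^ g) (h0 N)).
pose P N : {poly R} :=
  (4 `^ a) *: (('X^k * sval (Qex N)) \Po (4^-1 *: 'X)).
exists P => x /andP[x0 x4].
set y := x / 4.
have y01 : 0 < y <= 1 by rewrite /y; lra.
have y0 : 0 < y by case/andP: y01.
have yE : y != 0 by rewrite gt_eqF.
have PE N : (P N).[x] = 4 `^ a * y ^+ k / y *
    (bernstein N.+1 (fun j => (j%:R / N.+1%:R) `^ g)).[y].
  rewrite (svalP (Qex N)) /P hornerZ horner_comp !hornerM hornerXn hornerX.
  rewrite hornerZ hornerX (mulrC _ x) -/y; by field.
have xaE : x `^ a = 4 `^ a * y ^+ k / y * y `^ g.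
  rewrite (_ : x = 4 * y); last by rewrite /y; field.
  rewrite powRM ?ltW// aE -mulrA -mulrA; congr (_ * _).
  rewrite powRD ?yE ?implybT// powRD ?yE ?implybT//.
  by rewrite powR_mulrn ?ltW// powR_inv1 ?ltW//; ring.
have c0 : 0 < 4 `^ a * y ^+ k / y.
  by rewrite divr_gt0// mulr_gt0// ?powR_gt0// exprn_gt0.
split=> [N|].
  rewrite PE xaE; apply/andP; split; last first.
    by rewrite ler_pM2l//; case/andP: (bernstein_powR N g01 y01).
  rewrite mulr_ge0 ?(ltW c0)//.
  have -> : 0 = (bernstein N.+1 (fun j => 0 + 0 * j%:R + 0 * j%:R ^+2)).[y].
    by rewrite bernstein_quadratic; ring.
  apply: bernstein_le => [|j]; first by case/andP: y01 => /ltW -> ->.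
  by rewrite !mul0r !addr0 powR_ge0.
under eq_cvg do rewrite PE.
rewrite xaE; apply: cvgM; first exact: cvg_cst.
apply: (@squeeze_cvgr _ _ _ _ (fun N => y `^ g - 4 * y `^ g / y / N.+1%:R)
  (fun=> y `^ g)).
- by apply: nearW => N; exact: bernstein_powR.
- rewrite -[X in _ --> X]subr0; apply: cvgB; first exact: cvg_cst.
  rewrite -[X in _ --> X](mulr0 (4 * y `^ g / y)).
  by apply: cvgM; [exact: cvg_cst|exact: cvg_harmonic].
- exact: cvg_cst.
Qed.

End bernstein.

(** * Products of sums of two coordinates *)

Section pairs.
Variable R : realType.
Implicit Types (z w : circle R).

(** The symmetric trigonometric polynomials of degree one in two circle variables
have these as a basis, and only [twist 0], that is z + w, is analytic. *)
Definition twist k z w : R[i] :=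
  circle_val z ^+ k.+1 * conjc (circle_val w) ^+ k +
  conjc (circle_val z) ^+ k * circle_val w ^+ k.+1.

Definition sqmod z w : R := normc (circle_val z + circle_val w) ^+ 2.

Lemma circle_conjc z : circle_val z * conjc (circle_val z) = 1.
Proof. by rewrite mul_conjc normc_circle expr1n. Qed.

Lemma sqmodE z w : (sqmod z w)%:C =
  2 + circle_val z * conjc (circle_val w) + conjc (circle_val z) * circle_val w.
Proof.
rewrite /sqmod -mul_conjc rmorphD/= mulrDl !mulrDr !circle_conjc.
by rewrite (mulrC (circle_val w)); ring.
Qed.

Lemma twist0 z w : twist 0 z w = circle_val z + circle_val w.
Proof. by rewrite /twist !expr0 mulr1 mul1r !expr1. Qed.

(** Multiplication by |z + w|^2 = 2 + z / w + w / z acts on the twists by a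
three-term recurrence. For index 0 the term of index -1, which is [twist 0]
again, is folded back: hence the coefficient 3. *)
Lemma sqmod_twist0 z w : (sqmod z w)%:C * twist 0 z w = 3 * twist 0 z w + twist 1 z w.
Proof.
rewrite sqmodE /twist !expr0 !expr1 !mulr1 !mul1r.
have := circle_conjc z; have := circle_conjc w.
set a := circle_val z; set b := circle_val w; set a' := conjc a; set b' := conjc b.
move=> bb aa.
rewrite (_ : _ * _ = 2 * (a + b) + a ^+ 2 * b' + a' * b ^+ 2 + a * (b * b') + b * (a * a'));
  last by ring.
by rewrite aa bb; ring.
Qed.

Lemma sqmod_twistS k z w : (sqmod z w)%:C * twist k.+1 z w =
  2 * twist k.+1 z w + twist k.+2 z w + twist k z w.
Proof.
rewrite sqmodE /twist.
have := circle_conjc z; have := circle_conjc w.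
set a := circle_val z; set b := circle_val w; set a' := conjc a; set b' := conjc b.
move=> bb aa.
rewrite (_ : _ * _ = 2 * (a ^+ k.+2 * b' ^+ k.+1 + a' ^+ k.+1 * b ^+ k.+2) +
   (a ^+ k.+3 * b' ^+ k.+2 + a' ^+ k.+2 * b ^+ k.+3) +
   (a ^+ k.+1 * (a * a') * b' ^+ k * (b * b') +
    a' ^+ k * (a * a') * b ^+ k.+1 * (b * b')));
  last by rewrite !exprS; ring.
by rewrite aa bb !mulr1.
Qed.

(** Real coefficients suffice since polynomials in |z + w|^2 with real
coefficients are used; the bound k0 isolates [twist 0]. *)
Inductive tspan (k0 : nat) : (circle R -> circle R -> R[i]) -> Prop :=
| tspan0 : tspan k0 (fun _ _ => 0)
| tspanDZ (a : R) k f : (k0 <= k)%N -> tspan k0 f ->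
    tspan k0 (fun z w => a%:C * twist k z w + f z w).

Lemma tspan_sqmod f : tspan 0 f -> tspan 0 (fun z w => (sqmod z w)%:C * f z w).
Proof.
elim=> [|a k {}f _ _ ih].
  rewrite (_ : (fun _ _ => _) = fun _ _ => 0); first exact: tspan0.
  by apply/funext => z; apply/funext => w; rewrite mulr0.
case: k => [|k].
  rewrite (_ : (fun _ _ => _) = fun z w => (a + a + a)%:C * twist 0 z w +
    (a%:C * twist 1 z w + (sqmod z w)%:C * f z w)); first by do 2 apply: tspanDZ => //.
  apply/funext => z; apply/funext => w; rewrite mulrDr mulrCA sqmod_twist0 [RHS]addrA.
  by congr (_ + _); rewrite !rmorphD/=; ring.
rewrite (_ : (fun _ _ => _) = fun z w => (a + a)%:C * twist k.+1 z w +
  (a%:C * twist k.+2 z w + (a%:C * twist k z w + (sqmod z w)%:C * f z w))).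
  by do 3 apply: tspanDZ => //.
apply/funext => z; apply/funext => w; rewrite mulrDr mulrCA sqmod_twistS [RHS]addrA [RHS]addrA.
by congr (_ + _); rewrite !rmorphD/=; ring.
Qed.

Lemma tspan_poly (P : {poly R}) :
  tspan 0 (fun z w => (circle_val z + circle_val w) * (P.[sqmod z w])%:C).
Proof.
elim/poly_ind: P => [|P c ih].
  rewrite (_ : (fun _ _ => _) = fun _ _ => 0); first exact: tspan0.
  by apply/funext => z; apply/funext => w; rewrite horner0 mulr0.
rewrite (_ : (fun _ _ => _) = fun z w => c%:C * twist 0 z w + (sqmod z w)%:C *
   ((circle_val z + circle_val w) * (P.[sqmod z w])%:C)).
  by apply: tspanDZ => //; exact: tspan_sqmod.
apply/funext => z; apply/funext => w.
by rewrite twist0 hornerD hornerM hornerX hornerC rmorphD rmorphM/=; ring.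
Qed.

Lemma tspan_split f : tspan 0 f -> exists (c : R) g, tspan 1 g /\
  forall z w, f z w = c%:C * (circle_val z + circle_val w) + g z w.
Proof.
elim=> [|a k {}f _ _ [c [g [sg fE]]]].
  exists 0, (fun _ _ => 0); split; first exact: tspan0.
  by move=> z w; rewrite mul0r addr0.
case: k => [|k].
  exists (a + c), g; split=> // z w.
  by rewrite twist0 fE addrA -mulrDl rmorphD.
exists c, (fun z w => a%:C * twist k.+1 z w + g z w); split.
  exact: tspanDZ.
by move=> z w; rewrite fE addrCA.
Qed.

End pairs.

Section pair_products.
Variables (R : realType) (m : probability (Tinf R) R).
Hypothesis hm : is_haar_Tinf m.
Local Notation Tinf := (Tinf R).
Local Notation cI := (complex_integral m).

Definition pair_sum j (chi : Tinf) : R[i] :=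
  circle_val (chi j.*2) + circle_val (chi j.*2.+1).
Definition pair_poly (P : {poly R}) j (chi : Tinf) : R[i] :=
  pair_sum j chi * (P.[normc (pair_sum j chi) ^+ 2])%:C.

Definition pair_prod n (chi : Tinf) : R[i] := \prod_(j < n) pair_sum j chi.
Definition pair_poly_prod (P : {poly R}) n (chi : Tinf) : R[i] := \prod_(j < n) pair_poly P j chi.

(** By [torus_characterE] this is the exponent of [chi i] in the character
[chi(q)]. *)
Definition freq (q : rat) i := prime_exponent (nth_prime i) q.

Lemma freqM q r i : 0 < q -> 0 < r -> freq (q * r) i = freq q i + freq r i.
Proof. exact: prime_exponentM. Qed.

Lemma freq1 i : freq 1 i = 0.
Proof. by rewrite /freq -[1]/(1%:R) prime_exponent_nat// logn1. Qed.

Lemma freqV q i : 0 < q -> freq q^-1 i = - freq q i.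
Proof. exact: prime_exponentV. Qed.

Lemma cspan_coordX (S : rat -> Prop) i j a b :
  (forall q, 0 < q -> (forall l, freq q l = ((l == i)%:R *+ a - (l == j)%:R *+ b)) -> S q) ->
  cspan S (fun chi : Tinf => circle_val (chi i) ^+ a * conjc (circle_val (chi j)) ^+ b).
Proof.
move=> Sq.
have chX k n : exists2 q, (0 < q) /\ (forall l, freq q l = (l == k)%:R *+ n) &
    forall chi : Tinf, torus_character chi q = circle_val (chi k) ^+ n.
  elim: n => [|n [q [q0 vq] qE]].
    exists 1; last by move=> chi; rewrite torus_character1.
    by split=> // l; rewrite freq1.
  have p0 : 0 < (nth_prime k)%:R :> rat by rewrite ltr0n nth_prime_gt0.
  exists ((nth_prime k)%:R * q).
    split; first exact: mulr_gt0.
    by move=> l; rewrite freqM// vq /freq prime_exponent_nth mulrS.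
  by move=> chi; rewrite torus_characterM// qE torus_character_nth exprS.
have [q [q0 vq] qE] := chX i a; have [r [r0 vr] rE] := chX j b.
rewrite (_ : (fun _ => _) = fun chi => 1 * torus_character chi (q * r^-1)).
  apply: cspan_char; first by rewrite mulr_gt0// invr_gt0.
  apply: Sq; first by rewrite mulr_gt0// invr_gt0.
  by move=> l; rewrite freqM ?invr_gt0// freqV// vq vr.
apply/funext => chi.
by rewrite mul1r torus_characterM ?invr_gt0// torus_characterV// qE rE rmorphXn.
Qed.

Lemma cspan_pair_sum (S : rat -> Prop) j :
  (forall q, 0 < q -> (forall l, freq q l = (l == j.*2)%:R) -> S q) ->
  (forall q, 0 < q -> (forall l, freq q l = (l == j.*2.+1)%:R) -> S q) ->
  cspan S (pair_sum j).
Proof.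
move=> S1 S2; rewrite /pair_sum; apply: cspanD.
  have := @cspan_coordX S j.*2 0 1 0; under eq_fun do rewrite expr1 mulr1.
  by apply=> q q0 vq; apply: S1 => // l; rewrite vq mulr1n mulr0n subr0.
have := @cspan_coordX S j.*2.+1 0 1 0; under eq_fun do rewrite expr1 mulr1.
by apply=> q q0 vq; apply: S2 => // l; rewrite vq mulr1n mulr0n subr0.
Qed.

Lemma cspan_twist k j (S : rat -> Prop) :
  (forall q, 0 < q ->
    (forall l, freq q l = (l == j.*2)%:R *+ k.+1 - (l == j.*2.+1)%:R *+ k) -> S q) ->
  (forall q, 0 < q ->
    (forall l, freq q l = (l == j.*2.+1)%:R *+ k.+1 - (l == j.*2)%:R *+ k) -> S q) ->
  cspan S (fun chi : Tinf => twist k (chi j.*2) (chi j.*2.+1)).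
Proof.
move=> S1 S2; rewrite /twist; apply: cspanD; first exact: cspan_coordX.
under eq_fun do rewrite mulrC.
exact: cspan_coordX.
Qed.

Definition negative_on_pair j (q : rat) := (freq q j.*2 < 0) \/ (freq q j.*2.+1 < 0).

Lemma cspan_negative_on_pair f j : tspan 1 f ->
  cspan (fun q => negative_on_pair j q /\ forall l, l != j.*2 -> l != j.*2.+1 -> freq q l = 0)
    (fun chi : Tinf => f (chi j.*2) (chi j.*2.+1)).
Proof.
have n12 : (j.*2 == j.*2.+1) = false by rewrite ltn_eqF.
have n21 : (j.*2.+1 == j.*2) = false by rewrite gtn_eqF.
elim=> [|a [//|k] {}f _ _ ih]; first exact: cspan0.
apply: cspanD => //; apply: cspanZ; apply: cspan_twist => q q0 vq; split.
- by right; rewrite vq n21 eqxx mul0rn sub0r oppr_lt0 ltr0n.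
- by move=> l /negbTE l1 /negbTE l2; rewrite vq l1 l2 !mul0rn subrr.
- by left; rewrite vq n12 eqxx mul0rn sub0r oppr_lt0 ltr0n.
- by move=> l /negbTE l1 /negbTE l2; rewrite vq l1 l2 !mul0rn subrr.
Qed.

End pair_products.

Section representation.
Variables (R : realType) (m : probability (Tinf R) R).
Hypothesis hm : is_haar_Tinf m.
Local Notation Tinf := (Tinf R).
Local Notation cI := (complex_integral m).

Lemma freq_ge0_int (q : rat) : 0 < q -> (forall l, 0 <= freq q l) -> q \is a Num.int.
Proof.
move=> q0 vq; rewrite Qint_def; apply: contrapT => /negP d1.
have d0 : (0 < `|denq q|)%N by rewrite absz_gt0 denq_neq0.
have d1' : (1 < `|denq q|)%N.
  rewrite ltn_neqAle d0 andbT; apply: contra d1 => /eqP e.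
  by rewrite -[denq q]gez0_abs ?denq_ge0// -e.
have pd := pdiv_prime d1'; set p := pdiv _ in pd.
have := vq (prime_index p); rewrite /freq prime_indexK// /prime_exponent.
have -> : logn p `|numq q| = 0%N.
  apply/eqP; rewrite -leqn0 leqNgt logn_gt0 mem_primes; apply/negP => /and3P[_ _ pn].
  have := coprime_num_den q; rewrite /coprime => /eqP g1.
  have : (p %| 1)%N by rewrite -g1 dvdn_gcd pn pdiv_dvd.
  by rewrite dvdn1 => /eqP p1; rewrite p1 in pd.
rewrite sub0r oppr_ge0 -[(0 : int)]/(0%N%:Z) lez_nat leqn0 => /eqP l0.
have : (0 < logn p `|denq q|)%N by rewrite logn_gt0 mem_primes pd d0 pdiv_dvd.
by rewrite l0.
Qed.

Lemma cspan_pair_sum_at j : cspan (fun q => forall l, l != j.*2 -> l != j.*2.+1 -> freq q l = 0)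
  (@pair_sum R j).
Proof.
by apply: cspan_pair_sum => q q0 vq l /negbTE l1 /negbTE l2; rewrite vq ?l1 ?l2.
Qed.

Lemma measurable_pair_sum j : measurable_fun setT (@pair_sum R j).
Proof. exact: cspan_measurable (cspan_pair_sum_at j). Qed.

Lemma normc_pair_sum j (chi : Tinf) : normc (pair_sum j chi) <= 2.
Proof. by rewrite (le_trans (le_normcD _ _))// !normc_circle. Qed.

Lemma cspan_pair_prod n : cspan (fun q => forall l, 0 <= freq q l) (@pair_prod R n).
Proof.
elim: n => [|n ih].
  rewrite (_ : pair_prod 0 = fun chi => 1 * torus_character chi 1).
    by apply: cspan_char => // l; rewrite freq1.
  by apply/funext => chi; rewrite /pair_prod big_ord0 torus_character1 mulr1.
rewrite (_ : pair_prod n.+1 = fun chi => pair_prod n chi * pair_sum n chi); last first.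
  by apply/funext => chi; rewrite /pair_prod big_ord_recr.
apply: (cspanM _ ih (S' := fun q => forall l, 0 <= freq q l)).
  by move=> q r q0 r0 vq vr l; rewrite freqM// addr_ge0.
by apply: cspan_pair_sum => q q0 vq l; rewrite vq.
Qed.

(** Modulo characters negative in the j-th pair and not involving the others,
(z + w) P(|z + w|^2) is c (z + w), with the same c for all pairs. *)
Definition pair_poly_splits (P : {poly R}) (c : R) := forall j, exists g,
  cspan (fun q => negative_on_pair j q /\
    forall l, l != j.*2 -> l != j.*2.+1 -> freq q l = 0) g /\
  forall chi : Tinf, pair_poly P j chi = c%:C * pair_sum j chi + g chi.

Lemma pair_poly_split (P : {poly R}) : exists c : R, pair_poly_splits P c.
Proof.
have [c [g [sg gE]]] := tspan_split (tspan_poly P).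
exists c => j; exists (fun chi => g (chi j.*2) (chi j.*2.+1)); split.
  exact: cspan_negative_on_pair.
by move=> chi; exact: gE.
Qed.

Lemma cspan_pair_poly P j : cspan (fun q => forall l, l != j.*2 -> l != j.*2.+1 -> freq q l = 0)
  (@pair_poly R P j).
Proof.
have [c /(_ j)[g [sg gE]]] := pair_poly_split P.
rewrite (_ : pair_poly P j = fun chi => c%:C * pair_sum j chi + g chi).
  apply: cspanD; first by apply: cspanZ; exact: cspan_pair_sum_at.
  by apply: cspanS sg => q [].
by apply/funext => chi; rewrite gE.
Qed.

Lemma cspan_pair_poly_prod P n :
  cspan (fun q => forall l, (n.*2 <= l)%N -> freq q l = 0) (@pair_poly_prod R P n).
Proof.
elim: n => [|n ih].
  rewrite (_ : pair_poly_prod P 0 = fun chi => 1 * torus_character chi 1).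
    by apply: cspan_char => // l _; rewrite freq1.
  by apply/funext => chi; rewrite /pair_poly_prod big_ord0 torus_character1 mulr1.
rewrite (_ : pair_poly_prod P n.+1 = fun chi =>
  pair_poly_prod P n chi * pair_poly P n chi); last first.
  by apply/funext => chi; rewrite /pair_poly_prod big_ord_recr.
apply: cspanM _ ih (cspan_pair_poly P n) => q r q0 r0 vq vr l nl.
rewrite freqM// vq ?vr ?addr0//.
- by rewrite gtn_eqF// (leq_trans _ nl)// doubleS.
- by rewrite gtn_eqF// (leq_trans _ nl)// doubleS.
- by rewrite (leq_trans _ nl)// doubleS ltnW// ltnW.
Qed.

(** One factor is replaced at a time. The auxiliary factor Y carries the factors
already replaced: it does not involve the pairs that remain, so the error term is
negative in the pair considered and is orthogonal to f. *)
Lemma pairing_pair_poly_prod (f : Tinf -> R[i]) P (c : R) : cintegrable m f -> analytic m f ->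
  pair_poly_splits P c ->
  forall n, cI (fun chi => f chi * conjc (pair_poly_prod P n chi)) =
    (c ^+ n)%:C * cI (fun chi => f chi * conjc (pair_prod n chi)).
Proof.
move=> fi fa cP n.
have fintM S g : cspan S g -> cintegrable m (fun chi => f chi * conjc (g chi)).
  move=> Sg; have [M gM] := cspan_bounded Sg.
  apply: (@cintegrableM _ _ _ _ _ _ M) => //.
    by apply: measurable_conjc; exact: cspan_measurable Sg.
  by move=> x; rewrite normc_conj.
suff key Y : cspan (fun q => forall l, (l < n.*2)%N -> freq q l = 0) Y ->
    cI (fun chi => f chi * conjc (Y chi * pair_poly_prod P n chi)) =
    (c ^+ n)%:C * cI (fun chi => f chi * conjc (Y chi * pair_prod n chi)).
  have mul1 (g : Tinf -> R[i]) :
      (fun chi => f chi * conjc (1 * g chi)) = fun chi => f chi * conjc (g chi).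
    by apply/funext => chi; rewrite mul1r.
  rewrite -(mul1 (pair_poly_prod P n)) -(mul1 (pair_prod n)); apply: key.
  rewrite (_ : (fun _ => 1) = fun chi => 1 * torus_character chi 1).
    by apply: cspan_char => // l _; rewrite freq1.
  by apply/funext => chi; rewrite torus_character1 mulr1.
elim: n Y => [|n ih] Y SY.
  rewrite expr0 mul1r; congr complex_integral; apply/funext => chi.
  by rewrite /pair_poly_prod /pair_prod !big_ord0.
have [g [sg gE]] := cP n.
have SYPsi : cspan (fun q => freq q n.*2 = 0 /\ freq q n.*2.+1 = 0)
    (fun chi => Y chi * pair_poly_prod P n chi).
  apply: cspanM _ SY (cspan_pair_poly_prod P n) => q r q0 r0 vq vr.
  by rewrite !freqM// !vq ?vr ?addr0// doubleS ltnS// ltnW.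
have SYs : cspan (fun q => forall l, (l < n.*2)%N -> freq q l = 0)
    (fun chi => Y chi * pair_sum n chi).
  apply: cspanM _ SY (cspan_pair_sum_at n) => q r q0 r0 vq vr l ln.
  rewrite freqM// vq ?vr ?addr0//.
  - by rewrite ltn_eqF.
  - by rewrite ltn_eqF// ltnS ltnW.
  - by rewrite doubleS ltnW// ltnS ltnW.
have SYPg : cspan (negative_on_pair n) (fun chi => (Y chi * pair_poly_prod P n chi) * g chi).
  apply: cspanM _ SYPsi sg => q r q0 r0 [v1 v2] [br _].
  by rewrite /negative_on_pair !freqM// v1 v2 !add0r.
have SYPs : cspan (fun=> True) (fun chi => Y chi * pair_poly_prod P n chi * pair_sum n chi).
  exact: cspanM SYPsi (cspan_pair_sum_at n).
have bad_not_int q : negative_on_pair n q -> q \isn't a Num.int.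
  by case; exact: prime_exponent_lt0_not_int.
transitivity (cI (fun chi =>
    c%:C * (f chi * conjc (Y chi * pair_poly_prod P n chi * pair_sum n chi)) +
    f chi * conjc (Y chi * pair_poly_prod P n chi * g chi))).
  congr complex_integral; apply/funext => chi.
  rewrite /pair_poly_prod big_ord_recr/= gE mulrA mulrDr mulrCA.
  by rewrite conjcD (conjcM c%:C) conjc_real mulrDr; congr (_ + _); rewrite mulrCA.
rewrite complex_integralD; [|exact: cintegrableZ (fintM _ _ SYPs)|exact: fintM SYPg].
rewrite complex_integralZ; last exact: fintM SYPs.
rewrite (integral_analytic_cspan fi fa bad_not_int SYPg) addr0.
have -> : (fun chi => f chi * conjc (Y chi * pair_poly_prod P n chi * pair_sum n chi)) =
    fun chi => f chi * conjc (Y chi * pair_sum n chi * pair_poly_prod P n chi).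
  by apply/funext => chi; rewrite (mulrAC (Y chi)).
rewrite (ih _ SYs) mulrA -rmorphM -exprS; congr (_ * complex_integral _ _).
by apply/funext => chi; rewrite /pair_prod big_ord_recr/= -mulrA [pair_sum n chi * _]mulrC.
Qed.

End representation.

Section moments.
Variables (R : realType) (m : probability (Tinf R) R).
Hypothesis hm : is_haar_Tinf m.
Local Notation Tinf := (Tinf R).
Local Notation cI := (complex_integral m).
Local Notation X := (fun chi : Tinf => normc (pair_sum 0 chi)).

Definition moment (q : R) : R := \int[m]_x (X x `^ q).

Lemma measurable_modulus : measurable_fun setT X.
Proof. by apply: measurable_normc; exact: measurable_pair_sum. Qed.

Lemma modulus_itv (x : Tinf) : 0 <= X x <= 2.
Proof. by rewrite normc_ge0 normc_pair_sum. Qed.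

Lemma measurable_modulus_pow q : measurable_fun setT (fun x => X x `^ q).
Proof. exact: (measurableT_comp (measurable_powR _) measurable_modulus). Qed.

Lemma modulus_pow_le q (x : Tinf) : 0 <= q -> X x `^ q <= 2 `^ q.
Proof.
by move=> q0; have /andP[h0 hx] := modulus_itv x; rewrite ge0_ler_powR// ?nnegrE.
Qed.

Lemma modulus_pow_bounded q (x : Tinf) : 0 <= q -> `|X x `^ q| <= 2 `^ q.
Proof. by move=> q0; rewrite ger0_norm ?powR_ge0// modulus_pow_le. Qed.

Lemma measurable_pair_prod n : measurable_fun setT (@pair_prod R n).
Proof. exact: cspan_measurable (cspan_pair_prod R n). Qed.

Lemma pair_prod_recl n (chi : Tinf) :
  pair_prod n.+1 chi = pair_sum 0 chi * pair_prod n (tail_coords 2 chi).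
Proof. by rewrite /pair_prod big_ord_recl. Qed.

Lemma normc_pair_prod n (chi : Tinf) : normc (pair_prod n chi) <= 2 ^+ n.
Proof.
rewrite /pair_prod normc_prod -[X in _ <= _ ^+ X](card_ord n) -prodr_const.
by apply: ler_prod => j _; rewrite normc_ge0 normc_pair_sum.
Qed.

Lemma pair_prod_pow_bounded n q (x : Tinf) : 0 <= q ->
  `|normc (pair_prod n x) `^ q| <= (2 ^+ n) `^ q.
Proof.
move=> q0; rewrite ger0_norm ?powR_ge0//.
by rewrite ge0_ler_powR// ?nnegrE ?normc_ge0 ?exprn_ge0 ?normc_pair_prod.
Qed.

Lemma measurable_pair_prod_pow n q :
  measurable_fun setT (fun x : Tinf => normc (pair_prod n x) `^ q).
Proof.
apply: (measurableT_comp (measurable_powR _)); apply: measurable_normc.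
exact: measurable_pair_prod.
Qed.

(** The factors are independent and identically distributed. *)
Lemma integral_pair_prod_powR q n : 0 <= q ->
  \int[m]_x (normc (pair_prod n x) `^ q) = moment q ^+ n.
Proof.
move=> q0; elim: n => [|n ih].
  under eq_Rintegral do rewrite /pair_prod big_ord0 normc1 powR1.
  by rewrite Rintegral_prob_cst.
rewrite exprS -ih.
rewrite -(@haar_prod_real _ _ hm 2 _ (fun x => normc (pair_prod n x) `^ q)
  (2 `^ q) ((2 ^+ n) `^ q)).
- by apply: eq_Rintegral => x _; rewrite pair_prod_recl normcM powRM// normc_ge0.
- exact: measurable_modulus_pow.
- exact: measurable_pair_prod_pow.
- by move=> x; exact: modulus_pow_bounded.
- by move=> x; exact: pair_prod_pow_bounded.
- by [].
Qed.

(** |z + w|^2 = 2 + z / w + w / z, and the characters have mean zero. *)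
Lemma moment2 : moment 2 = 2.
Proof.
apply: complexI; rewrite -complex_integral_real.
have n12 : (0 == 1 :> nat) = false by [].
have cs : cspan (fun q => q != 1) (fun chi : Tinf =>
    circle_val (chi 0%N) ^+ 1 * conjc (circle_val (chi 1%N)) ^+ 1 +
    circle_val (chi 1%N) ^+ 1 * conjc (circle_val (chi 0%N)) ^+ 1).
  apply: cspanD; apply: cspan_coordX => q q0 vq; apply/eqP => q1.
    by have := vq 0%N; rewrite q1 freq1.
  by have := vq 1%N; rewrite q1 freq1.
rewrite (_ : (fun _ => _) = fun chi => 2 + (
    circle_val (chi 0%N) ^+ 1 * conjc (circle_val (chi 1%N)) ^+ 1 +
    circle_val (chi 1%N) ^+ 1 * conjc (circle_val (chi 0%N)) ^+ 1)); last first.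
  apply/funext => chi; rewrite -[2 : R]/(2%:R) powR_mulrn ?normc_ge0//.
  rewrite [LHS](sqmodE (chi 0%N) (chi 1%N)) !expr1 addrA.
  by rewrite (mulrC (conjc _)).
rewrite complex_integralD; last 2 first.
- by apply: (@cintegrable_bounded _ _ _ _ _ (normc (2:R[i]))) => //; exact: measurable_cst.
- exact: cspan_integrable cs.
rewrite complex_integral_cst (integral_cspan hm _ cs)// addr0.
exact: esym (rmorph_nat (real_complex R) 2).
Qed.

Lemma pairing_pair_prod_diag n :
  cI (fun chi => pair_prod n chi * conjc (pair_prod n chi)) = (2 ^+ n)%:C.
Proof.
rewrite -moment2 -integral_pair_prod_powR// -complex_integral_real.
congr complex_integral; apply/funext => chi.
by rewrite mul_conjc -[2 : R]/(2%:R) powR_mulrn ?normc_ge0.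
Qed.

Lemma analytic_pair_prod n : analytic m (@pair_prod R n).
Proof.
apply: (cspan_analytic hm (S := fun q => 0 < q /\ forall l, 0 <= freq q l)).
  by move=> q [q0 vq]; exact: freq_ge0_int.
elim: (cspan_pair_prod R n) => [|c q f q0 Sq _ ih]; first exact: cspan0.
exact: cspanDZ.
Qed.

Lemma cintegrable_pair_prod n : cintegrable m (@pair_prod R n).
Proof. exact: cspan_integrable (cspan_pair_prod R n). Qed.

Lemma moment_ge1 q : 1 <= q -> 1 <= moment q.
Proof.
move=> q1; have q0 : 0 < q by rewrite (lt_le_trans _ q1).
have m1 : 1 <= moment 1.
  have : moment 2 <= \int[m]_x (2 * X x).
    apply: (@Rintegral_le _ _ _ _ _ _ (2 `^ 2) 4).
    - exact: measurable_modulus_pow.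
    - by apply: measurable_funM => //; exact: measurable_modulus.
    - by move=> x; exact: modulus_pow_bounded.
    - move=> x; have /andP[X0 X2] := modulus_itv x.
      by rewrite ger0_norm ?mulr_ge0//; lra.
    - move=> x; have /andP[X0 X2] := modulus_itv x.
      by rewrite -[leLHS]/(X x `^ 2%:R) powR_mulrn// expr2 ler_wpM2r.
  rewrite moment2 RintegralZl//; last first.
    apply: (@bounded_integrable _ _ _ _ _ 2); first exact: measurable_modulus.
    by move=> x; have /andP[X0 X2] := modulus_itv x; rewrite ger0_norm.
  rewrite (_ : \int[m]_x X x = moment 1); first by lra.
  by apply: eq_Rintegral => x _; rewrite powRr1 ?normc_ge0.
have /= := @Lnorm_nondecreasing _ _ _ m 1%:E q%:E X measurable_modulus.
rewrite !lee_fin lexx q1 => /(_ isT isT).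
rewrite !(Lnorm_bounded _ measurable_modulus modulus_itv)//.
rewrite -!/(moment _) invr1 powRr1 ?(le_trans ler01)//.
rewrite lee_fin => /(le_trans m1) h.
have mq0 : 0 <= moment q by apply: Rintegral_ge0 => x _; exact: powR_ge0.
have : 1 `^ q <= (moment q `^ q^-1) `^ q.
  by rewrite ge0_ler_powR ?nnegrE ?powR_ge0// ltW.
by rewrite powR1 -powRrM mulVf ?gt_eqF// powRr1.
Qed.

End moments.

Section pair_prod_orthogonality.
Variables (R : realType) (m : probability (Tinf R) R).
Hypothesis hm : is_haar_Tinf m.

(** Each character in [pair_prod n] has degree one in each of the first n pairs
and degree zero in the others; this separates the products for distinct n. *)
Lemma cspan_pair_prod_degree n :
  cspan (fun q => forall j, freq q j.*2 + freq q j.*2.+1 = (j < n)%N%:R) (@pair_prod R n).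
Proof.
elim: n => [|n ih].
  rewrite (_ : pair_prod 0 = fun chi => 1 * torus_character chi 1).
    by apply: cspan_char => // j; rewrite !freq1.
  by apply/funext => chi; rewrite /pair_prod big_ord0 torus_character1 mulr1.
rewrite (_ : pair_prod n.+1 = fun chi => pair_prod n chi * pair_sum n chi); last first.
  by apply/funext => chi; rewrite /pair_prod big_ord_recr.
have e01 i j : (i.*2 == j.*2.+1) = false.
  by apply/eqP => /(congr1 odd); rewrite /= !odd_double.
apply: (cspanM _ ih (S' := fun q => forall j, freq q j.*2 + freq q j.*2.+1 = (j == n)%N%:R)).
  move=> q r q0 r0 vq vr j; rewrite !freqM// addrACA vq vr.
  by rewrite ltnS (leq_eqVlt j n); case: ssrnat.ltngtP.
apply: cspan_pair_sum => q q0 vq j; rewrite !vq.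
  by rewrite (eq_sym _.+1) e01 (can_eq doubleK) addr0.
by rewrite e01 eqSS (can_eq doubleK) add0r.
Qed.

Lemma pairing_pair_prod_off_diag n n' : n != n' ->
  complex_integral m (fun chi => pair_prod n chi * conjc (pair_prod n' chi)) = 0.
Proof.
move=> nn'; apply: (integral_cspan hm (S := fun q => q != 1)) => //.
apply: (cspanM _ (cspan_pair_prod_degree n) (cspan_conj _ (cspan_pair_prod_degree n'))
  (S' := fun q => forall j, freq q j.*2 + freq q j.*2.+1 = - (j < n')%N%:R)).
- move=> q r q0 r0 vq vr; apply/eqP => qr.
  have := vr (minn n n'); have := vq (minn n n').
  have := congr1 (fun t => freq t (minn n n').*2 + freq t (minn n n').*2.+1) qr.
  rewrite /= !freqM// addrACA => e e1 e2; move: e; rewrite e1 e2.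
  by rewrite !freq1 !gtn_min !ltnn orbF /=; move: nn'; case: ssrnat.ltngtP.
- by move=> q q0 vq j; rewrite !freqV// -opprD vq.
Qed.

End pair_prod_orthogonality.

(** * Norms of the coefficient functionals *)

Section functional_bound.
Variables (R : realType) (m : probability (Tinf R) R).
Hypothesis hm : is_haar_Tinf m.
Local Notation Tinf := (Tinf R).
Local Notation cI := (complex_integral m).
Local Notation X := (fun chi : Tinf => normc (pair_sum 0 chi)).

(** The constant c of P is found by pairing with [pair_prod 1] itself. *)
Lemma pair_poly_coef P (c : R) : pair_poly_splits P c ->
  \int[m]_x (X x ^+ 2 * P.[X x ^+ 2]) = 2 * c.
Proof.
move=> cP; apply: complexI.
have F1 (chi : Tinf) : pair_prod 1 chi = pair_sum 0 chi by rewrite /pair_prod big_ord1.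
have := pairing_pair_poly_prod (cintegrable_pair_prod m 1) (analytic_pair_prod hm 1) cP 1.
rewrite (pairing_pair_prod_diag hm 1) !expr1 mulrC rmorphM/= => <-.
rewrite -complex_integral_real; congr complex_integral; apply/funext => chi.
rewrite /pair_poly_prod big_ord1 F1 /pair_poly.
by rewrite conjcM conjc_real mulrA mul_conjc -rmorphM.
Qed.

(** On 0 <= y <= 2, y ^ 2 ranges over [0, 4], where P(u) tends to
u ^ ((q - 2) / 2) from below. In particular
|(z + w) P| <= |z + w| ^ (q - 1), the modulus of the Hoelder dual of z + w. *)
Lemma dual_polynomials q : 1 <= q -> exists P : nat -> {poly R},
  (forall N (x : Tinf) j, normc (pair_poly (P N) j x) <= normc (pair_sum j x) `^ (q - 1)) /\
  \int[m]_x (X x ^+ 2 * (P N).[X x ^+ 2]) @[N --> \oo] --> moment m q.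
Proof.
move=> q1; have q0 : 0 < q by rewrite (lt_le_trans _ q1).
have [|P PE] := @powR_poly_approx R ((q - 2) / 2); first by lra.
have main (y : R) : 0 <= y <= 2 ->
    (forall N, 0 <= y ^+ 2 * (P N).[y ^+ 2] <= y `^ q /\
       normc (P N).[y ^+ 2]%:C * y <= y `^ (q - 1)) /\
    y ^+ 2 * (P N).[y ^+ 2] @[N --> \oo] --> y `^ q.
  move=> /andP[y0 y2]; have [->|yE] := eqVneq y 0.
    split=> [N|]; last first.
      by rewrite powR0 ?gt_eqF// expr0n/=; under eq_cvg do rewrite mul0r; exact: cvg_cst.
    by rewrite powR0 ?gt_eqF// expr0n/= mul0r mulr0 lexx powR_ge0.
  have y_gt0 : 0 < y by rewrite lt_def yE.
  have yy : 0 < y ^+ 2 <= 4 by rewrite exprn_gt0//=; nra.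
  have [bd cv] := PE _ yy.
  have pE : (y ^+ 2) `^ ((q - 2) / 2) = y `^ (q - 2).
    by rewrite -powR_mulrn// -powRrM; congr (_ `^ _); field.
  have p2 : y ^+ 2 * y `^ (q - 2) = y `^ q.
    by rewrite -powR_mulrn// -powRD ?yE ?implybT//; congr (_ `^ _); ring.
  have p1 : y `^ (q - 2) * y = y `^ (q - 1).
    rewrite -[X in _ * X](powRr1 y0) -powRD ?yE ?implybT//; congr (_ `^ _); ring.
  split=> [N|].
    have /andP[b0 b1] := bd N; rewrite pE in b1.
    split; last by rewrite normc_real ger0_norm// -p1 ler_wpM2r.
    by rewrite mulr_ge0 ?exprn_ge0//= -p2 ler_wpM2l ?exprn_ge0.
  rewrite -p2 -pE; apply: cvgM => //; exact: cvg_cst.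
exists P; split=> [N x j|].
  rewrite /pair_poly normcM mulrC.
  have h : 0 <= normc (pair_sum j x) <= 2 by rewrite normc_ge0 normc_pair_sum.
  by have [/(_ N)[]] := main _ h.
have mX2 : measurable_fun setT (fun x => X x ^+ 2).
  by apply: measurable_funX; exact: measurable_modulus.
apply: (@Rintegral_dominated_cvg _ _ _ m _ _ (fun=> 2 `^ q)).
- move=> N; apply: measurable_funM => //.
  apply: (@measurableT_comp _ _ _ _ _ _ (fun t : R => (P N).[t])) => //.
  by apply: continuous_measurable_fun; exact: continuous_horner.
- exact: measurable_modulus_pow.
- exact: finite_measure_integrable_cst.
- move=> N x; have [/(_ N)[/andP[h0 h1] _] _] := main _ (modulus_itv x).
  rewrite ger0_norm// (le_trans h1)//.
  exact: (modulus_pow_le x (ltW q0)).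
- by move=> x; have [] := main _ (modulus_itv x).
Qed.

Lemma hoelder_pair_prod q n (f : Tinf -> R[i]) : 1 <= q -> measurable_fun setT f ->
  (\int[m]_x (normc (f x) * normc (pair_prod n x) `^ (q - 1))%:E <=
   Lp_norm m q%:E f * ((moment m q ^+ n) `^ (1 - q^-1))%:E)%E.
Proof.
rewrite le_eqVlt => /predU1P[<-|q1] mf.
  rewrite invr1 !subrr powRr0 mule1 /Lp_norm Lnorm1.
  rewrite le_eqVlt; apply/orP; left; apply/eqP; apply: eq_integral => x _ /=.
  by rewrite powRr0 mulr1 ger0_norm ?normc_ge0.
have q0 : 0 < q by rewrite (lt_trans _ q1).
have qq : 0 < 1 - q^-1 by rewrite subr_gt0 invf_lt1.
have mG : measurable_fun setT (fun x : Tinf => normc (pair_prod n x) `^ (q - 1)).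
  exact: measurable_pair_prod_pow.
have := @hoelder _ _ _ m _ _ q (1 - q^-1)^-1 (measurable_normc mf) mG q0.
rewrite invr_gt0 qq invrK subrKC => /(_ isT erefl).
rewrite Lnorm1 => h; apply: le_trans (le_trans h _).
  rewrite le_eqVlt; apply/orP; left; apply/eqP; apply: eq_integral => x _ /=.
  by rewrite ger0_norm// mulr_ge0 ?normc_ge0 ?powR_ge0.
rewrite lee_wpmul2l ?Lnorm_ge0//.
rewrite (@Lnorm_bounded _ _ _ _ _ ((2 ^+ n) `^ (q - 1)))//; last 2 first.
- move=> x; rewrite powR_ge0/=.
  have := @pair_prod_pow_bounded R n (q - 1) x; rewrite ger0_norm ?powR_ge0//; apply.
  by rewrite subr_ge0 ltW.
- by rewrite invr_gt0.
rewrite lee_fin invrK -(integral_pair_prod_powR hm n (ltW q0)).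
rewrite (_ : \int[m]_x _ = \int[m]_x (normc (pair_prod n x) `^ q))//.
apply: eq_Rintegral => x _; rewrite -powRrM; congr (_ `^ _); field.
by rewrite gt_eqF//= subr_eq0 gt_eqF.
Qed.

(** Replacing [pair_prod n] by the product built on P costs the factor c ^ n,
where 2 c tends to [moment q], and the new kernel is dominated by
|pair_prod n| ^ (q - 1). Hoelder's inequality then yields
(2 / mu) ^ n * (mu ^ n) ^ (1 - 1/q) with mu = [moment q]. *)
Lemma functional_bound q n (f : Tinf -> R[i]) : 1 <= q ->
  cintegrable m f -> analytic m f ->
  ((normc (cI (fun chi => f chi * conjc (pair_prod n chi))))%:E <=
   ((2 / moment m q `^ q^-1) ^+ n)%:E * Lp_norm m q%:E f)%E.
Proof.
move=> q1 fi fa; set K := normc _.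
have mf : measurable_fun setT f by case: fi.
have mq1 := moment_ge1 hm q1; set mu := moment m q in mq1 *.
have mu0 : 0 < mu by rewrite (lt_le_trans _ mq1).
have [P [Pb Pc]] := dual_polynomials q1.
pose I := \int[m]_x (normc (f x) * normc (pair_prod n x) `^ (q - 1)).
have powb (x : Tinf) : `|normc (pair_prod n x) `^ (q - 1)| <= (2 ^+ n) `^ (q - 1).
  by apply: pair_prod_pow_bounded; rewrite subr_ge0.
have Ii : m.-integrable setT (EFin \o (fun x => normc (f x) * normc (pair_prod n x) `^ (q - 1))).
  rewrite (_ : _ \o _ = ((EFin \o (fun x => (normc (pair_prod n x) `^ (q - 1))%R)) \*
    (fun x => (normc (f x))%:E))%E); last first.
    by apply/funext => x /=; rewrite -EFinM mulrC.
  apply: integrableMr => //; first exact: measurable_pair_prod_pow.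
    exists ((2 ^+ n) `^ (q - 1)); split; first exact: num_real.
    by move=> M hM x _ /=; rewrite (le_trans (powb x))// ltW.
  by case: fi.
have KN N : ((\int[m]_x (X x ^+ 2 * (P N).[X x ^+ 2])) / 2) ^+ n * K <= I.
  have [c cP] := pair_poly_split (P N).
  rewrite (pair_poly_coef cP) mulrAC divff// mul1r.
  have : c ^+ n * K <= normc (cI (fun chi => f chi * conjc (pair_poly_prod (P N) n chi))).
    rewrite (pairing_pair_poly_prod fi fa cP n) normcM normc_real.
    by rewrite ler_wpM2r ?ler_norm ?normc_ge0.
  move=> /le_trans; apply.
  have PsiS := cspan_pair_poly_prod (P N) n; have [M PsiM] := cspan_bounded PsiS.
  have fPi : cintegrable m (fun chi => f chi * conjc (pair_poly_prod (P N) n chi)).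
    apply: (@cintegrableM _ _ _ _ _ _ M) => //.
      by apply: measurable_conjc; exact: cspan_measurable PsiS.
    by move=> x; rewrite normc_conj.
  apply: le_trans (normc_complex_integral fPi) _.
  apply: le_Rintegral => //; first by case: fPi.
  move=> x _; rewrite normcM normc_conj ler_wpM2l ?normc_ge0//.
  rewrite /pair_poly_prod /pair_prod !normc_prod.
  suff [] : 0 <= \prod_(j < n) normc (pair_sum j x) /\
    \prod_(j < n) normc (pair_poly (P N) j x) <=
    (\prod_(j < n) normc (pair_sum j x)) `^ (q - 1) by [].
  elim/big_rec2: _ => [|j y1 y2 _ [y0 ih]]; first by rewrite powR1.
  rewrite mulr_ge0 ?normc_ge0//; split=> //; rewrite powRM ?normc_ge0//.
  apply: le_trans (ler_wpM2l (normc_ge0 _) ih) _.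
  by rewrite ler_wpM2r ?powR_ge0.
have KI : (mu / 2) ^+ n * K <= I.
  have cv : ((\int[m]_x (X x ^+ 2 * (P N).[X x ^+ 2])) / 2) ^+ n * K @[N --> \oo]
      --> (mu / 2) ^+ n * K.
    apply: cvgM; last exact: cvg_cst.
    apply: (@cvg_comp _ _ _ (fun N => (\int[m]_x (X x ^+ 2 * (P N).[X x ^+ 2])) / 2)
      (fun t : R => t ^+ n) \oo (nbhs (mu / 2)) (nbhs ((mu / 2) ^+ n))).
      by apply: cvgM => //; exact: cvg_cst.
    exact: exprn_continuous.
  by apply: (cvgr_to_le cv); exact: nearW.
have IH := hoelder_pair_prod n q1 mf.
have IE : (\int[m]_x (normc (f x) * normc (pair_prod n x) `^ (q - 1))%:E = I%:E)%E.
  by rewrite /I /Rintegral fineK//; move/integrable_fin_num : Ii; apply.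
have B : (2 / mu) ^+ n * (mu ^+ n) `^ (1 - q^-1) = (2 / mu `^ q^-1) ^+ n.
  rewrite -!powR_mulrn ?divr_ge0 ?powR_ge0 ?(ltW mu0)// -powRrM (mulrC n%:R) powRrM.
  rewrite -powRM ?divr_ge0 ?powR_ge0 ?(ltW mu0)//; congr (_ `^ _).
  rewrite powRB ?(gt_eqF mu0) ?implybT// powRr1 ?(ltW mu0)//.
  by field; rewrite ?gt_eqF ?powR_gt0.
have KE : K <= (2 / mu) ^+ n * I.
  rewrite (_ : K = (2 / mu) ^+ n * ((mu / 2) ^+ n * K)).
    by rewrite ler_wpM2l// exprn_ge0// divr_ge0// ltW.
  rewrite mulrA -exprMn (_ : 2 / mu * _ = 1) ?expr1n ?mul1r//.
  by field; rewrite gt_eqF.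
rewrite -B EFinM -muleA [X in (_ * X)%E]muleC.
apply: (@le_trans _ _ ((2 / mu) ^+ n * I)%:E); first by rewrite lee_fin.
rewrite EFinM lee_wpmul2l//; last by rewrite -IE.
by rewrite lee_fin exprn_ge0// divr_ge0// ltW.
Qed.

End functional_bound.

(** * Strict log-convexity of the moments *)

Section arcs.
Variables (R : realType) (m : probability (Tinf R) R).
Hypothesis hm : is_haar_Tinf m.
Local Notation Tinf := (Tinf R).
Local Notation X := (fun chi : Tinf => normc (pair_sum 0 chi)).

(** Strictness in Lyapunov's inequality and the lower estimate for Dirichlet
kernels both rest on some arcs not being too small. *)
Lemma arclength_ge (A : set (circle R)) (a b : R) : measurable A ->
  0 <= a -> a < b -> b <= 2 * pi ->
  (forall t, a <= t <= b -> A (expi t)) ->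
  (((b - a) / (2 * pi))%:E <= arclength R A)%E.
Proof.
move=> mA a0 ab b2 tA.
have mpre : measurable (@expi R @^-1` A).
  by rewrite -[X in measurable X]setTI; exact: measurable_expi.
apply: (@le_trans _ _ (uniform_prob (twopi_gt0 R) `[a, b])); last first.
  by apply: le_measure; rewrite ?inE// => t /=; rewrite in_itv/=; exact: tA.
rewrite /uniform_prob (eq_integral (fun=> ((2 * pi)^-1)%:E)); last first.
  move=> t; rewrite inE/= in_itv/= => /andP[at_ tb]; rewrite /uniform_pdf subr0.
  by rewrite (le_trans a0 at_) (le_trans tb b2).
by rewrite integral_cst//= lebesgue_measure_itv/= lte_fin ab -EFinB -EFinM mulrC.
Qed.

Lemma measurable_cylinder2 (A B : set (circle R)) : measurable A -> measurable B ->
  measurable [set chi : Tinf | A (chi 0%N) /\ B (chi 1%N)].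
Proof.
move=> mA mB; rewrite (_ : [set _ | _] =
    (setT `&` (fun chi : Tinf => chi 0%N) @^-1` A) `&`
    (setT `&` (fun chi : Tinf => chi 1%N) @^-1` B)); last by rewrite !setTI.
by apply: measurableI; exact: measurable_coord.
Qed.

Lemma haar_rect (A B : set (circle R)) : measurable A -> measurable B ->
  (0 < arclength R A)%E -> (0 < arclength R B)%E ->
  (0 < m [set chi | A (chi 0%N) /\ B (chi 1%N)])%E.
Proof.
move=> mA mB A0 B0; pose C j := if j is 0%N then A else B.
rewrite (_ : [set _ | _] = cylinder 2 C).
  rewrite (haar_cylinder hm 2 (A := C)); last by case.
  by rewrite big_ord_recr big_ord1 mule_gt0.
apply/seteqP; split => chi /=; first by move=> [? ?] [|[|//]].
by move=> h; split; [exact: (h 0%N)|exact: (h 1%N)].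
Qed.

Lemma measurable_gt d (T : measurableType d) (f : T -> R) (c : R) :
  measurable_fun setT f -> measurable [set z | c < f z].
Proof.
move=> mf; rewrite (_ : [set _ | _] = setT `&` f @^-1` `]c, +oo[%classic).
  exact: mf.
by rewrite setTI; apply/seteqP; split => z /=; rewrite in_itv/= andbT.
Qed.

Lemma measurable_circle_Re : measurable_fun setT (fun z : circle R => complex.Re (circle_val z)).
Proof. by have /measurable_complexP[] := @measurable_circle_val R. Qed.

Lemma measurable_circle_Im : measurable_fun setT (fun z : circle R => complex.Im (circle_val z)).
Proof. by have /measurable_complexP[] := @measurable_circle_val R. Qed.

Lemma arclength_gt0 (f : circle R -> R) (h : R -> R) (t0 c : R) :
  measurable_fun setT f -> (forall t, f (expi t) = h t) ->
  {for t0, continuous h} -> 0 <= t0 < 2 * pi -> c < h t0 ->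
  (0 < arclength R [set z | (c < f z)%R])%E.
Proof.
move=> mf fE ch /andP[t00 t0pi] ct.
have : \forall t \near t0, c < h t by exact: (cvgr_gt _ ch).
move=> [e /= e0 he]; have pi0 := twopi_gt0 R.
set b := Num.min (e / 2) (2 * pi - t0).
have b0 : 0 < b by rewrite lt_min divr_gt0//= subr_gt0.
have b1 : b <= 2 * pi - t0 by rewrite ge_min lexx orbT.
apply: lt_le_trans (@arclength_ge _ t0 (t0 + b) _ _ _ _ _) => //.
- by rewrite lte_fin addrC addKr divr_gt0.
- exact: measurable_gt.
- by rewrite ltrDl.
- by rewrite addrC -lerBrDr.
move=> t /andP[ta tb] /=; rewrite fE; apply: he => /=.
rewrite distrC ger0_norm ?subr_ge0// (@le_lt_trans _ _ b)//; first lra.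
by rewrite gt_min ltr_pdivrMr// ltr_pMr// ltr1n.
Qed.

Lemma arc_Re (c : R) : c < 1 ->
  (0 < arclength R [set z | (c < complex.Re (circle_val z))%R])%E.
Proof.
move=> c1; apply: (@arclength_gt0 _ cos 0) => //.
- exact: measurable_circle_Re.
- exact: continuous_cos.
- by rewrite lexx twopi_gt0.
- by rewrite cos0.
Qed.

Lemma arc_Im (c : R) : c < 1 ->
  (0 < arclength R [set z | (c < complex.Im (circle_val z))%R])%E.
Proof.
have pi0 := pi_gt0 R.
move=> c1; apply: (@arclength_gt0 _ sin (pi / 2)) => //.
- exact: measurable_circle_Im.
- exact: continuous_sin.
- by apply/andP; split; lra.
- by rewrite sin_pihalf.
Qed.

Lemma modulus_near2 (c : R) : c < 2 -> (0 < m [set x | (c < X x)%R])%E.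
Proof.
move=> c2; pose c' := Num.max (c / 2) 0.
have c'1 : c' < 1 by rewrite gt_max ltr01 andbT; lra.
have mR := measurable_gt c' measurable_circle_Re.
apply: lt_le_trans (haar_rect mR mR (arc_Re c'1) (arc_Re c'1)) _.
apply: le_measure; rewrite ?inE.
- exact: (measurable_cylinder2 mR mR).
- exact: (measurable_gt c (@measurable_modulus R)).
move=> chi /= [h0 h1].
apply: lt_le_trans (normc_Re _); apply: lt_le_trans (ler_norm _).
rewrite /pair_sum raddfD/=.
have : c / 2 <= c' by rewrite le_max lexx.
by move: h0 h1; lra.
Qed.

Lemma modulus_sqr (chi : Tinf) : X chi ^+ 2 =
  (complex.Re (circle_val (chi 0%N)) + complex.Re (circle_val (chi 1%N))) ^+ 2 +
  (complex.Im (circle_val (chi 0%N)) + complex.Im (circle_val (chi 1%N))) ^+ 2.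
Proof. by rewrite normc_sqr /pair_sum !raddfD. Qed.

Lemma circle_sqr (z : circle R) :
  complex.Re (circle_val z) ^+ 2 + complex.Im (circle_val z) ^+ 2 = 1.
Proof. by rewrite -normc_sqr normc_circle expr1n. Qed.

Lemma measurable_not_two_valued (x0 : R) :
  measurable [set x : Tinf | (0 < X x /\ X x != x0)%R].
Proof.
rewrite (_ : [set _ | _] = [set x | 0 < X x] `&` (setT `&` X @^-1` (~` [set x0]))).
  apply: measurableI; first exact: (measurable_gt 0 (@measurable_modulus R)).
  by apply: (@measurable_modulus R) => //; exact: measurableC.
by rewrite setTI; apply/seteqP; split => x /= [x1 /eqP x2].
Qed.

(** Near (1, 1) the square of |z + w| is close to 4, near (1, i) it is close to
2. Both regions have positive measure, and x0 can account for one of them only. *)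
Lemma modulus_not_two_valued (x0 : R) : (0 < m [set x | (0 < X x /\ X x != x0)%R])%E.
Proof.
pose c : R := 99 / 100.
have c1 : c < 1 by rewrite /c; lra.
have mR := measurable_gt c measurable_circle_Re.
have mI := measurable_gt c measurable_circle_Im.
have mS := measurable_not_two_valued x0.
(* 3 lies between the values 2 and 4 of X ^ 2 at (1, i) and (1, 1). *)
have [x03|x03] := leP (x0 ^+ 2) 3.
  apply: lt_le_trans (haar_rect mR mR (arc_Re c1) (arc_Re c1)) _.
  apply: le_measure; rewrite ?inE//.
    exact: (@measurable_cylinder2 _ _ mR mR).
  move=> chi /= [h0 h1].
  have X3 : 3 < X chi ^+ 2.
    rewrite modulus_sqr; move: h0 h1; rewrite /c.
    set a := complex.Re _; set a' := complex.Re _; set b := complex.Im _ + complex.Im _ => h0 h1.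
    have : 0 <= (a + a' - 198 / 100) * (a + a' + 198 / 100) by apply: mulr_ge0; lra.
    by have := sqr_ge0 b; lra.
  split; last by apply: contraTneq x03 => <-; rewrite -ltNge.
  rewrite lt_def normc_ge0 andbT; apply: contraTneq X3 => ->.
  by rewrite expr0n/= -leNgt.
apply: lt_le_trans (haar_rect mR mI (arc_Re c1) (arc_Im c1)) _.
apply: le_measure; rewrite ?inE//.
  exact: (@measurable_cylinder2 _ _ mR mI).
move=> chi /= [].
have := circle_sqr (chi 0%N); have := circle_sqr (chi 1%N).
have := modulus_sqr chi.
set a := complex.Re _; set b := complex.Im _; set a' := complex.Re _; set b' := complex.Im _.
rewrite /c => XE e1 e0 h0 h1.
have sq (r : R) : 99 / 100 < r -> 98 / 100 <= r ^+ 2.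
  move=> hr; have : 0 <= (r - 99 / 100) * (r + 99 / 100) by apply: mulr_ge0; lra.
  by lra.
have bb : b ^+ 2 <= 2 / 100 by have := sq _ h0; lra.
have aa' : a' ^+ 2 <= 2 / 100 by have := sq _ h1; lra.
have a1 : a ^+ 2 <= 1 by have := sqr_ge0 b; lra.
have b1 : b' ^+ 2 <= 1 by have := sqr_ge0 a'; lra.
have amgm (r s : R) : r ^+ 2 <= 1 -> s ^+ 2 <= 2 / 100 -> - (1 / 4) < r * s < 1 / 4.
  move=> hr hs; have := sqr_ge0 (r - 7 * s); have := sqr_ge0 (r + 7 * s).
  by move=> ? ?; lra.
have X13 : 1 < X chi ^+ 2 < 3.
  rewrite XE; have -> : (a + a') ^+ 2 + (b + b') ^+ 2 = 2 + 2 * a * a' + 2 * b * b'.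
    by lra.
  have := amgm _ _ a1 aa'; have := amgm _ _ b1 bb; rewrite (mulrC b').
  by lra.
case/andP: X13 => X1 X3; split.
  rewrite lt_def normc_ge0 andbT; apply: contraTneq X1 => ->.
  by rewrite expr0n/= -leNgt.
by apply: contraTneq X3 => ->; rewrite -leNgt ltW.
Qed.

End arcs.

Section gap.
Variables (R : realType) (m : probability (Tinf R) R).
Hypothesis hm : is_haar_Tinf m.
Local Notation Tinf := (Tinf R).
Local Notation X := (fun chi : Tinf => normc (pair_sum 0 chi)).
Local Notation moment := (moment m).

(** Strict convexity of the exponential, from 1 + x < exp x for x <> 0. *)
Lemma amgm_strict (x y t : R) : 0 < x -> 0 < y -> 0 < t < 1 -> x != y ->
  x `^ (1 - t) * y `^ t < (1 - t) * x + t * y.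
Proof.
move=> x0 y0 /andP[t0 t1] xy.
set a := ln x; set b := ln y; set z := (1 - t) * a + t * b.
have xE : x = expR a by rewrite lnK.
have yE : y = expR b by rewrite lnK.
have ab : a != b by apply: contra xy => /eqP e; rewrite xE yE e.
rewrite /powR (gt_eqF x0) (gt_eqF y0) -expRD -/a -/b -/z xE yE.
have az : a - z = t * (a - b) by rewrite /z; ring.
have bz : b - z = (1 - t) * (b - a) by rewrite /z; ring.
have t1' : 0 < 1 - t by lra.
clearbody z.
have above (c : R) : c - z != 0 -> expR z * (1 + (c - z)) < expR c.
  move=> cz; rewrite -[c in ltRHS](subrKC z) expRD ltr_pM2l ?expR_gt0//.
  exact: expR_gt1Dx.
have hx : (1 - t) * (expR z * (1 + (a - z))) < (1 - t) * expR a.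
  by rewrite ltr_pM2l// above// az mulf_neq0 ?subr_eq0// gt_eqF.
have hy : t * (expR z * (1 + (b - z))) < t * expR b.
  by rewrite ltr_pM2l// above// bz mulf_neq0 ?subr_eq0 1?eq_sym// lt_eqF.
apply: le_lt_trans (ltrD hx hy); rewrite az bz.
by rewrite le_eqVlt; apply/orP; left; apply/eqP; ring.
Qed.

Lemma powR_div (x A r : R) : 0 <= x -> 0 < A -> (x / A) `^ r = x `^ r / A `^ r.
Proof.
move=> x0 A0; rewrite powRM ?invr_ge0 ?(ltW A0)//; congr (_ * _).
by rewrite -powR_inv1 ?(ltW A0)// -powRN -powRrM mulN1r.
Qed.

Lemma Rintegral_gt0 (h : Tinf -> R) (M : R) (E : set Tinf) : measurable_fun setT h ->
  (forall x, 0 <= h x <= M) -> measurable E -> (0 < m E)%E ->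
  (forall x, E x -> 0 < h x) -> 0 < \int[m]_x h x.
Proof.
move=> mh hM mE E0 hE.
have hb x : `|h x| <= M by have /andP[h0 hx] := hM x; rewrite ger0_norm.
rewrite lt_def Rintegral_ge0 ?andbT; last by move=> x _; case/andP: (hM x).
apply/negP => /eqP e.
have : (\int[m]_x `|(h x)%:E| = 0)%E.
  rewrite -[RHS]/(0%:E) -e -(EFin_Rintegral m mh hb)//.
  by apply: eq_integral => x _; rewrite /= ger0_norm//; case/andP: (hM x).
move/(ae_eq_integral_abs m measurableT) => /(_ _)[|N [mN N0 hN]].
  exact/measurable_EFinP.
have : (m E <= m N)%E.
  apply: le_measure; rewrite ?inE// => x Ex; apply: hN => /= /(_ I)[hx].
  by have := hE _ Ex; rewrite hx ltxx.
by rewrite N0 leNgt E0.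
Qed.

Lemma moment_gt0 q : 1 <= q -> 0 < moment q.
Proof. by move=> q1; rewrite (lt_le_trans ltr01)// moment_ge1. Qed.

Lemma integrable_modulus_pow q : 0 <= q ->
  m.-integrable setT (EFin \o (fun x => X x `^ q)).
Proof.
move=> q0; apply: (@bounded_integrable _ _ _ _ _ (2 `^ q)).
  exact: measurable_modulus_pow.
by move=> x; exact: modulus_pow_bounded.
Qed.

(** Integrate the weighted AM-GM inequality for X ^ a / A and X ^ b / B, where A
and B are the moments. Equality at a point forces X = 0 or X ^ (b - a) = B / A,
and X avoids these two values on a set of positive measure. *)
Lemma lyapunov_strict (a b t : R) : 1 <= a -> a < b -> 0 < t < 1 ->
  moment ((1 - t) * a + t * b) < moment a `^ (1 - t) * moment b `^ t.
Proof.
move=> a1 ab t01; have /andP[t0 t1] := t01; set p := _ + _.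
have b1 : 1 <= b by rewrite (le_trans a1)// ltW.
have p1 : 1 <= p by rewrite /p; nra.
set A := moment a; set B := moment b.
have A0 : 0 < A by exact: moment_gt0.
have B0 : 0 < B by exact: moment_gt0.
have AE : moment a = A by []. have BE : moment b = B by [].
clearbody A B.
have AB0 : 0 < A `^ (1 - t) * B `^ t by rewrite mulr_gt0 ?powR_gt0.
(* phi (X) is the defect in the AM-GM inequality, divided by normalizations. *)
pose phi (y : R) := (1 - t) / A * y `^ a + t / B * y `^ b -
  (A `^ (1 - t) * B `^ t)^-1 * y `^ p.
have key y : 0 < y -> y `^ a / A != y `^ b / B -> 0 < phi y.
  move=> y0 ne.
  have := amgm_strict (divr_gt0 (powR_gt0 a y0) A0) (divr_gt0 (powR_gt0 b y0) B0) t01 ne.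
  rewrite !powR_div ?powR_ge0// -!powRrM mulrACA -powRD ?(gt_eqF y0) ?implybT//.
  rewrite (mulrC a) (mulrC b) -/p /phi -invfM subr_gt0 => h.
  by rewrite mulrC (lt_le_trans h)// le_eqVlt; apply/orP; left; apply/eqP; ring.
have phi0 y : 0 <= y -> 0 <= phi y.
  rewrite le_eqVlt => /predU1P[<-|y0].
    rewrite /phi !powR0 ?mulr0 ?subrr ?addr0 ?gt_eqF//.
    - by rewrite (lt_le_trans ltr01).
    - by rewrite (lt_le_trans ltr01).
    - by rewrite (lt_le_trans ltr01).
  have [e|ne] := eqVneq (y `^ a / A) (y `^ b / B); last exact: ltW (key _ y0 ne).
  rewrite /phi.
  have e1 : (y `^ a / A) `^ (1 - t) * (y `^ b / B) `^ t = y `^ a / A.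
    rewrite -e -powRD ?subrK ?powRr1 ?divr_ge0 ?powR_ge0 ?(ltW A0)//.
    by rewrite mulf_neq0 ?invr_eq0 ?gt_eqF ?powR_gt0 ?implybT.
  move: e1; rewrite !powR_div ?powR_ge0// -!powRrM mulrACA -powRD ?(gt_eqF y0) ?implybT//.
  rewrite (mulrC a) (mulrC b) -/p -invfM mulrC => ->.
  rewrite [X in _ <= X - _](_ : _ = (1 - t) * (y `^ a / A) + t * (y `^ b / B)); last by ring.
  by rewrite -e -mulrDl subrK mul1r subrr.
have mphi : measurable_fun setT (fun x => phi (X x)).
  by apply: measurable_funB; first apply: measurable_funD;
    apply: measurable_funM => //; exact: measurable_modulus_pow.
pose x0 := (B / A) `^ (b - a)^-1.
have ba0 : 0 < b - a by rewrite subr_gt0.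
have : 0 < \int[m]_x phi (X x).
  apply: (@Rintegral_gt0 _ ((1 - t) / A * 2 `^ a + t / B * 2 `^ b)
      [set x : Tinf | (0 < X x /\ X x != x0)%R]) => //.
  - move=> x; have /andP[X0 X2] := modulus_itv x.
    rewrite phi0//= /phi lerBlDr -[leLHS]addr0 lerD//.
      apply: lerD; apply: ler_wpM2l.
      + by rewrite divr_ge0 ?subr_ge0// ltW.
      + exact: modulus_pow_le (le_trans ler01 a1).
      + by rewrite divr_ge0// ltW.
      + exact: modulus_pow_le (le_trans ler01 b1).
    by rewrite mulr_ge0 ?powR_ge0// invr_ge0 ltW.
  - exact: measurable_not_two_valued.
  - exact: modulus_not_two_valued.
  - move=> x /= [X0 Xx0]; apply: key => //; apply: contra Xx0 => /eqP e.
    have e2 : X x `^ (b - a) = B / A.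
      rewrite powRB ?(gt_eqF X0) ?implybT//.
      apply: (mulIf (lt0r_neq0 (powR_gt0 a X0))); rewrite divfK ?gt_eqF ?powR_gt0//.
      apply: (mulIf (lt0r_neq0 (divr_gt0 ltr01 B0))); rewrite mul1r -e.
      by field; rewrite !gt_eqF.
    by rewrite /x0 -e2 -powRrM divff ?(gt_eqF ba0)// powRr1// ltW.
have iZ (c q : R) : 0 <= q -> m.-integrable setT (EFin \o (fun x => c * X x `^ q)).
  by move=> q0; apply: integrable_scale; exact: integrable_modulus_pow.
have [a0 b0 p0] : [/\ 0 <= a, 0 <= b & 0 <= p] by split; exact: le_trans ler01 _.
have iab : m.-integrable setT
    (EFin \o (fun x => (1 - t) / A * X x `^ a + t / B * X x `^ b)).
  rewrite (_ : _ \o _ = (EFin \o (fun x => ((1 - t) / A * X x `^ a)%R)) \+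
    (EFin \o (fun x => (t / B * X x `^ b)%R)))%E//.
  by apply: integrableD => //; exact: iZ.
rewrite /phi RintegralB//; last exact: iZ.
rewrite RintegralD//; [|exact: iZ|exact: iZ].
rewrite !RintegralZl//; try exact: integrable_modulus_pow.
rewrite -!/(moment _) AE BE !divfK ?(gt_eqF A0) ?(gt_eqF B0)// subrK subr_gt0.
by rewrite mulrC ltr_pdivrMr// mul1r.
Qed.

(** The case b = oo of [lyapunov_strict], as 2 is the supremum of X. *)
Lemma lyapunov_sup (a p : R) : 1 <= a -> a < p -> moment p < moment a * 2 `^ (p - a).
Proof.
move=> a1 ap; have a0 : 0 <= a by exact: le_trans a1.
have p0 : 0 <= p by rewrite (le_trans a0)// ltW.
have split2 (y : R) : 0 < y -> y `^ p = y `^ a * y `^ (p - a).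
  by move=> y0; rewrite -powRD ?(gt_eqF y0) ?implybT// subrKC.
have pa0 : 0 < p - a by rewrite subr_gt0.
have c0 : 0 <= 2 `^ (p - a) :> R by exact: powR_ge0.
have iZ : m.-integrable setT (EFin \o (fun x => 2 `^ (p - a) * X x `^ a)).
  by apply: integrable_scale; exact: integrable_modulus_pow.
rewrite mulrC -RintegralZl//; last exact: integrable_modulus_pow.
rewrite -subr_gt0 -RintegralB//; last exact: integrable_modulus_pow.
apply: (@Rintegral_gt0 _ (2 `^ (p - a) * 2 `^ a)
    [set x : Tinf | (0 < X x /\ X x != 2)%R]).
- apply: measurable_funB; last exact: measurable_modulus_pow.
  by apply: measurable_funM => //; exact: measurable_modulus_pow.
- move=> x; have /andP[X0 X2] := modulus_itv x.
  apply/andP; split.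
    rewrite subr_ge0; move: X0; rewrite le_eqVlt => /predU1P[<-|X0].
      rewrite powR0 ?mulr_ge0 ?powR_ge0// gt_eqF//.
      by rewrite (lt_le_trans _ (ltW ap))// (lt_le_trans ltr01).
    rewrite split2// mulrC ler_wpM2r ?powR_ge0//.
    by rewrite ge0_ler_powR ?nnegrE ?normc_ge0 ?(ltW pa0).
  rewrite lerBlDr -[leLHS]addr0 lerD ?powR_ge0// ler_wpM2l//.
  exact: modulus_pow_le.
- exact: measurable_not_two_valued.
- exact: modulus_not_two_valued.
- move=> x /= [X0 Xx2]; have /andP[_ X2] := modulus_itv x.
  rewrite subr_gt0 split2// mulrC ltr_pM2r ?powR_gt0//.
  by rewrite gt0_ltr_powR ?nnegrE ?ltW// lt_neqAle Xx2.
Qed.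

(** The L^q norm of z_0 + z_1. *)
Definition pair_norm q := moment q `^ q^-1.

Lemma pair_norm_gt0 q : 1 <= q -> 0 < pair_norm q.
Proof. by move=> q1; rewrite powR_gt0// moment_gt0. Qed.

Lemma pair_norm_le q q' : 1 <= q -> q <= q' -> pair_norm q <= pair_norm q'.
Proof.
move=> q1 qq'.
have /= := @Lnorm_nondecreasing _ _ _ m q%:E q'%:E X (@measurable_modulus R).
rewrite !lee_fin => /(_ q1 qq').
by rewrite !(Lnorm_bounded _ (@measurable_modulus R) (@modulus_itv R))//;
  rewrite ?lee_fin// (lt_le_trans ltr01)// (le_trans q1).
Qed.

(** [lyapunov_strict] in terms of norms, with 1/p interpolated instead of p; the
weight t of moments and the weight th of norms are related by t = th * p / b. *)
Lemma pair_norm_lyapunov (a b p th : R) : 1 <= a -> a < b -> 0 < th < 1 ->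
  p^-1 = (1 - th) / a + th / b -> pair_norm p < pair_norm a `^ (1 - th) * pair_norm b `^ th.
Proof.
move=> a1 ab /andP[th0 th1] pE.
have a0 : 0 < a by rewrite (lt_le_trans ltr01).
have b0 : 0 < b by rewrite (lt_trans a0).
have b1 : 1 <= b by rewrite (le_trans a1)// ltW.
have th1' : 0 < 1 - th by lra.
have p0 : 0 < p by rewrite -invr_gt0 pE addr_gt0// divr_gt0.
have pn : p != 0 by rewrite gt_eqF.
have tE : (1 - th) * p / a + th * p / b = 1.
  by rewrite [X in X + _]mulrAC [X in _ + X]mulrAC -mulrDl -pE mulVf.
pose t := th * p / b.
have t01 : 0 < t < 1.
  rewrite /t divr_gt0 ?mulr_gt0//=; rewrite -tE ltrDr divr_gt0// mulr_gt0//.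
have tE' : 1 - t = (1 - th) * p / a by rewrite -[X in X - _]tE /t; ring.
have e : (1 - t) * a + t * b = p.
  by rewrite tE' /t !divfK ?gt_eqF//; ring.
have := lyapunov_strict a1 ab t01; rewrite e /pair_norm.
have : 0 <= moment p by apply: Rintegral_ge0 => x _; exact: powR_ge0.
move: (moment p) (moment a) (moment b) => P A B P0 h.
have : P `^ p^-1 < (A `^ (1 - t) * B `^ t) `^ p^-1.
  by rewrite gt0_ltr_powR ?invr_gt0 ?nnegrE ?mulr_ge0 ?powR_ge0.
congr (_ < _); rewrite powRM; [|exact: powR_ge0|exact: powR_ge0].
rewrite -!(powRrM A) -!(powRrM B) tE' /t.
by congr (_ `^ _ * _ `^ _); field; rewrite pn ?(gt_eqF a0) ?(gt_eqF b0).
Qed.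

Lemma pair_norm_lyapunov_sup (a p : R) : 1 <= a -> a < p ->
  pair_norm p < pair_norm a `^ (a / p) * 2 `^ (1 - a / p).
Proof.
move=> a1 ap; have a0 : 0 < a by rewrite (lt_le_trans ltr01).
have p0 : 0 < p by rewrite (lt_trans a0).
have := lyapunov_sup a1 ap; rewrite /pair_norm.
have : 0 <= moment p by apply: Rintegral_ge0 => x _; exact: powR_ge0.
have := moment_gt0 a1.
move: (moment p) (moment a) => P A A0 P0 h.
have : P `^ p^-1 < (A * 2 `^ (p - a)) `^ p^-1.
  by rewrite gt0_ltr_powR ?invr_gt0 ?nnegrE ?mulr_ge0 ?powR_ge0 ?(ltW A0).
congr (_ < _); rewrite powRM; [|exact: ltW|exact: powR_ge0].
rewrite -!(powRrM A) -!(powRrM 2).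
by congr (_ `^ _ * _ `^ _); field; rewrite ?(gt_eqF a0) ?(gt_eqF p0).
Qed.

(** The L^n norms tend to the supremum norm: the set where X > c1 > c has
positive measure, and (c / c1) ^ n falls below it. *)
Lemma pair_norm_near2 (c : R) : c < 2 -> exists n0 : nat, forall n : nat, (n0 <= n)%N ->
  (0 < n)%N -> c <= pair_norm n%:R.
Proof.
move=> c2; have [c0|c0] := leP c 0.
  by exists 0 => n _ n0; rewrite (le_trans c0)// powR_ge0.
pose c1 := (c + 2) / 2.
have c1c : c < c1 by rewrite /c1; lra.
have c12 : c1 < 2 by rewrite /c1; lra.
have c10 : 0 < c1 by lra.
clearbody c1.
set E := [set x : Tinf | c1 < X x].
have mE : measurable E by exact: (measurable_gt c1 (@measurable_modulus R)).
have E0 := modulus_near2 hm c12; rewrite -/E in E0.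
have Efin : m E \is a fin_num by exact: fin_num_measure.
have mu0 : 0 < fine (m E) by rewrite fine_gt0// E0 -ge0_fin_numE.
set mu := fine (m E) in mu0.
have r1 : `|c / c1| < 1.
  by rewrite ger0_norm ?divr_ge0 ?(ltW c0) ?(ltW c10)// ltr_pdivrMr// mul1r.
have [n0 _ hn0] : \forall n \near \oo, (c / c1) ^+ n < mu.
  have := cvg_expr r1 => h; exact: (cvgr_lt _ h).
exists n0 => n n0n npos; have nn0 : 0 < n%:R :> R by rewrite ltr0n.
have h := hn0 n n0n; rewrite /= in h.
have : c ^+ n <= moment n%:R.
  apply: (@le_trans _ _ (c1 ^+ n * mu)).
    rewrite -[c](divfK (lt0r_neq0 c10)) exprMn mulrC ler_wpM2l ?exprn_ge0 ?ltW//.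
  have -> : c1 ^+ n * mu = \int[m]_x (c1 ^+ n * \1_E x).
    rewrite RintegralZl//; last exact: integrable_indic.
    by rewrite /Rintegral integral_indic// setIT.
  apply: (@Rintegral_le _ _ _ _ _ _ (c1 ^+ n) (2 `^ n%:R)).
  - by apply: measurable_funM => //; exact: measurable_indic.
  - exact: measurable_modulus_pow.
  - move=> x; rewrite normrM (ger0_norm (exprn_ge0 _ (ltW c10))) ler_piMr ?exprn_ge0 ?(ltW c10)//.
    by rewrite indicE; case: (_ \in _); rewrite ?normr1 ?normr0.
  - by move=> x; apply: modulus_pow_bounded.
  - move=> x; rewrite indicE powR_mulrn ?normc_ge0//.
    have [|_] := boolP (x \in E); last by rewrite mulr0 exprn_ge0 ?normc_ge0.
    by rewrite inE /E/= mulr1 => /ltW Ex; rewrite lerXn2r ?nnegrE ?normc_ge0// ltW.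
move=> hc; rewrite /pair_norm.
have : (c ^+ n) `^ n%:R^-1 <= moment n%:R `^ n%:R^-1.
  have c_ge0 := exprn_ge0 n (ltW c0).
  by rewrite ge0_ler_powR ?nnegrE ?invr_ge0// (le_trans c_ge0).
by rewrite -powR_mulrn ?(ltW c0)// -powRrM divff ?(gt_eqF nn0)// powRr1// (ltW c0).
Qed.

(** The norm on H^q of f |-> the integral of f times the conjugate of z_0 + z_1. *)
Definition dual_norm q := 2 / pair_norm q.

(** 1/p, with the convention 1/oo = 0. *)
Definition inv_exponent (p : \bar R) : R := if p is r%:E then r^-1 else 0.

Lemma dual_norm_gap_div (x y z th : R) : 0 < x -> 0 < y -> 0 < z ->
  z < x `^ (1 - th) * y `^ th -> (2 / x) `^ (1 - th) * (2 / y) `^ th < 2 / z.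
Proof.
move=> x0 y0 z0 h; rewrite !powR_div// mulf_div -powRD; last first.
  by rewrite (gt_eqF (ltr0Sn R 1)) implybT.
rewrite subrK powRr1// ltr_pM2l// ltf_pV2 ?posrE//.
by rewrite mulr_gt0 ?powR_gt0.
Qed.

Lemma powR_le_base (x e th : R) : 0 < x -> x <= e -> 1 < e -> 0 < th < 1 ->
  x `^ th <= e.
Proof.
move=> x0 xe e1 /andP[th0 th1]; have e0 : 0 < e by rewrite (lt_trans ltr01).
apply: (@le_trans _ _ (e `^ th)).
  by rewrite ge0_ler_powR ?nnegrE ?(ltW x0) ?(ltW e0) ?(ltW th0).
by apply: ler1_powR; exact: ltW.
Qed.

(** For p2 = oo the functional is bounded through H^r with r large and finite:
the L^r norm is at most the supremum norm, and [pair_norm_near2] keeps the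
inequality strict, l2 = 2 / X_r being as close to 1 as needed. *)
Lemma dual_norm_gap (p1 p : R) (p2 : \bar R) : 1 <= p1 -> p1 < p -> (p%:E < p2)%E ->
  exists th l2 : R, [/\ 0 < th < 1, p^-1 = (1 - th) / p1 + th * inv_exponent p2,
    0 < l2 <= dual_norm p1, dual_norm p1 `^ (1 - th) * l2 `^ th < dual_norm p &
    forall n (f : Tinf -> R[i]), cintegrable m f -> analytic m f ->
      ((normc (complex_integral m (fun chi => f chi * conjc (pair_prod n chi))))%:E <=
       (l2 ^+ n)%:E * Lp_norm m p2 f)%E].
Proof.
move=> p11 p1p pp2.
have p10 : 0 < p1 by rewrite (lt_le_trans ltr01).
have p0 : 0 < p by rewrite (lt_trans p10).
have pge1 : 1 <= p by rewrite (le_trans p11)// ltW.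
have lam_gt0 q : 1 <= q -> 0 < dual_norm q by move=> q1; rewrite divr_gt0// pair_norm_gt0.
have lam_le q q' : 1 <= q -> q <= q' -> dual_norm q' <= dual_norm q.
  move=> q1 qq'; have q'1 := le_trans q1 qq'.
  rewrite /dual_norm; apply: ler_wpM2l; first by [].
  rewrite lef_pV2 ?posrE; [|exact: pair_norm_gt0|exact: pair_norm_gt0].
  exact: pair_norm_le.
case: p2 pp2 => [p2| |]// pp2.
- rewrite lte_fin in pp2.
  have p20 : 0 < p2 by rewrite (lt_trans p0).
  have p21 : 1 <= p2 by rewrite (le_trans pge1)// ltW.
  have i1 : p2^-1 < p^-1 by rewrite ltf_pV2.
  have i2 : p^-1 < p1^-1 by rewrite ltf_pV2.
  have d0 : 0 < p1^-1 - p2^-1 by rewrite subr_gt0 (lt_trans i1).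
  pose th := (p1^-1 - p^-1) / (p1^-1 - p2^-1).
  have th01 : 0 < th < 1.
    apply/andP; split; first by rewrite divr_gt0// subr_gt0.
    by rewrite /th ltr_pdivrMr// mul1r; lra.
  have pE : p^-1 = (1 - th) / p1 + th / p2.
    rewrite (_ : _ + _ = p1^-1 - th * (p1^-1 - p2^-1)); last by ring.
    by rewrite /th divfK ?gt_eqF//; ring.
  exists th, (dual_norm p2); split=> //.
  + apply/andP; split; first exact: lam_gt0.
    by apply: (lam_le _ _ p11); exact: ltW (lt_trans p1p pp2).
  + apply: (dual_norm_gap_div (pair_norm_gt0 p11) (pair_norm_gt0 p21) (pair_norm_gt0 pge1)).
    exact: pair_norm_lyapunov p11 (lt_trans p1p pp2) th01 pE.
  + by move=> n f fi fa; exact: (functional_bound hm n p21 fi fa).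
- pose th := 1 - p1 / p.
  have th01 : 0 < th < 1.
    by rewrite /th subr_gt0 ltr_pdivrMr// mul1r p1p/= ltrBlDr ltrDl divr_gt0.
  have [th0 th1] := andP th01.
  have strict : dual_norm p1 `^ (1 - th) < dual_norm p.
    have := dual_norm_gap_div (pair_norm_gt0 p11) (ltr0Sn R 1) (pair_norm_gt0 pge1) (th := th).
    rewrite divff ?gt_eqF// powR1 mulr1; apply.
    rewrite (_ : 1 - th = p1 / p); last by rewrite /th; ring.
    exact: pair_norm_lyapunov_sup.
  pose e := dual_norm p / dual_norm p1 `^ (1 - th).
  have e1 : 1 < e by rewrite /e ltr_pdivlMr ?powR_gt0 ?lam_gt0// mul1r.
  have e0 : 0 < e by rewrite (lt_trans ltr01).
  (* Any number strictly between 1 and e leaves room on both sides. *)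
  pose e' := (1 + e) / 2.
  have e'e : e' < e by rewrite /e'; lra.
  have e'1 : 1 < e' by rewrite /e'; lra.
  have [|n0 hn0] := @pair_norm_near2 (2 / e').
    by rewrite ltr_pdivrMr ?ltr_pMr//; lra.
  pose n := maxn n0 (Num.truncn p1).+1.
  have nn0 : (n0 <= n)%N by exact: leq_maxl.
  have np1 : p1 <= n%:R.
    apply: (@le_trans _ _ (Num.truncn p1).+1%:R); last by rewrite ler_nat leq_maxr.
    by have /andP[_ /ltW] := truncn_itv (ltW p10).
  have n1 : 1 <= n%:R :> R by rewrite (le_trans p11).
  have ngt0 : (0 < n)%N by rewrite -(ltr0n R) (lt_le_trans ltr01).
  have le' : dual_norm n%:R <= e'.
    rewrite /dual_norm ler_pdivrMr ?pair_norm_gt0// mulrC -ler_pdivrMr; last by lra.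
    exact: hn0.
  exists th, (dual_norm n%:R); split=> //.
  + by rewrite mulr0 addr0 /th opprB addrCA subrr addr0 mulrAC divff ?gt_eqF// mul1r.
  + apply/andP; split; first exact: lam_gt0.
    exact: (lam_le _ _ p11 np1).
  + have l1 := powR_gt0 (1 - th) (lam_gt0 _ p11).
    rewrite mulrC -(ltr_pdivlMr _ _ l1) -/e.
    apply: le_lt_trans e'e.
    exact: (powR_le_base (lam_gt0 _ n1)).
  + move=> k f fi fa.
    apply: (le_trans (functional_bound hm k n1 fi fa)).
    apply: lee_wpmul2l.
      by rewrite lee_fin; exact: exprn_ge0 (ltW (lam_gt0 _ n1)).
    apply: Lp_norm_nondecreasing; rewrite ?lee_fin ?leey//.
    by case: fi.
Qed.

End gap.

(** * Dirichlet kernels *)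

Section dirichlet.
Variables (R : realType) (m : probability (Tinf R) R).
Hypothesis hm : is_haar_Tinf m.
Local Notation Tinf := (Tinf R).
Local Notation cI := (complex_integral m).

Definition dirichlet N (chi : Tinf) : R[i] := \sum_(k < N) circle_val (chi 0%N) ^+ k.

Lemma cspan_dirichlet N : cspan (fun q => forall l, 0 <= freq q l) (dirichlet N).
Proof.
apply: cspan_sum => k.
have := @cspan_coordX R (fun q => forall l, 0 <= freq q l) 0 0 k 0.
rewrite (_ : (fun _ => _) = fun chi : Tinf => circle_val (chi 0%N) ^+ k); last first.
  by apply/funext => chi; rewrite expr0 mulr1.
apply=> q q0 vq l; rewrite vq mulr0n subr0.
by case: (l == 0%N); rewrite ?mul0rn// -[1]/(1%:Z) natz.
Qed.

Lemma measurable_dirichlet N : measurable_fun setT (dirichlet N).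
Proof. exact: cspan_measurable (cspan_dirichlet N). Qed.

Lemma normc_dirichlet N (chi : Tinf) : normc (dirichlet N chi) <= N%:R.
Proof.
rewrite /dirichlet; elim: N => [|N ih]; first by rewrite big_ord0 normc0.
rewrite big_ord_recr/= (le_trans (le_normcD _ _))// -natr1 lerD//.
by rewrite normcX normc_circle expr1n.
Qed.

(** Parseval's identity, by induction: the added term is orthogonal to the
previous ones. *)
Lemma integral_dirichlet_sqr N : \int[m]_x (normc (dirichlet N x) ^+ 2) = N%:R.
Proof.
apply: complexI; rewrite -complex_integral_real.
rewrite (_ : (fun _ => _) = fun chi => dirichlet N chi * conjc (dirichlet N chi)); last first.
  by apply/funext => chi; rewrite mul_conjc.
elim: N => [|N ih].
  rewrite (_ : (fun _ => _) = fun=> 0) ?complex_integral_cst//.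
  by apply/funext => chi; rewrite /dirichlet big_ord0 mul0r.
pose z (chi : Tinf) := circle_val (chi 0%N) ^+ N.
have ortho : cspan (fun q => q != 1) (fun chi => dirichlet N chi * conjc (z chi)).
  rewrite (_ : (fun _ => _) = fun chi => \sum_(k < N) (circle_val (chi 0%N) ^+ k *
      conjc (circle_val (chi 0%N)) ^+ N)); last first.
    apply/funext => chi; rewrite /dirichlet mulr_suml; apply: eq_bigr => k _.
    by rewrite /z; congr (_ * _); exact: (rmorphXn conjc).
  apply: cspan_sum => k; apply: cspan_coordX => q q0 vq; apply/eqP => q1.
  have := vq 0%N; rewrite q1 freq1 eqxx.
  by move=> /esym/eqP; rewrite subr_eq0 eqr_nat ltn_eqF// ltn_ord.
have orthoC : cspan (fun q => q != 1) (fun chi => conjc (dirichlet N chi * conjc (z chi))).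
  by apply: cspan_conj ortho => q q0; rewrite invr_eq1.
have DD : cintegrable m (fun chi => dirichlet N chi * conjc (dirichlet N chi)).
  apply: (@cintegrable_bounded _ _ _ _ _ (N%:R ^+ 2)).
    apply: measurable_complexM; first exact: measurable_dirichlet.
    by apply: measurable_conjc; exact: measurable_dirichlet.
  move=> chi; rewrite normcM normc_conj -expr2 lerXn2r ?nnegrE ?normc_ge0//.
  exact: normc_dirichlet.
rewrite (_ : (fun _ => _) = fun chi => (dirichlet N chi * conjc (dirichlet N chi) +
    dirichlet N chi * conjc (z chi)) + (conjc (dirichlet N chi * conjc (z chi)) + 1)); last first.
  apply/funext => chi; rewrite /dirichlet big_ord_recr/= -/(dirichlet N chi) -/(z chi).
  have zz : z chi * conjc (z chi) = 1 by rewrite mul_conjc /z normcX normc_circle !expr1n.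
  by rewrite conjcD mulrDl !mulrDr zz conjcM conjcK [conjc _ * z chi]mulrC.
have i1 : cintegrable m (fun chi => dirichlet N chi * conjc (z chi)).
  exact: cspan_integrable ortho.
have i2 : cintegrable m (fun chi => conjc (dirichlet N chi * conjc (z chi))).
  exact: cspan_integrable orthoC.
have i3 : cintegrable m (fun=> 1 : R[i]).
  apply: (@cintegrable_bounded _ _ _ _ _ 1); first exact: measurable_cst.
  by move=> x; rewrite normc1.
rewrite complex_integralD; [|exact: cintegrableD|exact: cintegrableD].
rewrite !complex_integralD// ih (integral_cspan hm _ ortho)//.
rewrite (integral_cspan hm _ orthoC)// complex_integral_cst addr0 add0r.
by rewrite -[in RHS]natr1 (rmorphD (real_complex R))/=.
Qed.

Lemma measurable_dirichlet_sqr N :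
  measurable_fun setT (fun x : Tinf => normc (dirichlet N x ^+ 2)).
Proof. by apply: measurable_normc; apply: measurable_complexX; exact: measurable_dirichlet. Qed.

Lemma dirichlet_sqr_itv N (x : Tinf) : 0 <= normc (dirichlet N x ^+ 2) <= N%:R ^+ 2.
Proof.
by rewrite normc_ge0/= normcX lerXn2r ?nnegrE ?normc_ge0// normc_dirichlet.
Qed.

(** Interpolation between |D_N| <= N and the L^2 norm of D_N:
|D_N| ^ (2q) <= N ^ (2(q-1)) * |D_N| ^ 2. This needs 2q >= 2, which is why the
square of the kernel is used rather than the kernel. *)
Lemma Lp_norm_dirichlet_le N (q : \bar R) : (0 < N)%N -> (1 <= q)%E ->
  (Lp_norm m q (fun x => dirichlet N x ^+ 2)%R <= (N%:R `^ (2 - inv_exponent q))%:E)%E.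
Proof.
move=> N0; have n0 : 0 < N%:R :> R by rewrite ltr0n.
case: q => [q| |]// q1; last first.
  rewrite /= subr0 powR_mulrn ?(ltW n0)// /Lp_norm unlock /Lnorm.
  case: ifPn => [mT|]; last by rewrite lee_fin exprn_ge0// ltW.
  apply/ess_supP; apply: nearW => x.
  have : ((`|normc (dirichlet N x ^+ 2)|)%R%:E <= ((N%:R ^+ 2)%R : R)%:E)%E.
    by have /andP[h0 h1] := dirichlet_sqr_itv N x; rewrite lee_fin ger0_norm.
  exact.
rewrite lee_fin in q1.
have q0 : 0 < q by rewrite (lt_le_trans ltr01).
rewrite /Lp_norm.
rewrite (Lnorm_bounded m (measurable_dirichlet_sqr N) (@dirichlet_sqr_itv N) q0).
rewrite lee_fin.
have e : N%:R `^ (2 - q^-1) = (N%:R `^ (2 * q - 1)) `^ q^-1.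
  rewrite -powRrM; congr (_ `^ _); field.
  by rewrite gt_eqF.
rewrite [leRHS]e.
rewrite ge0_ler_powR ?nnegrE ?invr_ge0 ?powR_ge0 ?(ltW q0)//.
  by apply: Rintegral_ge0 => x _; exact: powR_ge0.
have -> : N%:R `^ (2 * q - 1) = \int[m]_x (N%:R `^ (2 * (q - 1)) * normc (dirichlet N x) ^+ 2).
  rewrite RintegralZl//; last first.
    apply: (@bounded_integrable _ _ _ _ _ (N%:R ^+ 2)).
      by apply: measurable_funX; apply: measurable_normc; exact: measurable_dirichlet.
    move=> x; rewrite ger0_norm ?exprn_ge0 ?normc_ge0//.
    by rewrite lerXn2r ?nnegrE ?normc_ge0// normc_dirichlet.
  rewrite integral_dirichlet_sqr.
  transitivity (N%:R `^ (2 * (q - 1)) * N%:R `^ 1 : R); last by rewrite powRr1 ?(ltW n0).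
  by rewrite -powRD ?(gt_eqF n0) ?implybT//; congr (_ `^ _); ring.
apply: (@Rintegral_le _ _ _ _ _ _ ((N%:R ^+ 2) `^ q) (N%:R `^ (2 * (q - 1)) * N%:R ^+ 2)).
- exact: (measurableT_comp (measurable_powR _) (measurable_dirichlet_sqr N)).
- apply: measurable_funM => //.
  by apply: measurable_funX; apply: measurable_normc; exact: measurable_dirichlet.
- move=> x; have /andP[h0 h1] := dirichlet_sqr_itv N x.
  by rewrite ger0_norm ?powR_ge0// ge0_ler_powR ?nnegrE ?(ltW q0)// exprn_ge0// ltW.
- move=> x; rewrite normrM ger0_norm ?powR_ge0// ler_wpM2l ?powR_ge0//.
  rewrite ger0_norm ?exprn_ge0 ?normc_ge0//.
  by rewrite lerXn2r ?nnegrE ?normc_ge0// normc_dirichlet.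
- move=> x; have := normc_dirichlet N x; rewrite normcX.
  have := normc_ge0 (dirichlet N x); set y := normc _ => y0 yN.
  rewrite -powR_mulrn// -powRrM.
  have [->|yn0] := eqVneq y 0.
    rewrite powR0 ?mulr_ge0 ?powR_ge0// mulf_neq0 ?pnatr_eq0// gt_eqF//.
  have -> : 2%:R * q = 2 * (q - 1) + 2%:R by ring.
  rewrite powRD ?(negbTE yn0) ?implybT// ler_wpM2r ?powR_ge0//.
  by rewrite ge0_ler_powR ?nnegrE ?(ltW n0)// mulr_ge0// subr_ge0.
Qed.

(** On the arc of length e / N, all N terms z ^ k have real part at least 1/2,
so |D_N| >= N / 2 there. *)
Lemma Lp_norm_dirichlet_ge (q : R) : 1 <= q -> exists2 c : R, 0 < c &
  forall N, (0 < N)%N ->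
  ((c * N%:R `^ (2 - q^-1))%:E <= Lp_norm m q%:E (fun x => dirichlet N x ^+ 2)%R)%E.
Proof.
move=> q1; have q0 : 0 < q by rewrite (lt_le_trans ltr01).
have [e e0 he] : exists2 e : R, 0 < e & forall t, 0 <= t <= e -> 1 / 2 <= cos t.
  have : \forall t \near (0:R), 1 / 2 < cos t.
    have := @continuous_cos R 0; rewrite /continuous_at cos0 => h.
    by apply: (cvgr_gt _ h); lra.
  move=> [e /= e0 he]; exists (e / 2); first by rewrite divr_gt0.
  move=> t /andP[t0 te]; apply/ltW/he => /=; rewrite sub0r normrN ger0_norm//; lra.
pose eta := Num.min e (2 * pi).
have pi0 := twopi_gt0 R.
have eta0 : 0 < eta by rewrite lt_min e0 pi0.
pose c1 := eta / (2 * pi).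
have c10 : 0 < c1 by rewrite divr_gt0.
have c11 : c1 <= 1 by rewrite ler_pdivrMr// mul1r ge_min lexx orbT.
exists (c1 / 4); first by rewrite divr_gt0.
move=> N N0; have n0 : 0 < N%:R :> R by rewrite ltr0n.
pose A := [set z : circle R | N%:R / 2 <= normc (\sum_(k < N) circle_val z ^+ k)].
have mA : measurable A.
  rewrite (_ : A = setT `&` (fun z : circle R => normc (\sum_(k < N) circle_val z ^+ k))
    @^-1` `[N%:R / 2, +oo[%classic); last first.
    by rewrite setTI; apply/seteqP; split => z /=; rewrite in_itv/= andbT.
  have ms : measurable_fun setT (fun z : circle R => normc (\sum_(k < N) circle_val z ^+ k)).
    apply: measurable_normc; elim: N {N0 n0 A} => [|N ih].
      rewrite (_ : (fun _ => _) = cst 0); first exact: measurable_cst.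
      by apply/funext => z; rewrite big_ord0.
    rewrite (_ : (fun _ => _) = fun z => \sum_(k < N) circle_val z ^+ k + circle_val z ^+ N).
      apply: measurable_complexD => //; apply: measurable_complexX.
      exact: measurable_circle_val.
    by apply/funext => z; rewrite big_ord_recr.
  exact: ms.
have hA : ((c1 / N%:R)%:E <= arclength R A)%E.
  have := @arclength_ge R A 0 (eta / N%:R) mA (lexx _).
  rewrite subr0 (mulrAC eta) -/c1; apply.
  - by rewrite divr_gt0.
  - apply: (@le_trans _ _ eta); last by rewrite ge_min lexx orbT.
    by rewrite ler_pdivrMr// ler_peMr ?(ltW eta0)// ler1n.
  - move=> t /andP[t0 te]; rewrite /A/=.
    apply: le_trans (normc_Re _); apply: le_trans (ler_norm _).
    rewrite raddf_sum/=.
    have -> : N%:R / 2 = \sum_(k < N) (1 / 2 : R).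
      by rewrite sumr_const card_ord -[RHS]mulr_natl mul1r.
    apply: ler_sum => k _; rewrite cos_sin_exp/=; apply: he.
    rewrite mulr_ge0//=; apply: (@le_trans _ _ eta); last by rewrite ge_min lexx.
    rewrite ler_pdivlMr// in te; apply: le_trans te; rewrite mulrC ler_wpM2l//.
    by rewrite ler_nat ltnW.
pose E := [set x : Tinf | A (x 0%N)].
have mE : measurable E.
  rewrite -[E](setTI) /E; exact: (@measurable_coord R 0%N measurableT _ mA).
have hE : c1 / N%:R <= fine (m E).
  rewrite -lee_fin fineK ?fin_num_measure//.
  by rewrite (_ : m E = arclength R A)//; exact: haar_coord0.
rewrite /Lp_norm.
rewrite (Lnorm_bounded m (measurable_dirichlet_sqr N) (@dirichlet_sqr_itv N) q0).
rewrite lee_fin.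
pose b := (N%:R / 2) ^+ 2 : R.
have b0 : 0 <= b by rewrite exprn_ge0// divr_ge0// ltW.
have low : b `^ q * (c1 / N%:R) <= \int[m]_x (normc (dirichlet N x ^+ 2) `^ q).
  apply: (@le_trans _ _ (\int[m]_x (b `^ q * \1_E x))).
    rewrite RintegralZl//; last exact: integrable_indic.
    rewrite /Rintegral integral_indic// setIT.
    by rewrite ler_wpM2l// powR_ge0.
  apply: (@Rintegral_le _ _ _ _ _ _ (b `^ q) ((N%:R ^+ 2) `^ q)).
  - by apply: measurable_funM => //; exact: measurable_indic.
  - exact: (measurableT_comp (measurable_powR _) (measurable_dirichlet_sqr N)).
  - move=> x; rewrite normrM (ger0_norm (powR_ge0 _ _)) ler_piMr ?powR_ge0//.
    by rewrite indicE; case: (_ \in _); rewrite ?normr1 ?normr0.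
  - move=> x; have /andP[h0 h1] := dirichlet_sqr_itv N x.
    by rewrite ger0_norm ?powR_ge0// ge0_ler_powR ?nnegrE ?(ltW q0)// exprn_ge0// ltW.
  - move=> x; rewrite indicE.
    have [|_] := boolP (x \in E); last by rewrite mulr0 powR_ge0.
    rewrite inE /E/= mulr1 => Ex; rewrite ge0_ler_powR ?nnegrE ?(ltW q0) ?normc_ge0//.
    rewrite normcX /b lerXn2r ?nnegrE ?normc_ge0 ?divr_ge0 ?(ltW n0)//.
have cN0 : 0 < c1 / N%:R by rewrite divr_gt0.
have : (b `^ q * (c1 / N%:R)) `^ q^-1 <= (\int[m]_x (normc (dirichlet N x ^+ 2) `^ q)) `^ q^-1.
  rewrite ge0_ler_powR ?nnegrE ?invr_ge0 ?(ltW q0)//.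
    by rewrite mulr_ge0 ?powR_ge0// ltW.
  by apply: Rintegral_ge0 => x _; exact: powR_ge0.
apply: le_trans.
rewrite powRM ?powR_ge0 ?(ltW cN0)// -powRrM divff ?gt_eqF// powRr1//.
rewrite powR_div ?(ltW c10)// powRB ?(gt_eqF n0) ?implybT// powR_mulrn ?(ltW n0)//.
rewrite /b expr_div_n.
have h1 : c1 <= c1 `^ q^-1 by rewrite ger1_powR ?c10// invf_le1.
have Nq : 0 < N%:R `^ q^-1 :> R by rewrite powR_gt0.
rewrite (_ : c1 / 4 * (N%:R ^+ 2 / N%:R `^ q^-1) =
  N%:R ^+ 2 / 2 ^+ 2 * (c1 / N%:R `^ q^-1)); last first.
  by field; rewrite gt_eqF.
rewrite ler_wpM2l ?divr_ge0 ?exprn_ge0 ?(ltW n0)//.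
by rewrite ler_wpM2r ?invr_ge0 ?(ltW Nq).
Qed.

End dirichlet.

(** * Choice of the rank-one operators *)

Section parameters.
Variable R : realType.

(** For a * N ^ (2 - s) to cancel l1 ^ n at s = s1 and l2 ^ n at s = s2 one needs
N ^ (s1 - s2) = (l1 / l2) ^ n; the factor 1/2 pays for rounding N to an integer. *)
Lemma scale_choice (s1 s2 th l1 l2 l : R) (n : nat) :
  0 <= s2 < s1 -> s1 <= 1 -> 0 < th < 1 -> 0 < l2 <= l1 -> 0 < l ->
  exists (N : nat) (a : R), [/\ (0 < N)%N, 0 < a,
    l1 ^+ n * (a * N%:R `^ (2 - s1)) <= 1,
    l2 ^+ n * (a * N%:R `^ (2 - s2)) <= 1 &
    1 / 2 * (l / (l1 `^ (1 - th) * l2 `^ th)) ^+ n <=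
      l ^+ n * (a * N%:R `^ (2 - ((1 - th) * s1 + th * s2)))].
Proof.
move=> /andP[s20 s21] s11 /andP[th0 th1] /andP[l20 l21] l0.
have l10 : 0 < l1 by rewrite (lt_le_trans l20).
pose d := s1 - s2.
have d0 : 0 < d by rewrite subr_gt0.
have d1 : d <= 1 by rewrite /d; lra.
have th1' : 0 < 1 - th by lra.
pose r := (l1 / l2) ^+ n.
have r1 : 1 <= r by rewrite exprn_ege1// ler_pdivlMr// mul1r.
have r0 : 0 < r by rewrite (lt_le_trans ltr01).
(* x is the real solution of x ^ d = r, and N is its rounding. *)
pose x := r `^ d^-1.
have x1 : 1 <= x.
  rewrite -(powRr0 r); apply: ler_powR => //; rewrite invr_ge0; exact: ltW.
have x0 : 0 < x by rewrite (lt_le_trans ltr01).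
have xd : x `^ d = r.
  by rewrite /x -powRrM mulVf ?(gt_eqF d0)// powRr1 ?(ltW r0).
pose N := (Num.truncn x).+1.
have /andP[trl tru] := truncn_itv (ltW x0).
have n0 : 0 < N%:R :> R by rewrite ltr0n.
have xN : x <= N%:R := ltW tru.
have N2x : N%:R <= 2 * x by rewrite /N -natr1; lra.
have Nd_ge : r <= N%:R `^ d.
  rewrite -xd ge0_ler_powR ?nnegrE ?(ltW d0) ?(ltW x0) ?(ltW n0)//.
have Nd_le : N%:R `^ d <= 2 * r.
  apply: (@le_trans _ _ ((2 * x) `^ d)).
    by rewrite ge0_ler_powR ?nnegrE ?(ltW d0) ?(ltW n0) ?mulr_ge0 ?(ltW x0).
  rewrite powRM ?(ltW x0)// xd; apply: ler_wpM2r; first exact: ltW.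
  by apply: ler1_powR => //; rewrite ler1n.
have N0 : (0 < N)%N by [].
clearbody N.
pose D := l2 ^+ n * N%:R `^ (2 - s2).
have D0 : 0 < D by rewrite mulr_gt0 ?exprn_gt0 ?powR_gt0.
exists N, D^-1; split=> //.
- by rewrite invr_gt0.
- rewrite (_ : _ * _ = r / N%:R `^ d); last first.
    have -> : N%:R `^ (2 - s1) = N%:R `^ (2 - s2) / N%:R `^ d.
      by rewrite -powRB ?(gt_eqF n0) ?implybT//; congr (_ `^ _); rewrite /d; ring.
    rewrite /D /r expr_div_n.
    by field; rewrite !(gt_eqF (powR_gt0 _ n0)) expf_neq0 ?(gt_eqF l20).
  by rewrite ler_pdivrMr ?powR_gt0// mul1r.
- rewrite mulrCA mulVf//; exact: lt0r_neq0.
have -> : l ^+ n * (D^-1 * N%:R `^ (2 - ((1 - th) * s1 + th * s2))) =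
    (l / l2) ^+ n / (N%:R `^ d) `^ (1 - th).
  rewrite -powRrM /D.
  have -> : N%:R `^ (2 - ((1 - th) * s1 + th * s2)) =
      N%:R `^ (2 - s2) / N%:R `^ (d * (1 - th)).
    by rewrite -powRB ?(gt_eqF n0) ?implybT//; congr (_ `^ _); rewrite /d; ring.
  rewrite expr_div_n.
  by field; rewrite !(gt_eqF (powR_gt0 _ n0)) expf_neq0 ?(gt_eqF l20).
have up : (N%:R `^ d) `^ (1 - th) <= 2 * r `^ (1 - th).
  apply: (@le_trans _ _ ((2 * r) `^ (1 - th))).
    by rewrite ge0_ler_powR ?nnegrE ?powR_ge0 ?(ltW th1') ?mulr_ge0 ?(ltW r0).
  rewrite powRM ?(ltW r0)//; apply: ler_wpM2r; first exact: powR_ge0.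
  by apply: ler1_powR; [rewrite ler1n|lra].
have rE : r `^ (1 - th) = ((l1 / l2) `^ (1 - th)) ^+ n.
  have q0 : 0 <= l1 / l2 by rewrite divr_ge0 ?(ltW l10) ?(ltW l20).
  rewrite /r; elim: (n) => [|k ih]; first by rewrite !expr0 powR1.
  by rewrite !exprS powRM ?exprn_ge0// ih.
have -> : (l / (l1 `^ (1 - th) * l2 `^ th)) ^+ n = (l / l2) ^+ n / r `^ (1 - th).
  rewrite rE -expr_div_n; congr (_ ^+ n).
  have e : l2 = l2 `^ (1 - th) * l2 `^ th.
    by rewrite -powRD ?(gt_eqF l20) ?implybT// subrK powRr1 ?(ltW l20).
  rewrite powRM ?invr_ge0 ?(ltW l10) ?(ltW l20)//.
  have -> : l2^-1 `^ (1 - th) = (l2 `^ (1 - th))^-1.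
    by rewrite -powR_inv1 ?(ltW l20)// -powRrM mulN1r powRN.
  rewrite [X in _ / X / _]e.
  by field; rewrite ?(gt_eqF (powR_gt0 _ l20)) ?(gt_eqF (powR_gt0 _ l10)).
have rt0 : 0 < r `^ (1 - th) by rewrite powR_gt0.
have u0 : 0 < (N%:R `^ d) `^ (1 - th) by rewrite !powR_gt0.
rewrite (_ : 1 / 2 * _ = (l / l2) ^+ n / (2 * r `^ (1 - th))); last first.
  by field; rewrite (gt_eqF rt0).
apply: ler_wpM2l; first by rewrite exprn_ge0// divr_ge0 ?(ltW l0) ?(ltW l20).
by rewrite lef_pV2 ?posrE ?mulr_gt0.
Qed.

End parameters.

Section rank_one.
Variables (R : realType) (m : probability (Tinf R) R).
Hypothesis hm : is_haar_Tinf m.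
Local Notation Tinf := (Tinf R).
Local Notation cI := (complex_integral m).
Local Notation L n f := (cI (fun chi => f chi * conjc (pair_prod n chi))).

Lemma Lp_norm_pair_prod n (q : R) : 1 <= q ->
  Lp_norm m q%:E (@pair_prod R n) = ((pair_norm m q) ^+ n)%:E.
Proof.
move=> q1; have q0 : 0 < q by rewrite (lt_le_trans ltr01).
have mF : measurable_fun setT (fun x : Tinf => normc (pair_prod n x)).
  by apply: measurable_normc; exact: measurable_pair_prod.
have bF (x : Tinf) : 0 <= normc (pair_prod n x) <= 2 ^+ n.
  by rewrite normc_ge0 normc_pair_prod.
rewrite /Lp_norm (Lnorm_bounded m mF bF q0) (integral_pair_prod_powR hm n (ltW q0)).
rewrite /pair_norm; congr EFin; move: (moment_ge1 hm q1) => /(le_trans ler01).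
move: (moment m q) => M M0; elim: n {mF bF} => [|n ih]; first by rewrite !expr0 powR1.
by rewrite !exprS powRM ?exprn_ge0// ih.
Qed.

(** The norm of a rank-one operator is at most the norm of the functional times
the norm of the image vector. *)
Lemma block_bound (q : \bar R) n N (a l : R) : (1 <= q)%E -> (0 < N)%N -> 0 < a -> 0 <= l ->
  (forall f, cintegrable m f -> analytic m f ->
    ((normc (L n f))%:E <= (l ^+ n)%:E * Lp_norm m q f)%E) ->
  l ^+ n * (a * N%:R `^ (2 - inv_exponent q)) <= 1 ->
  forall f, cintegrable m f -> analytic m f ->
  ((a * normc (L n f))%:E * Lp_norm m q (fun x => dirichlet N x ^+ 2)%R <= Lp_norm m q f)%E.
Proof.
move=> q1 N0 a0 l0 bound small f fi fa.
have D := Lp_norm_dirichlet_le hm N0 q1.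
have nf0 := Lp_norm_ge0 m q f.
set d := N%:R `^ _ in small D.
have d0 : 0 <= d by exact: powR_ge0.
apply: (@le_trans _ _ ((a * normc (L n f))%:E * d%:E)%E).
  by apply: lee_wpmul2l => //; rewrite lee_fin mulr_ge0 ?(ltW a0) ?normc_ge0.
rewrite -EFinM mulrAC EFinM.
apply: (@le_trans _ _ ((a * d)%:E * ((l ^+ n)%:E * Lp_norm m q f))%E).
  by apply: lee_wpmul2l (bound f fi fa); rewrite lee_fin mulr_ge0 ?(ltW a0).
rewrite muleA -EFinM mulrC -[leRHS]mul1e; apply: lee_wpmul2r => //.
Qed.

(** The index [n k] is a multiple of k + 1 so large that the gap factor
kap ^ (n k) absorbs both 4 ^ (k + 1) and the constants lost in the two-sided
estimates of Dirichlet kernels. *)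
Lemma building_blocks (p1 p : R) (p2 : \bar R) : 1 <= p1 -> p1 < p -> (p%:E < p2)%E ->
  exists (n N : nat -> nat) (a : nat -> R),
    [/\ injective n, forall k, (0 < N k)%N, forall k, 0 < a k,
    forall q, q = p1%:E \/ q = p2 -> forall k f, cintegrable m f -> analytic m f ->
      ((a k * normc (L (n k) f))%:E * Lp_norm m q (fun x => dirichlet (N k) x ^+ 2)%R
         <= Lp_norm m q f)%E &
    forall k, ((4 ^+ k.+1)%:E * Lp_norm m p%:E (@pair_prod R (n k)) <=
      (a k * 2 ^+ (n k))%:E * Lp_norm m p%:E (fun x => dirichlet (N k) x ^+ 2)%R)%E].
Proof.
move=> p11 p1p pp2.
have p10 : 0 < p1 by rewrite (lt_le_trans ltr01).
have p0 : 0 < p by rewrite (lt_trans p10).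
have pge1 : 1 <= p by rewrite (le_trans p11)// ltW.
have p2ge1 : (1 <= p2)%E by rewrite (le_trans _ (ltW pp2))// lee_fin.
have [th [l2 [th01 pE l2b gap bound2]]] := dual_norm_gap hm p11 p1p pp2.
set s1 := p1^-1; set s2 := inv_exponent p2.
have s20 : 0 <= s2.
  rewrite /s2; case: (p2) p2ge1 => //= r; rewrite lee_fin => /(le_trans ler01).
  by rewrite invr_ge0.
have s21 : s2 < s1.
  rewrite /s2 /s1; case: (p2) pp2 => [r| |]//=; last by rewrite invr_gt0.
  by rewrite lte_fin => pr; rewrite ltf_pV2 ?posrE ?(lt_trans p1p)// (lt_trans p0).
have s11 : s1 <= 1 by rewrite invf_le1.
have nrm0 := pair_norm_gt0 hm pge1; have nrm1 := pair_norm_gt0 hm p11.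
set l1 := dual_norm m p1 in gap l2b; set l := dual_norm m p in gap.
have l0 : 0 < l by exact: divr_gt0 (ltr0Sn R 1) nrm0.
have l10 : 0 < l1 by exact: divr_gt0 (ltr0Sn R 1) nrm1.
have bound1 n f (fi : cintegrable m f) (fa : analytic m f) :
    ((normc (L n f))%:E <= (l1 ^+ n)%:E * Lp_norm m p1%:E f)%E.
  exact: functional_bound.
have lE : l = 2 / pair_norm m p by [].
clearbody l l1.
have /andP[l20 l21] := l2b.
set kap := l / (l1 `^ (1 - th) * l2 `^ th).
have kap1 : 1 < kap by rewrite ltr_pdivlMr ?mul1r// mulr_gt0 ?powR_gt0.
have kap0 : 0 < kap by rewrite (lt_trans ltr01).
have [c c0 low] := Lp_norm_dirichlet_ge hm pge1.
have [K K0 hK] : exists2 K, (0 < K)%N & forall k, 4 ^+ k.+1 <= c * (1 / 2 * kap ^+ (K * k.+1)).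
  pose b := 1 + 2 / c; pose B := 4 * b.
  have b1 : 1 <= b by rewrite lerDl divr_ge0// ltW.
  have B0 : 0 < B by rewrite mulr_gt0// (lt_le_trans ltr01).
  have k1 : `|kap^-1| < 1 by rewrite ger0_norm ?invr_ge0 ?(ltW kap0)// invf_lt1.
  have [K0 _ hK0] : \forall K \near \oo, kap^-1 ^+ K < B^-1.
    by apply: (cvgr_lt _ (cvg_expr k1)); rewrite invr_gt0.
  exists K0.+1 => // k; have hB : B <= kap ^+ K0.+1.
    have := hK0 _ (leqnSn K0); rewrite /= exprVn => h.
    by move: h; rewrite ltf_pV2 ?posrE ?exprn_gt0// => /ltW.
  rewrite exprM; apply: (@le_trans _ _ (c * (1 / 2 * B ^+ k.+1))); last first.
    apply: ler_wpM2l; first exact: ltW.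
    by apply: ler_wpM2l => //; rewrite lerXn2r ?nnegrE ?exprn_ge0 ?(ltW B0) ?(ltW kap0).
  rewrite /B exprMn.
  have h4 : 0 <= 4 ^+ k.+1 :> R by rewrite exprn_ge0.
  have hb : b <= b ^+ k.+1 by rewrite exprS ler_peMr ?(le_trans ler01)// exprn_ege1.
  have hc : 1 <= c * (1 / 2 * b ^+ k.+1).
    apply: (@le_trans _ _ (c * (1 / 2 * b))).
      rewrite /b (_ : c * _ = c / 2 + 1); first by rewrite lerDr divr_ge0 ?(ltW c0).
      by field; rewrite (gt_eqF c0).
    by apply: ler_wpM2l; [exact: ltW|apply: ler_wpM2l].
  rewrite (_ : c * _ = 4 ^+ k.+1 * (c * (1 / 2 * b ^+ k.+1))); last by ring.
  by rewrite ler_peMr.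
have s12 : 0 <= s2 < s1 by rewrite s20.
pose n k := (K * k.+1)%N.
have ex k := scale_choice (n k) s12 s11 th01 l2b l0.
have {ex} [N ex] := choice ex; have {ex} [a ex] := choice ex.
exists n, N, a; split.
- by move=> i j /eqP; rewrite /n eqn_pmul2l// eqSS => /eqP.
- by move=> k; have [N0 _ _ _ _] := ex k.
- by move=> k; have [_ a0 _ _ _] := ex k.
- move=> q qE k f fi fa; have [N0 a0 b1 b2 _] := ex k.
  case: qE => ->.
    apply: (@block_bound _ _ _ _ l1) => //; first exact: ltW.
    by move=> h hi ha; exact: bound1.
  apply: (@block_bound _ _ _ _ l2) => //; first exact: ltW.
  by move=> h hi ha; exact: bound2.
- move=> k; have [N0 a0 _ _ b3] := ex k.
  rewrite Lp_norm_pair_prod//.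
  apply: (@le_trans _ _ ((a k * 2 ^+ n k)%:E * (c * (N k)%:R `^ (2 - p^-1))%:E)%E); last first.
    apply: lee_wpmul2l; last exact: low.
    by rewrite lee_fin mulr_ge0 ?(ltW a0)// exprn_ge0.
  rewrite -!EFinM lee_fin.
  have hk := hK k; rewrite -/(n k) in hk.
  move: b3; rewrite -/kap -pE => b3.
  move: nrm0 lE; move: (pair_norm m p) => M nrm0 lE.
  have nn0 : 0 < M ^+ n k by exact: exprn_gt0.
  have two : 2 ^+ n k = l ^+ n k * M ^+ n k.
    by rewrite -exprMn lE divfK ?(gt_eqF nrm0).
  rewrite two.
  have h : 4 ^+ k.+1 <= c * (l ^+ n k * (a k * (N k)%:R `^ (2 - p^-1))).
    by apply: (le_trans hk); apply: ler_wpM2l => //; exact: ltW.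
  apply: le_trans (ler_wpM2r (ltW nn0) h) _.
  by rewrite le_eqVlt; apply/orP; left; apply/eqP; ring.
Qed.

End rank_one.

(** * Lebesgue norms and Hardy spaces *)

Lemma cvg_powR (R : realType) (u : nat -> R) (y q : R) : 0 < q ->
  (forall n, 0 <= u n) -> u n @[n --> \oo] --> y -> u n `^ q @[n --> \oo] --> y `^ q.
Proof.
move=> q0 u0 uy; have y0 : 0 <= y by apply: (cvgr_to_ge uy); exact: nearW.
have [ye|yn] := eqVneq y 0; last first.
  have y1 : 0 < y by rewrite lt_def yn.
  have c : {for y, continuous (fun t : R => t `^ q)}.
    apply: differentiable_continuous; apply/derivable1_diffP.
    by apply: derivable_powR; rewrite in_itv/= y1.
  exact: (@cvg_comp _ _ _ u (fun t : R => t `^ q) \oo (nbhs y) (nbhs (y `^ q)) uy c).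
rewrite ye powR0 ?(gt_eqF q0)//; rewrite {y y0}ye in uy.
apply/cvgrPdist_lt => e e0; have e1 : 0 < e `^ q^-1 by exact: powR_gt0.
have /cvgrPdist_lt/(_ _ e1) := uy; apply: filterS => n.
rewrite !sub0r !normrN !ger0_norm ?powR_ge0// => un.
rewrite -[ltRHS](@powRr1 _ e) ?(ltW e0)// -(@mulVf _ q) ?(gt_eqF q0)// powRrM.
by rewrite gt0_ltr_powR ?nnegrE ?powR_ge0.
Qed.

Section Lp_lemmas.
Variables (R : realType) (m : probability (Tinf R) R).
Local Notation Tinf := (Tinf R).
Implicit Types f g : Tinf -> R[i].

Let mT : (m : {measure set Tinf -> \bar R}) setT = 1%E := probability_setT m.

Lemma Lp_normZ q (c : R[i]) f : (1 <= q)%E -> measurable_fun setT f ->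
  Lp_norm m q (fun x => c * f x) = ((normc c)%:E * Lp_norm m q f)%E.
Proof.
move=> q1 mf; rewrite /Lp_norm unlock /Lnorm; case: q q1 => [q q1|_|//]; last first.
  rewrite mT lte01 -ess_supZl ?normc_ge0 ?mT ?lte01//; congr ess_sup.
  by apply/funext => x /=; rewrite normcM normrM EFinM (ger0_norm (normc_ge0 c)).
rewrite lee_fin in q1; have q0 : 0 < q by rewrite (lt_le_trans ltr01).
have mp : measurable_fun setT (fun x => (normc (f x) `^ q)%:E).
  by apply/measurable_EFinP; apply: (measurableT_comp (measurable_powR _));
    exact: measurable_normc.
under eq_integral => x _ do rewrite /= normcM ger0_norm ?mulr_ge0 ?normc_ge0//
  powRM ?normc_ge0// EFinM.
under [in RHS]eq_integral => x _ do rewrite /= ger0_norm ?normc_ge0//.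
rewrite ge0_integralZl//; last 2 first.
- by move=> x _; rewrite lee_fin powR_ge0.
- by rewrite lee_fin powR_ge0.
rewrite poweRM ?lee_fin ?powR_ge0//; last first.
  by apply: integral_ge0 => x _; rewrite lee_fin powR_ge0.
congr (_ * _)%E; rewrite poweR_EFin -powRrM divff ?(gt_eqF q0)// powRr1//.
exact: normc_ge0.
Qed.

Lemma Lp_normD q f g : (1 <= q)%E -> measurable_fun setT f -> measurable_fun setT g ->
  (Lp_norm m q (fun x => f x + g x)%R <= Lp_norm m q f + Lp_norm m q g)%E.
Proof.
move=> q1 mf mg.
have mnf := measurable_normc mf; have mng := measurable_normc mg.
apply: le_trans (eminkowski m mnf mng q1).
rewrite /Lp_norm unlock /Lnorm; case: q q1 => [q q1|_|//]; last first.
  rewrite mT lte01; apply: le_ess_sup; apply: nearW => x /=.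
  rewrite lee_fin !ger0_norm ?addr_ge0 ?normc_ge0//; exact: le_normcD.
rewrite lee_fin in q1; have q0 : 0 < q by rewrite (lt_le_trans ltr01).
have mfg : measurable_fun setT (fun x => normc (f x + g x)).
  by apply: measurable_normc; exact: measurable_complexD.
apply: gt0_ler_poweR.
- by rewrite invr_ge0 ltW.
- by rewrite in_itv/= leey integral_ge0// => x _; exact: poweR_ge0.
- by rewrite in_itv/= leey integral_ge0// => x _; exact: poweR_ge0.
apply: ge0_le_integral => //.
- by move=> x _; exact: poweR_ge0.
- by apply: (measurableT_comp (measurable_poweR _)); apply: measurableT_comp => //;
    exact/measurable_EFinP.
- apply: (measurableT_comp (measurable_poweR _)); apply: measurableT_comp => //.
  by apply/measurable_EFinP; exact: measurable_funD.
- move=> x _; apply: gt0_ler_poweR.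
  + exact: ltW.
  + by rewrite in_itv/= leey lee_fin normr_ge0.
  + by rewrite in_itv/= leey lee_fin normr_ge0.
  + rewrite /= lee_fin !ger0_norm ?addr_ge0 ?normc_ge0//; exact: le_normcD.
Qed.

(** Fatou's lemma for finite q; for q = oo a countable union of null sets. *)
Lemma Lp_norm_lim q (f_ : nat -> Tinf -> R[i]) f (C : R) : (1 <= q)%E ->
  (forall n, measurable_fun setT (f_ n)) -> measurable_fun setT f ->
  (forall x, normc (f_ n x) @[n --> \oo] --> normc (f x)) ->
  (forall n, (Lp_norm m q (f_ n) <= C%:E)%E) -> (Lp_norm m q f <= C%:E)%E.
Proof.
move=> q1 mf_ mf ff fC.
have C0 : 0 <= C by rewrite -lee_fin (le_trans (Lp_norm_ge0 m q (f_ 0%N))).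
case: q q1 fC => [q q1 fC|_ fC|//]; last first.
  move: fC; rewrite /Lp_norm unlock /Lnorm mT lte01 => fC.
  apply/ess_supP.
  have : \forall x \ae m, forall n, (`|(normc (f_ n x))%:E| <= C%:E)%E.
    by apply/ae_foralln => n; exact/ess_supP/fC.
  apply: filterS => x h; rewrite /= lee_fin ger0_norm ?normc_ge0//.
  apply: (cvgr_to_le (ff x)); apply: nearW => n.
  by have := h n; rewrite /= lee_fin ger0_norm ?normc_ge0.
rewrite lee_fin in q1; have q0 : 0 < q by rewrite (lt_le_trans ltr01).
pose h n x := ((normc (f_ n x)) `^ q)%:E.
have mh n : measurable_fun setT (h n).
  by apply/measurable_EFinP; apply: (measurableT_comp (measurable_powR _));
    exact: measurable_normc.
have LE g : (Lp_norm m q%:E g `^ q = \int[m]_x ((normc (g x)) `^ q)%:E)%E.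
  rewrite /Lp_norm poweR_Lnorm ?(gt_eqF q0)//; apply: eq_integral => x _ /=.
  by rewrite ger0_norm ?normc_ge0.
have hC n : (\int[m]_x h n x <= (C `^ q)%:E)%E.
  rewrite -LE -poweR_EFin; apply: gt0_ler_poweR => //; first exact: ltW.
  - by rewrite in_itv/= leey Lp_norm_ge0.
  - by rewrite in_itv/= leey lee_fin C0.
have lim x : limn_einf (h ^~ x) = ((normc (f x)) `^ q)%:E.
  apply: (cvg_limn_einf_sup _).1; apply: cvg_EFin; first exact: nearW.
  by apply: (cvg_powR q0 _ (ff x)) => n; exact: normc_ge0.
have key : (\int[m]_x ((normc (f x)) `^ q)%:E <= (C `^ q)%:E)%E.
  under eq_integral => x _ do rewrite -lim.
  apply: le_trans (fatou m measurableT mh _) _.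
    by move=> n x _; rewrite lee_fin powR_ge0.
  rewrite limn_einf_lim; apply: lime_le; first exact: is_cvg_einfs.
  apply: nearW => n; apply: le_trans (hC n).
  by apply: ereal_inf_lbound; exists n => /=.
have : ((Lp_norm m q%:E f `^ q) `^ q^-1 <= ((C `^ q)%:E) `^ q^-1)%E.
  apply: gt0_ler_poweR; first by rewrite invr_ge0 ltW.
  - by rewrite in_itv/= leey poweR_ge0.
  - by rewrite in_itv/= leey lee_fin powR_ge0.
  - by rewrite LE.
rewrite -poweRrM divff ?(gt_eqF q0)// poweRe1 ?Lp_norm_ge0//.
by rewrite poweR_EFin -powRrM divff ?(gt_eqF q0)// powRr1.
Qed.

End Lp_lemmas.

Section hardy_closure.
Variables (R : realType) (m : probability (Tinf R) R).
Local Notation Tinf := (Tinf R).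

Lemma Lp_norm1 (f : Tinf -> R[i]) : Lp_norm m 1%E f = (\int[m]_x (normc (f x))%:E)%E.
Proof.
rewrite /Lp_norm Lnorm1; apply: eq_integral => x _ /=.
by rewrite ger0_norm ?normc_ge0.
Qed.

Lemma Lp_cintegrable q (f : Tinf -> R[i]) : (1 <= q)%E -> measurable_fun setT f ->
  (Lp_norm m q f < +oo)%E -> cintegrable m f.
Proof.
move=> q1 mf fq; split => //; apply/integrableP; split.
  by apply/measurable_EFinP; exact: measurable_normc.
under eq_integral => x _ do rewrite /= (ger0_norm (normc_ge0 _)).
rewrite -Lp_norm1; apply: le_lt_trans fq.
exact: Lp_norm_nondecreasing.
Qed.

Lemma Hardy_cintegrable q (f : L0 m) : (1 <= q)%E -> Hardy m q f -> cintegrable m f.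
Proof. by move=> q1 [fq _]; apply: Lp_cintegrable q1 (measurable_L0 f) fq. Qed.

Lemma Hardy_le q r (f : L0 m) : (1 <= q)%E -> (q <= r)%E -> Hardy m r f -> Hardy m q f.
Proof.
move=> q1 qr [fr f0]; split => //; apply: le_lt_trans fr.
exact: Lp_norm_nondecreasing (measurable_L0 f) q1 qr.
Qed.

Lemma analytic_comb (a : R[i]) (f g : Tinf -> R[i]) : cintegrable m f -> cintegrable m g ->
  analytic m f -> analytic m g -> analytic m (fun x => a * f x + g x).
Proof.
move=> fi gi fa ga q q0 qint.
have ei h : cintegrable m h -> cintegrable m (fun x => h x * conjc (torus_character x q)).
  move=> hi; apply: (@cintegrableM _ _ _ _ _ _ 1) => //.
    by apply: measurable_conjc; exact: measurable_torus_character.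
  by move=> x; rewrite normc_conj normc_torus_character.
rewrite /fourier_coefficient (_ : (fun _ => _) = fun x =>
  a * (f x * conjc (torus_character x q)) + g x * conjc (torus_character x q)); last first.
  by apply/funext => x; rewrite mulrDl mulrA.
rewrite complex_integralD; last 2 first.
- by apply: cintegrableZ; exact: ei.
- exact: ei.
rewrite complex_integralZ; last exact: ei.
transitivity (a * fourier_coefficient m f q + fourier_coefficient m g q); first by [].
by rewrite fa// ga// mulr0 addr0.
Qed.

Lemma L0_combE (a : R[i]) (f g : L0 m) :
  ((a *: f + g : L0 m) : Tinf -> R[i]) = (fun x => a * f x + g x) %[ae m].
Proof.
have := L0_addE (a *: f) g; have := L0_scaleE a f.
by apply: filterS2 => x /= /(_ I) e1 /(_ I) e2 _; rewrite e2 e1.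
Qed.

Let measurable_comb (a : R[i]) (f g : L0 m) :
  measurable_fun setT (fun x => a * f x + g x).
Proof.
apply: measurable_complexD; last exact: measurable_L0.
by apply: measurable_complexM; [exact: measurable_cst|exact: measurable_L0].
Qed.

(** Hardy spaces consist of classes, while functions are computed pointwise; this
passes from one to the other. *)
Lemma Hardy_ae q (f : L0 m) (g : Tinf -> R[i]) : (1 <= q)%E -> measurable_fun setT g ->
  (f : Tinf -> R[i]) = g %[ae m] -> (Lp_norm m q g < +oo)%E -> analytic m g -> Hardy m q f.
Proof.
move=> q1 mg fg gq ga; split.
  by rewrite (ae_eq_Lp_norm q1 (measurable_L0 f) mg fg).
by move=> r r0 rint; rewrite (ae_eq_fourier_coefficient _ (measurable_L0 f) mg fg) ga.
Qed.

Lemma Hardy_comb q (a : R[i]) (f g : L0 m) : (1 <= q)%E ->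
  Hardy m q f -> Hardy m q g -> Hardy m q (a *: f + g).
Proof.
move=> q1 Hf Hg; have [fq fa] := Hf; have [gq ga] := Hg.
have mf := measurable_L0 f; have mg := measurable_L0 g.
apply: (Hardy_ae q1 (measurable_comb a f g) (L0_combE a f g)); last first.
  by apply: analytic_comb => //; exact: Hardy_cintegrable q1 _.
have maf : measurable_fun setT (fun x => a * f x).
  by apply: measurable_complexM => //; exact: measurable_cst.
apply: le_lt_trans (Lp_normD m q1 maf mg) _; rewrite Lp_normZ//.
by rewrite lte_add_pinfty// lte_mul_pinfty// lee_fin normc_ge0.
Qed.

Lemma HardyD q (f g : L0 m) : (1 <= q)%E ->
  Hardy m q f -> Hardy m q g -> Hardy m q (f + g).
Proof. by move=> q1 Hf Hg; rewrite -[f]scale1r; exact: Hardy_comb. Qed.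

End hardy_closure.

(** * Absolutely convergent sums of rank-one operators *)

Section nuclear.
Variables (R : realType) (m : probability (Tinf R) R).
Local Notation Tinf := (Tinf R).
Local Notation cI := (complex_integral m).
Variables (g : nat -> Tinf -> R[i]) (gam : nat -> R).
Hypothesis mg : forall k, measurable_fun setT (g k).
Hypothesis gam0 : forall k, 0 < gam k.
Hypothesis ggam : forall k, (\int[m]_x (normc (g k x))%:E <= (gam k)%:E)%E.

(** Weights of total mass 1, so that sums of contractions are contractions. *)
Definition weight (k : nat) : R := 2^-1 ^+ k.+1.

Lemma weight_gt0 k : 0 < weight k.
Proof. by rewrite exprn_gt0 ?invr_gt0. Qed.

Lemma sum_weight M : \sum_(0 <= k < M) weight k = 1 - 2^-1 ^+ M.
Proof.
elim: M => [|M ih]; first by rewrite big_geq// expr0 subrr.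
by rewrite big_nat_recr//= ih /weight exprS; field.
Qed.

Lemma sum_weight_le1 M : \sum_(0 <= k < M) weight k <= 1.
Proof. by rewrite sum_weight lerBlDr lerDl exprn_ge0. Qed.

(** Its integral is at most 1, so the series is finite almost everywhere. The
set where it diverges is removed once and for all, independently of the
coefficients: the sum is then defined at every point and depends linearly on
them. *)
Definition majorant (x : Tinf) : \bar R :=
  (\sum_(k <oo) (weight k * (normc (g k x) / gam k))%:E)%E.

Let v0 k x : 0 <= weight k * (normc (g k x) / gam k).
Proof. by rewrite mulr_ge0 ?(ltW (weight_gt0 k)) ?divr_ge0 ?normc_ge0 ?(ltW (gam0 k)). Qed.

Let mv k : measurable_fun setT (fun x => (weight k * (normc (g k x) / gam k))%:E).
Proof.
apply/measurable_EFinP; apply: measurable_funM => //.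
by apply: measurable_funM => //; exact: measurable_normc.
Qed.

Lemma majorant_ge0 x : (0 <= majorant x)%E.
Proof. by apply: nneseries_ge0 => k _ _; rewrite lee_fin. Qed.

Lemma measurable_majorant : measurable_fun setT majorant.
Proof.
rewrite /majorant; apply: ge0_emeasurable_sum => //.
by move=> k x _ _; rewrite lee_fin.
Qed.

Lemma integral_majorant : (\int[m]_x majorant x <= 1)%E.
Proof.
rewrite integral_nneseries//; last by move=> k x _; rewrite lee_fin.
apply: lime_le.
  apply: is_cvg_nneseries => k _ _; apply: integral_ge0 => x _.
  by rewrite lee_fin.
apply: nearW => M.
apply: (@le_trans _ _ (\sum_(0 <= k < M) (weight k)%:E)%E); last first.
  by rewrite sumEFin lee_fin sum_weight_le1.
apply: lee_sum => k _.
under eq_integral => x _ do rewrite mulrC -mulrA (mulrC _ (weight k)) mulrC EFinM.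
rewrite ge0_integralZl//; last 3 first.
- by apply/measurable_EFinP; exact: measurable_normc.
- by move=> x _; rewrite lee_fin normc_ge0.
- by rewrite lee_fin divr_ge0 ?(ltW (weight_gt0 k)) ?(ltW (gam0 k)).
have h0 : (0 <= (weight k / gam k)%:E)%E.
  by rewrite lee_fin divr_ge0 ?(ltW (weight_gt0 k)) ?(ltW (gam0 k)).
apply: le_trans (lee_wpmul2l h0 (ggam k)) _.
by rewrite -EFinM divfK ?(gt_eqF (gam0 k)).
Qed.

Definition convergence_set : set Tinf := [set x | (majorant x < +oo)%E].

Lemma measurable_convergence_set : measurable convergence_set.
Proof.
rewrite /convergence_set -[X in measurable X]setTI.
exact: emeasurable_fun_infty_o measurableT measurable_majorant _.
Qed.

Lemma ae_convergence_set : {ae m, forall x, convergence_set x}.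
Proof.
have iV : m.-integrable setT majorant.
  apply/integrableP; split; first exact: measurable_majorant.
  under eq_integral => x _ do rewrite gee0_abs ?majorant_ge0//.
  by apply: le_lt_trans integral_majorant _; rewrite ltry.
have := integrable_ae measurableT iV; apply: filterS => x /(_ I).
by rewrite /convergence_set/= ge0_fin_numE ?majorant_ge0.
Qed.

Definition cut k (x : Tinf) : R[i] := (\1_convergence_set x)%:C * g k x.
Definition cut_majorant (x : Tinf) : R := fine (majorant x) * \1_convergence_set x.

Lemma cut_majorant_ge0 x : 0 <= cut_majorant x.
Proof. by rewrite /cut_majorant mulr_ge0// fine_ge0// majorant_ge0. Qed.

Lemma normc_cut k x : normc (cut k x) = \1_convergence_set x * normc (g k x).
Proof. by rewrite /cut normcM normc_real ger0_norm. Qed.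

Lemma sum_cut_le x M : \sum_(0 <= k < M) weight k * (normc (cut k x) / gam k) <= cut_majorant x.
Proof.
rewrite /cut_majorant.
have [gx|ngx] := boolP (x \in convergence_set); last first.
  rewrite indicE (negbTE ngx) mulr0 big1// => k _.
  by rewrite normc_cut indicE (negbTE ngx) !mul0r mulr0.
rewrite indicE gx mulr1.
under eq_bigr => k _ do rewrite normc_cut indicE gx mul1r.
rewrite inE /convergence_set/= in gx.
rewrite -lee_fin fineK ?ge0_fin_numE ?majorant_ge0// -sumEFin.
by apply: nneseries_lim_ge => k _ _; rewrite lee_fin.
Qed.

Lemma integrable_cut_majorant : m.-integrable setT (EFin \o cut_majorant).
Proof.
have mb : measurable_fun setT cut_majorant.
  apply: measurable_funM; last by apply: measurable_indic; exact: measurable_convergence_set.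
  by apply: measurableT_comp => //; exact: measurable_majorant.
apply/integrableP; split; first exact/measurable_EFinP.
apply: (@le_lt_trans _ _ (\int[m]_x majorant x)%E); last first.
  by apply: le_lt_trans integral_majorant _; rewrite ltry.
apply: ge0_le_integral => //.
- by apply: measurableT_comp => //; exact/measurable_EFinP.
- exact: measurable_majorant.
move=> x _; rewrite /= ger0_norm ?cut_majorant_ge0// /cut_majorant indicE.
have [|_] := boolP (x \in convergence_set); last by rewrite mulr0 majorant_ge0.
by rewrite inE /convergence_set/= => gx; rewrite mulr1 fineK// ge0_fin_numE ?majorant_ge0.
Qed.

Lemma measurable_cut k : measurable_fun setT (cut k).
Proof.
apply: measurable_complexM => //; apply/measurable_complexP; split => /=.
  by apply: measurable_indic; exact: measurable_convergence_set.
exact: measurable_cst.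
Qed.

Definition partial_sum (c : nat -> R[i]) M x := \sum_(0 <= k < M) (weight k)%:C * c k * cut k x.
Definition nuclear_sum (c : nat -> R[i]) x : R[i] := complex_lim (fun M => partial_sum c M x).

(** The sizes of coefficients for which [majorant] dominates the series. *)
Definition admissible (c : nat -> R[i]) (C : R) := forall k, normc (c k) * gam k <= C.

Section admissible.
Variables (c : nat -> R[i]) (C : R).
Hypothesis cC : admissible c C.

Let C0 : 0 <= C.
Proof. by apply: le_trans (cC 0%N); rewrite mulr_ge0 ?normc_ge0 ?(ltW (gam0 _)). Qed.

Let sum_bound x M :
  \sum_(0 <= k < M) normc ((weight k)%:C * c k * cut k x) <= C * cut_majorant x.
Proof.
apply: le_trans (ler_wpM2l C0 (sum_cut_le x M)); rewrite mulr_sumr.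
apply: ler_sum => k _; rewrite normcM (normcM (weight k)%:C) normc_real.
rewrite ger0_norm ?(ltW (weight_gt0 k))//.
have -> : C * (weight k * (normc (cut k x) / gam k)) = weight k * (C / gam k) * normc (cut k x).
  by ring.
apply: ler_wpM2r; first exact: normc_ge0.
apply: ler_wpM2l; first exact: ltW (weight_gt0 k).
by rewrite ler_pdivlMr.
Qed.

Lemma nuclear_sum_cvg x : complex_cvg (fun M => partial_sum c M x) (nuclear_sum c x).
Proof. exact: complex_cvg_series (sum_bound x). Qed.

Lemma measurable_partial_sum M : measurable_fun setT (partial_sum c M).
Proof.
rewrite /partial_sum; elim: M => [|M ih].
  rewrite (_ : (fun _ => _) = cst 0); first exact: measurable_cst.
  by apply/funext => x; rewrite big_geq.
rewrite (_ : (fun _ => _) = fun x => partial_sum c M x + (weight M)%:C * c M * cut M x).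
  apply: measurable_complexD => //; apply: measurable_complexM; last exact: measurable_cut.
  exact: measurable_cst.
by apply/funext => x; rewrite /partial_sum big_nat_recr.
Qed.

Lemma measurable_nuclear_sum : measurable_fun setT (nuclear_sum c).
Proof.
apply/measurable_complexP; split.
  apply: (@measurable_fun_cvg _ _ _ _ (fun M x => complex.Re (partial_sum c M x))).
    by move=> M; have /measurable_complexP[] := measurable_partial_sum M.
  by move=> x _; exact: (nuclear_sum_cvg x).1.
apply: (@measurable_fun_cvg _ _ _ _ (fun M x => complex.Im (partial_sum c M x))).
  by move=> M; have /measurable_complexP[] := measurable_partial_sum M.
by move=> x _; exact: (nuclear_sum_cvg x).2.
Qed.

Lemma normc_partial_sum M x : normc (partial_sum c M x) <= C * cut_majorant x.
Proof. exact: le_trans (normc_sum_le _ _) (sum_bound x M). Qed.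

Lemma ae_cut k : {ae m, forall x, cut k x = g k x}.
Proof.
apply: filterS ae_convergence_set => x gx.
by rewrite /cut indicE mem_set// mul1r.
Qed.

Lemma integrable_scaled_majorant : m.-integrable setT (EFin \o (fun x => C * cut_majorant x)).
Proof. by apply: integrable_scale; exact: integrable_cut_majorant. Qed.

(** Fourier coefficients pass to the limit by dominated convergence. *)
Lemma analytic_nuclear_sum : (forall k, analytic m (g k)) -> analytic m (nuclear_sum c).
Proof.
move=> ag q q0 qint; rewrite /fourier_coefficient.
pose e (chi : Tinf) := conjc (torus_character chi q).
have me : measurable_fun setT e.
  by apply: measurable_conjc; exact: measurable_torus_character.
have ne x : normc (e x) = 1 by rewrite /e normc_conj normc_torus_character.
have gi k : cintegrable m (fun x => cut k x * e x).
  apply: (@cintegrableM _ _ _ _ _ _ 1) => //; last by move=> x; rewrite ne.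
  split; first exact: measurable_cut.
  apply: (@le_integrable _ _ _ m setT measurableT _ (fun x => (normc (g k x))%:E)).
  - by apply/measurable_EFinP; apply: measurable_normc; exact: measurable_cut.
  - move=> x _; rewrite /= lee_fin !ger0_norm ?normc_ge0//.
    rewrite normc_cut indicE; case: (x \in _); by rewrite ?mul1r ?mul0r ?normc_ge0.
  - apply/integrableP; split; first by apply/measurable_EFinP; exact: measurable_normc.
    under eq_integral => x _ do rewrite /= (ger0_norm (normc_ge0 _)).
    by apply: le_lt_trans (ggam k) _; rewrite ltry.
have g0 k : cI (fun x => cut k x * e x) = 0.
  rewrite -(ag k q q0 qint); apply: ae_eq_fourier_coefficient => //.
    exact: measurable_cut.
  by have := ae_cut k; apply: filterS => x h _.
have p0 M : cI (fun x => partial_sum c M x * e x) = 0.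
  rewrite (_ : (fun _ => _) = fun x => \sum_(0 <= k < M) (weight k)%:C * c k * (cut k x * e x)).
    rewrite (complex_integral_sum _ _).2; last by move=> k; exact: cintegrableZ.
    by rewrite big1// => k _; rewrite complex_integralZ// g0 mulr0.
  by apply/funext => x; rewrite /partial_sum mulr_suml; apply: eq_bigr => k _; rewrite mulrA.
have : complex_cvg (fun M => cI (fun x => partial_sum c M x * e x))
    (cI (fun x => nuclear_sum c x * e x)).
  apply: (@complex_integral_dominated_cvg _ _ _ _ _ _ (fun x => C * cut_majorant x)).
  - by move=> M; apply: measurable_complexM => //; exact: measurable_partial_sum.
  - by apply: measurable_complexM => //; exact: measurable_nuclear_sum.
  - exact: integrable_scaled_majorant.
  - by move=> M x; rewrite normcM ne mulr1; exact: normc_partial_sum.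
  - move=> x; have := complex_cvgZ (e x) (nuclear_sum_cvg x).
    by under eq_fun do rewrite mulrC; rewrite mulrC.
move/complex_cvg_lim => <-; rewrite (_ : (fun _ => _) = fun=> 0).
  by rewrite /complex_lim !lim_cst.
by apply/funext => M; exact: p0.
Qed.

(** Minkowski's inequality for the partial sums, then [Lp_norm_lim]. *)
Lemma Lp_norm_nuclear_sum q (C' : R) : (1 <= q)%E ->
  (forall k, ((normc (c k))%:E * Lp_norm m q (g k) <= C'%:E)%E) ->
  (Lp_norm m q (nuclear_sum c) <= C'%:E)%E.
Proof.
move=> q1 cg.
have C'0 : 0 <= C'.
  rewrite -lee_fin; apply: le_trans (cg 0%N).
  by rewrite mule_ge0 ?lee_fin ?normc_ge0 ?Lp_norm_ge0.
apply: (Lp_norm_lim (f_ := partial_sum c) q1).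
- by move=> M; exact: measurable_partial_sum.
- exact: measurable_nuclear_sum.
- by move=> x; exact: complex_cvg_normc (nuclear_sum_cvg x).
move=> M; apply: (@le_trans _ _ ((\sum_(0 <= k < M) weight k) * C')%:E); last first.
  by rewrite lee_fin ler_piMl// sum_weight_le1.
elim: M => [|M ih].
  rewrite big_geq// mul0r (_ : partial_sum c 0 = fun x => 0 * partial_sum c 0 x).
    rewrite Lp_normZ//; last exact: measurable_partial_sum.
    by rewrite normc0 mul0e.
  by apply/funext => x; rewrite /partial_sum big_geq// mul0r.
rewrite big_nat_recr//= mulrDl EFinD.
rewrite (_ : partial_sum c M.+1 = fun x =>
  partial_sum c M x + (weight M)%:C * c M * cut M x); last first.
  by apply/funext => x; rewrite /partial_sum big_nat_recr.
have mgh : measurable_fun setT (cut M) by exact: measurable_cut.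
have mgc : measurable_fun setT (fun x => (weight M)%:C * c M * cut M x).
  by apply: measurable_complexM => //; exact: measurable_cst.
have mp : measurable_fun setT (partial_sum c M) by exact: measurable_partial_sum.
apply: le_trans (Lp_normD m q1 mp mgc) _.
apply: leeD; first exact: ih.
rewrite Lp_normZ// normcM normc_real ger0_norm ?(ltW (weight_gt0 _))//.
rewrite (ae_eq_Lp_norm q1 mgh (mg M)); last first.
  by have := ae_cut M; apply: filterS => x h _.
rewrite EFinM -muleA EFinM; apply: lee_wpmul2l; last exact: cg.
by rewrite lee_fin (ltW (weight_gt0 _)).
Qed.

Lemma nuclear_sum_single j : (forall k, k != j -> c k = 0) ->
  nuclear_sum c = fun x => (weight j)%:C * c j * cut j x.
Proof.
move=> cj; apply/funext => x; apply: complex_cvg_lim.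
have e M : (j < M)%N -> partial_sum c M x = (weight j)%:C * c j * cut j x.
  move=> jM; rewrite /partial_sum (bigD1_seq j) ?mem_index_iota ?iota_uniq//=.
  by rewrite big1 ?addr0// => k /cj ->; rewrite mulr0 mul0r.
split; apply: cvg_near_cst; exists j.+1 => // M /= jM; by rewrite e.
Qed.

End admissible.

Lemma nuclear_sum_linear a c C c' C' : admissible c C -> admissible c' C' ->
  nuclear_sum (fun k => a * c k + c' k) = fun x => a * nuclear_sum c x + nuclear_sum c' x.
Proof.
move=> cC cC'; apply/funext => x; apply: complex_cvg_lim.
have := complex_cvgD (complex_cvgZ a (nuclear_sum_cvg cC x)) (nuclear_sum_cvg cC' x).
congr (complex_cvg _ _); apply/funext => M.
rewrite /partial_sum mulr_sumr -big_split/=; apply: eq_bigr => k _.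
by rewrite mulrDr mulrDl; congr (_ + _); ring.
Qed.

End nuclear.

(** * The counterexample *)

Section counterexample.
Variables (R : realType) (m : probability (Tinf R) R).
Hypothesis hm : is_haar_Tinf m.
Local Notation Tinf := (Tinf R).
Local Notation cI := (complex_integral m).
Local Notation L n f := (cI (fun chi => f chi * conjc (pair_prod n chi))).

Variables (n N : nat -> nat) (a : nat -> R).
Hypotheses (N0 : forall k, (0 < N k)%N) (a0 : forall k, 0 < a k).

Definition image_vector k (x : Tinf) : R[i] := dirichlet (N k) x ^+ 2.
(** The L^1 norm of the image vector, by [integral_dirichlet_sqr]. *)
Definition image_norm1 k : R := (N k)%:R.
Definition coefficient (f : Tinf -> R[i]) k : R[i] := (a k)%:C * L (n k) f.

Local Notation nuclear_series f := (nuclear_sum image_vector image_norm1 (coefficient f)).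

(** Measurability is only known for admissible coefficients, hence the case
distinction; on H^p1 the first case holds. *)
Definition nuclear_operator (f : L0 m) : L0 m :=
  match pselect (measurable_fun setT (nuclear_series f)) with
  | left mf => L0_class m mf
  | right _ => 0
  end.

Lemma nuclear_operatorE (f : L0 m) : measurable_fun setT (nuclear_series f) ->
  (nuclear_operator f : Tinf -> R[i]) = nuclear_series f %[ae m].
Proof. by rewrite /nuclear_operator; case: pselect => // mf _; exact: L0_classE. Qed.

Lemma image_norm1_gt0 k : 0 < image_norm1 k. Proof. by rewrite ltr0n. Qed.

Lemma measurable_image_vector k : measurable_fun setT (image_vector k).
Proof. by apply: measurable_complexX; exact: measurable_dirichlet. Qed.

Lemma integral_image_vector k : (\int[m]_x (normc (image_vector k x))%:E = (image_norm1 k)%:E)%E.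
Proof.
rewrite /image_norm1 -(integral_dirichlet_sqr hm) -(@EFin_Rintegral _ _ _ _ _ ((N k)%:R ^+ 2)).
- by apply: eq_integral => x _; rewrite /image_vector normcX.
- rewrite (_ : (fun _ => _) = fun x => normc (dirichlet (N k) x ^+ 2)).
    exact: measurable_dirichlet_sqr.
  by apply/funext => x; rewrite normcX.
- move=> x; have := dirichlet_sqr_itv (N k) x; rewrite normcX => /andP[h0 h1].
  by rewrite ger0_norm.
Qed.

Let image_vector_le k : (\int[m]_x (normc (image_vector k x))%:E <= (image_norm1 k)%:E)%E.
Proof. by rewrite integral_image_vector. Qed.

Lemma analytic_image_vector k : analytic m (image_vector k).
Proof.
apply: (cspan_analytic hm (S := fun q => 0 < q /\ forall l, 0 <= freq q l)).
  by move=> q [q0 vq]; exact: freq_ge0_int.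
have : cspan (fun q => forall l, 0 <= freq q l) (image_vector k).
  rewrite (_ : image_vector k = fun x => dirichlet (N k) x * dirichlet (N k) x).
    apply: cspanM _ (cspan_dirichlet R (N k)) (cspan_dirichlet R (N k)).
    by move=> q r q0 r0 vq vr l; rewrite freqM// addr_ge0.
  by apply/funext => x; rewrite /image_vector expr2.
by elim=> [|c q f q0 Sq _ ih]; [exact: cspan0|exact: cspanDZ].
Qed.

Variables (p1 : R) (p2 : \bar R).
Hypotheses (p11 : 1 <= p1) (p12 : (p1%:E <= p2)%E).
Hypothesis bound : forall q, q = p1%:E \/ q = p2 -> forall k f, cintegrable m f ->
  analytic m f ->
  ((a k * normc (L (n k) f))%:E * Lp_norm m q (image_vector k) <= Lp_norm m q f)%E.

Let p1E : (1 <= p1%:E)%E. Proof. by rewrite lee_fin. Qed.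

Let normc_coefficient f k : normc (coefficient f k) = a k * normc (L (n k) f).
Proof. by rewrite /coefficient normcM normc_real ger0_norm ?(ltW (a0 k)). Qed.

(** The contraction property on H^p1, as the L^1 norm is at most the L^p1 norm. *)
Lemma admissible_coefficient (f : L0 m) : Hardy m p1%:E f ->
  admissible image_norm1 (coefficient f) (fine (Lp_norm m p1%:E f)).
Proof.
move=> Hf k; have [fp fa] := Hf; rewrite normc_coefficient.
rewrite -lee_fin fineK ?ge0_fin_numE ?Lp_norm_ge0// EFinM.
apply: le_trans (bound (or_introl erefl) k (Hardy_cintegrable p1E Hf) fa).
apply: lee_wpmul2l; first by rewrite lee_fin mulr_ge0 ?(ltW (a0 k)) ?normc_ge0.
rewrite -integral_image_vector -Lp_norm1; apply: Lp_norm_nondecreasing => //.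
exact: measurable_image_vector.
Qed.

Lemma Hardy_nuclear_operatorE (f : L0 m) : Hardy m p1%:E f ->
  (nuclear_operator f : Tinf -> R[i]) = nuclear_series f %[ae m].
Proof.
move=> Hf; apply: nuclear_operatorE; apply: measurable_nuclear_sum (admissible_coefficient Hf).
  exact: measurable_image_vector.
exact: image_norm1_gt0.
Qed.

Lemma nuclear_operator_bounded q : q = p1%:E \/ q = p2 -> (1 <= q)%E -> (p1%:E <= q)%E ->
  bounded_from_to (Hardy m q) (Hardy m q) nuclear_operator.
Proof.
move=> qE q1 pq.
suff H (f : L0 m) : Hardy m q f ->
    Hardy m q (nuclear_operator f) /\
    fine (Lp_norm m q (nuclear_operator f)) <= fine (Lp_norm m q f).
  by exists 1 => f /H; rewrite mul1r.
move=> Hf.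
have Hf1 : Hardy m p1%:E f by exact: Hardy_le p1E pq Hf.
have [fq fa] := Hf; have C := admissible_coefficient Hf1.
have fqfin : Lp_norm m q f \is a fin_num by rewrite ge0_fin_numE ?Lp_norm_ge0.
have mn : measurable_fun setT (nuclear_series f).
  by apply: measurable_nuclear_sum C; [exact: measurable_image_vector|exact: image_norm1_gt0].
have nq : (Lp_norm m q (nuclear_series f) <= (fine (Lp_norm m q f))%:E)%E.
  apply: (Lp_norm_nuclear_sum measurable_image_vector image_norm1_gt0 image_vector_le C q1) => k.
  rewrite fineK// normc_coefficient; apply: bound => //; exact: Hardy_cintegrable Hf.
have e := Hardy_nuclear_operatorE Hf1.
split.
  apply: (Hardy_ae q1 mn e); first by apply: le_lt_trans nq _; rewrite ltry.
  apply: (analytic_nuclear_sum measurable_image_vector image_norm1_gt0 image_vector_le C).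
  exact: analytic_image_vector.
rewrite /= (ae_eq_Lp_norm q1 (measurable_L0 _) mn e) -lee_fin fineK//.
by rewrite ge0_fin_numE ?Lp_norm_ge0//; apply: le_lt_trans nq _; rewrite ltry.
Qed.

Let pairing_integrable j f : cintegrable m f ->
  cintegrable m (fun chi => f chi * conjc (pair_prod j chi)).
Proof.
move=> fi; apply: (@cintegrableM _ _ _ _ _ _ (2 ^+ j)) => //.
  by apply: measurable_conjc; exact: measurable_pair_prod.
by move=> x; rewrite normc_conj; exact: normc_pair_prod.
Qed.

Lemma ae_coefficient (f g : Tinf -> R[i]) : measurable_fun setT f -> measurable_fun setT g ->
  f = g %[ae m] -> coefficient f = coefficient g.
Proof.
have mF j : measurable_fun setT (fun chi : Tinf => conjc (pair_prod j chi)).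
  by apply: measurable_conjc; exact: measurable_pair_prod.
move=> mf mg fg; apply/funext => k; rewrite /coefficient; congr (_ * _).
apply: ae_eq_complex_integral; [exact: measurable_complexM|exact: measurable_complexM|].
by apply: filterS fg => x /= /(_ I) ->.
Qed.

Lemma coefficient_linear b (f g : L0 m) : Hardy m p1%:E f -> Hardy m p1%:E g ->
  coefficient (b *: f + g : L0 m) = fun k => b * coefficient f k + coefficient g k.
Proof.
move=> Hf Hg; have fi := Hardy_cintegrable p1E Hf; have gi := Hardy_cintegrable p1E Hg.
rewrite (ae_coefficient _ _ (L0_combE b f g)); last 2 first.
- exact: measurable_L0.
- by have [] := cintegrableD (cintegrableZ b fi) gi.
apply/funext => k; rewrite /coefficient (_ : (fun _ => _) = fun x =>
  b * (f x * conjc (pair_prod (n k) x)) + g x * conjc (pair_prod (n k) x)); last first.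
  by apply/funext => x; rewrite mulrDl mulrA.
rewrite complex_integralD; last 2 first.
- by apply: cintegrableZ; exact: pairing_integrable.
- exact: pairing_integrable.
rewrite complex_integralZ; last exact: pairing_integrable.
by rewrite mulrDr mulrCA.
Qed.

Lemma nuclear_operator_linear b (f g : L0 m) : Hardy m p1%:E f -> Hardy m p1%:E g ->
  nuclear_operator (b *: f + g) = b *: nuclear_operator f + nuclear_operator g.
Proof.
move=> Hf Hg; apply: L0P.
have := Hardy_nuclear_operatorE (Hardy_comb b p1E Hf Hg).
rewrite (coefficient_linear b Hf Hg).
have Cf := admissible_coefficient Hf; have Cg := admissible_coefficient Hg.
rewrite (nuclear_sum_linear image_vector image_norm1_gt0 b Cf Cg) => e.
apply: ae_eq_trans e _; have := L0_combE b (nuclear_operator f) (nuclear_operator g).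
have := Hardy_nuclear_operatorE Hf; have := Hardy_nuclear_operatorE Hg.
apply: filterS3 => x /(_ I) e1 /(_ I) e2 /(_ I) e3 _.
exact (esym (eq_trans e3 (congr2 (fun u v => b * u + v) e2 e1))).
Qed.

(** Since p1 <= p2 the sum space is H^p1. *)
Lemma nuclear_operator_on_sum :
  linear_operator_on (ns_sum (Hardy m p1%:E) (Hardy m p2)) nuclear_operator.
Proof.
have sumE f : ns_sum (Hardy m p1%:E) (Hardy m p2) f -> Hardy m p1%:E f.
  move=> [u [v [Hu Hv ->]]]; apply: HardyD => //.
  exact: Hardy_le p1E p12 Hv.
split => [f|b f g] /sumE Hf; last by move=> /sumE Hg; exact: nuclear_operator_linear.
have [M bM] := nuclear_operator_bounded (or_introl erefl) p1E (lexx _).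
exists (nuclear_operator f), 0; split; last by rewrite addr0.
  by have [] := bM _ Hf.
by apply: Hardy0; exact: le_trans p1E p12.
Qed.

Hypothesis n_inj : injective n.
Variable p : R.
Hypotheses (p1p : p1 <= p).
Hypothesis large : forall k, ((4 ^+ k.+1)%:E * Lp_norm m p%:E (@pair_prod R (n k)) <=
      (a k * 2 ^+ (n k))%:E * Lp_norm m p%:E (image_vector k))%E.

(** Test functions: [pair_prod (n k)] is mapped to the k-th term alone, and the
weight 2 ^ -(k+1) against the gain 4 ^ (k+1) leaves 2 ^ (k+1). *)
Lemma nuclear_operator_unbounded :
  ~ bounded_from_to (Hardy m p%:E) (Hardy m p%:E) nuclear_operator.
Proof.
move=> [M bM].
have pge1 : 1 <= p by exact: le_trans p11 p1p.
have pE : (1 <= p%:E)%E by rewrite lee_fin.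
suff key k : 2 ^+ k.+1 <= M.
  have := key (Num.truncn M); apply/negP; rewrite -ltNge.
  have M0 : 0 <= M by apply: le_trans (key 0%N); rewrite exprn_ge0.
  have /andP[_ h] := truncn_itv M0; apply: (lt_trans h).
  by rewrite -natrX ltr_nat ltn_expl.
have mF : measurable_fun setT (@pair_prod R (n k)) by exact: measurable_pair_prod.
have eF := L0_classE m mF; set f := L0_class m mF in eF.
have [x x0 xE] : exists2 x, 0 < x & Lp_norm m p%:E (@pair_prod R (n k)) = x%:E.
  exists (pair_norm m p ^+ n k); last exact: Lp_norm_pair_prod.
  exact: exprn_gt0 (pair_norm_gt0 hm pge1).
have Hf : Hardy m p%:E f.
  apply: (Hardy_ae pE mF eF); first by rewrite xE ltry.
  exact: analytic_pair_prod.
have Hf1 : Hardy m p1%:E f by apply: Hardy_le p1E _ Hf; rewrite lee_fin.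
have [[Afp _]] := bM _ Hf.
rewrite /= (ae_eq_Lp_norm pE (measurable_L0 f) mF eF) xE /=.
have coefE j : coefficient f j = if j == k then (a k * 2 ^+ n k)%:C else 0.
  rewrite (ae_coefficient (measurable_L0 f) mF eF) /coefficient; case: eqVneq => [->|jk].
    by rewrite pairing_pair_prod_diag// -rmorphM.
  by rewrite pairing_pair_prod_off_diag ?mulr0// (inj_eq n_inj) eq_sym.
have := Hardy_nuclear_operatorE Hf1.
rewrite (@nuclear_sum_single _ _ _ _ k); last by move=> j /negbTE jk; rewrite coefE jk.
rewrite coefE eqxx => e.
have eg : (nuclear_operator f : Tinf -> R[i]) =
    (fun x => (weight R k)%:C * (a k * 2 ^+ n k)%:C * image_vector k x) %[ae m].
  move: e (ae_cut measurable_image_vector image_norm1_gt0 image_vector_le k).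
  by apply: filterS2 => t /(_ I) -> -> _.
have mwk : measurable_fun setT
    (fun x => (weight R k)%:C * (a k * 2 ^+ n k)%:C * image_vector k x).
  by apply: measurable_complexM; [exact: measurable_cst|exact: measurable_image_vector].
move: Afp; rewrite (ae_eq_Lp_norm pE (measurable_L0 _) mwk eg).
rewrite (Lp_normZ _ _ pE (measurable_image_vector k)) -rmorphM normc_real.
have wk := weight_gt0 R k.
rewrite ger0_norm; last by rewrite !mulr_ge0 ?exprn_ge0 ?(ltW wk) ?(ltW (a0 k)).
have := large k; rewrite xE EFinM -EFinM.
have := Lp_norm_ge0 m p%:E (image_vector k).
case: (Lp_norm m p%:E (image_vector k)) => [y||] //; last first.
  move=> _ _; rewrite mulry gtr0_sg ?mul1e//.
  by rewrite !mulr_gt0 ?exprn_gt0.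
rewrite -!EFinM !lee_fin => y0 h _ /= h'.
have : weight R k * (4 ^+ k.+1 * x) <= M * x.
  apply: le_trans h'; rewrite -mulrA; apply: ler_wpM2l => //; exact: ltW.
rewrite mulrA ler_pM2r// /weight -exprMn (_ : 2^-1 * 4 = 2)//.
by field.
Qed.

End counterexample.

Local Open Scope ereal_scope.

Theorem corollary1p2 (R : realType) (m : probability (Tinf R) R)
    (hm : is_haar_Tinf m) (p1 p p2 : \bar R)
    (hp1 : 1 <= p1) (hp1p : p1 < p) (hpp2 : p < p2) :
  ~ interpolation_space (Hardy m p1) (Hardy m p2) (Hardy m p).
Proof.
case: p1 hp1 hp1p => [p1| |]//; last by move=> _; rewrite ltNge leey.
case: p hpp2 => [p| |]//; last by rewrite ltNge leey.
rewrite lee_fin lte_fin => pp2 p11 p1p.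
have [n [N [a [n_inj N0 a0 bound large]]]] := building_blocks hm p11 p1p pp2.
have p1p2 : p1%:E <= p2 by rewrite (le_trans _ (ltW pp2))// lee_fin ltW.
have p2E : 1 <= p2 by rewrite (le_trans _ p1p2)// lee_fin.
move=> [_ _ /(_ (@nuclear_operator R m n N a))] interp.
apply: (nuclear_operator_unbounded hm N0 a0 p11 bound n_inj (ltW p1p) large).
apply: interp.
- exact: (nuclear_operator_on_sum hm N0 a0 p11 p1p2 bound).
- by apply: (nuclear_operator_bounded hm N0 a0 p11 bound) => //; left.
- by apply: (nuclear_operator_bounded hm N0 a0 p11 bound) => //; right.
Qed.
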